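(* Let $(\mathcal{P}_+,\diamond)$ be a regular generalized convolution algebra, let $\lambda\in\mathcal{P}_+$ be $\diamond$-infinitely decomposable, and let $X=\{X_t:t\ge0\}$ be the corresponding $\diamond$-Lévy process associated with $\lambda$. For every $f\in\mathcal{A}_\lambda$ there exists a (nonhomogeneous) Markov process $Y=\{Y_t:t\ge0\}$ with transition probabilities $\delta_x\diamond P^f_{s,t}$, $0\le s<t$, $x\ge 0$, where $P^f_{s,t}\in\mathcal{P}_+$ is the measure whose $\diamond$-generalized characteristic function is $\Psi(f,s,t,\cdot)$. The process $Y$ is a $\diamond$-additive process (denoted $Y_t=\diamond\int_0^t f(s)\,\mathrm{d}X_s$, $t\ge0$).
   Context: **Notation.** $\mathcal{P}_+$ is the set of Borel probability measures on $[0,\infty)$; $T_a\lambda$ is the law of $aX$ if $\mathcal{L}(X)=\lambda$; $\to$ is weak convergence. **Generalized convolution.** A binary, commutative, associative operation $\diamond$ on $\mathcal{P}_+$ such that: (i) $\lambda\diamond\delta_0=\lambda$; (ii) $(p\lambda_1+(1-p)\lambda_2)\diamond\lambda=p(\lambda_1\diamond\lambda)+(1-p)(\lambda_2\diamond\lambda)$ for $p\in[0,1]$; (iii) $T_a(\lambda_1\diamond\lambda_2)=(T_a\lambda_1)\diamond(T_a\lambda_2)$ for $a\ge0$; (iv) $\lambda_n\to\lambda$, $\nu_n\to\nu$ imply $\lambda_n\diamond\nu_n\to\lambda\diamond\nu$; (v) there are $c_n>0$ such that $T_{c_n}\delta_1^{\diamond n}$ converges weakly to a measure $\nu\neq\delta_0$.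 **Regularity and generalized characteristic functions.** $(\mathcal{P}_+,\diamond)$ is regular if there is a weakly continuous $h:\mathcal{P}_+\to\mathbb{R}$, $h\not\equiv0$, $h\not\equiv1$, with $h(a\lambda_1+(1-a)\lambda_2)=ah(\lambda_1)+(1-a)h(\lambda_2)$ for $a\in[0,1]$ and $h(\lambda_1\diamond\lambda_2)=h(\lambda_1)h(\lambda_2)$. Fix such $h$, put $\Omega(t)=h(\delta_t)$, and define the $\diamond$-generalized characteristic function of $\lambda$ by $\Phi_\lambda(t)=h(T_t\lambda)=\int_0^\infty\Omega(tx)\,\lambda(\mathrm{d}x)$, $t\ge0$. Known facts (Urbanik): $\lambda\mapsto\Phi_\lambda$ is one-to-one, $\Phi_{\lambda\diamond\nu}=\Phi_\lambda\Phi_\nu$, and uniform convergence of $\Phi_{\lambda_n}$ to $\Phi_\lambda$ on bounded intervals is equivalent to $\lambda_n\to\lambda$. The characteristic exponent $\varkappa=\varkappa(\diamond)$ is the largest $p>0$ such that $t\mapsto e^{-t^p}$ is a $\diamond$-generalized characteristic function (it exists, and $e^{-t^p}$ is one for every $p\in(0,\varkappa]$). **Infinite decomposability.** $\lambda$ is $\diamond$-infinitely decomposable if for each $n$ there is $\lambda_n\in\mathcal{P}_+$ with $\lambda=\lambda_n^{\diamond n}$. Known (Urbanik): this holds iff $$\Phi_\lambda(t)=\exp\Big\{-At^{\varkappa}-\int_0^\infty\frac{1-\Omega(tx)}{\upsilon(x)}\,m(\mathrm{d}x)\Big\}$$ for some $A\ge0$ and some finite Borel measure $m$ on $[0,\infty)$,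 where $\upsilon(x)=1-\Omega(x)$ for $0\le x\le x_0$, $\upsilon(x)=1-\Omega(x_0)$ for $x\ge x_0$, and $x_0>0$ is such that $\Omega(x)<1$ for $0<x\le x_0$. Integrals against $m(\mathrm{d}x)/\upsilon(x)$ are taken over $(0,\infty)$ (an atom of $m$ at $0$ being absorbed in $A$). There is then a family $\{\lambda^{\diamond r}\}_{r\ge0}$ with $\lambda^{\diamond0}=\delta_0$, $\lambda^{\diamond1}=\lambda$, $\lambda^{\diamond r}\diamond\lambda^{\diamond s}=\lambda^{\diamond(r+s)}$, $\lambda^{\diamond r}\to\delta_0$ as $r\downarrow0$. **Processes.** A $\diamond$-additive process is a Markov process in $[0,\infty)$ with transition probabilities $\delta_x\diamond\lambda_{s,t}$, $s<t$, for some family $\{\lambda_{s,t}:0\le s<t\}\subset\mathcal{P}_+$ with $\lambda_{s,t}\diamond\lambda_{t,u}=\lambda_{s,u}$ for all $s<t<u$. The $\diamond$-Lévy process associated with $\lambda$ is the $\diamond$-additive process with $\lambda_{s,t}=\lambda^{\diamond(t-s)}$. **Class $\mathcal{A}_\lambda$ and $\Psi$.** Let $\lambda$ be $\diamond$-infinitely decomposable, and let $A\ge0$ and the finite Borel measure $m$ on $[0,\infty)$ be such that $\Phi_\lambda(t)=\exp\big\{-At^{\varkappa}-\int_0^\infty\frac{1-\Omega(tx)}{\upsilon(x)}\,m(\mathrm{d}x)\big\}$ for all $t\ge0$. Then $\mathcal{A}_\lambda$ is the class of nonnegative measurable functions $f$ on $[0,\infty)$, bounded on compact intervals, such that for all $t,u>0$: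 $\int_0^tf(x)^{\varkappa}\,\mathrm{d}x<\infty$ and $\int_0^\infty\int_0^t\frac{1-\Omega(uf(x)r)}{\upsilon(r)}\,\mathrm{d}x\,m(\mathrm{d}r)<\infty$. For $f\in\mathcal{A}_\lambda$, $0\le s<t$, $u\ge0$, $$\Psi(f,s,t,u)=\exp\Big\{-Au^{\varkappa}\int_s^tf(x)^{\varkappa}\,\mathrm{d}x-\int_0^\infty\int_s^t\frac{1-\Omega(uf(x)r)}{\upsilon(r)}\,\mathrm{d}x\,m(\mathrm{d}r)\Big\}.$$ As a function of $u$, $\Psi(f,s,t,\cdot)$ is the $\diamond$-generalized characteristic function of a unique measure $P^f_{s,t}\in\mathcal{P}_+$. *)

(* Defs.v *)
From HB Require Import structures.
From mathcomp Require Import all_boot all_order all_algebra.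
From mathcomp Require Import all_classical all_reals all_analysis.
From mathcomp Require Import measurable_realfun.

Set Implicit Arguments.
Unset Strict Implicit.
Unset Printing Implicit Defensive.

Import Order.TTheory GRing.Theory Num.Theory.
Import numFieldNormedType.Exports.

Local Open Scope classical_set_scope.
Local Open Scope ring_scope.

(* Probability measures on [0, +oo[ are represented as Borel probability
   measures on the line that are carried by [0, +oo[. *)
Record Pplus (R : realType) := MkPplus {
  Pplus_prob :> probability R R ;
  Pplus_carried : Pplus_prob `[0, +oo[%classic = 1%E }.

(* Two library measures may differ on non-measurable sets, where they carry no
   information, so equality of elements of [Pplus R] is equality on Borel sets.
   Every operation below that is assumed weakly continuous respects it. *)
Definition eq_Pplus (R : realType) (mu nu : Pplus R) :=
  forall B : set R, measurable B -> mu B = nu B.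

Notation "mu =P+ nu" := (eq_Pplus mu nu) (at level 70, no associativity).

Section Pplus_constructions.
Context {R : realType}.

Lemma dirac_carried (x : R) : (dirac `|x| : probability R R) `[0, +oo[%classic = 1%E.
Proof. by rewrite /= diracE mem_set//= in_itv/= andbT. Qed.

(* The point mass at [x], meant for [0 <= x]; the absolute value only makes it
   total. *)
Definition delta (x : R) : Pplus R := MkPplus (dirac_carried x).

Definition scale_fun (a x : R) : R := `|a| * x.

Lemma measurable_scale_fun (a : R) : measurable_fun setT (scale_fun a).
Proof. exact: mulrl_measurable. Qed.

HB.instance Definition _ (a : R) :=
  isMeasurableFun.Build _ _ _ _ (scale_fun a) (measurable_scale_fun a).

Lemma scale_carried (a : R) (mu : Pplus R) :
  (distribution mu (scale_fun a) : probability R R) `[0, +oo[%classic = 1%E.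
Proof.
apply/eqP; rewrite eq_le probability_le1 //= -(Pplus_carried mu).
apply: le_measure; rewrite ?inE //.
- rewrite -[X in measurable X]setTI; exact: measurable_scale_fun.
- by move=> x /=; rewrite !in_itv/= !andbT => x0; rewrite mulr_ge0.
Qed.

(* The law of [a X] when [X] has law [mu], meant for [0 <= a]; the absolute
   value in [scale_fun] only makes it total. *)
Definition scale (a : R) (mu : Pplus R) : Pplus R :=
  MkPplus (scale_carried a mu).

(* [rho] is the mixture [p mu + (1 - p) nu]. *)
Definition is_mixture (p : R) (mu nu rho : Pplus R) :=
  forall B : set R, measurable B ->
    rho B = (p%:E * mu B + (1 - p)%:E * nu B)%E.

Definition weak_cvg {I : Type} (F : set_system I) (mu_ : I -> Pplus R)
    (mu : Pplus R) :=
  forall g : R -> R, continuous g -> (exists M, forall x, `|g x| <= M) ->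
    \int[mu_ i]_x g x @[i --> F] --> \int[mu]_x g x.

End Pplus_constructions.

Section generalized_convolution.
Context {R : realType}.
Variable op : Pplus R -> Pplus R -> Pplus R.

(* [n]-fold power; the 0-th power is [delta 0], the neutral element. *)
Definition gpow (mu : Pplus R) (n : nat) : Pplus R := iter n (op mu) (delta 0).

Record generalized_convolution : Prop := {
  gc_comm : forall mu nu, op mu nu =P+ op nu mu ;
  gc_assoc : forall mu nu rho, op mu (op nu rho) =P+ op (op mu nu) rho ;
  gc_unit : forall mu, op mu (delta 0) =P+ mu ;
  gc_mixture : forall p mu1 mu2 mu12 nu, 0 <= p <= 1 ->
    is_mixture p mu1 mu2 mu12 ->
    is_mixture p (op mu1 nu) (op mu2 nu) (op mu12 nu) ;
  gc_scale : forall a mu nu, 0 <= a ->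
    scale a (op mu nu) =P+ op (scale a mu) (scale a nu) ;
  gc_continuous : forall (mu_ nu_ : nat -> Pplus R) mu nu,
    weak_cvg \oo mu_ mu -> weak_cvg \oo nu_ nu ->
    weak_cvg \oo (fun n => op (mu_ n) (nu_ n)) (op mu nu) ;
  gc_limit : exists (c : nat -> R) (nu : Pplus R),
    [/\ forall n, 0 < c n,
        weak_cvg \oo (fun n => scale (c n) (gpow (delta 1) n)) nu &
        ~ (nu =P+ delta 0)] }.

(* The algebra is regular when some [h] satisfies this predicate. *)
Record regular_homomorphism (h : Pplus R -> R) : Prop := {
  rh_continuous : forall (mu_ : nat -> Pplus R) mu,
    weak_cvg \oo mu_ mu -> h (mu_ n) @[n --> \oo] --> h mu ;
  rh_neq0 : exists mu, h mu <> 0 ;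
  rh_neq1 : exists mu, h mu <> 1 ;
  rh_mixture : forall a mu nu rho, 0 <= a <= 1 ->
    is_mixture a mu nu rho -> h rho = a * h mu + (1 - a) * h nu ;
  rh_mul : forall mu nu, h (op mu nu) = h mu * h nu }.

Definition infinitely_decomposable (mu : Pplus R) :=
  forall n, (0 < n)%N -> exists mu_n, mu =P+ gpow mu_n n.

(* The family of powers [mu ^ r], [r >= 0]. *)
Definition power_family (mu : Pplus R) (mu_ : R -> Pplus R) :=
  [/\ mu_ 0 =P+ delta 0,
      mu_ 1 =P+ mu,
      forall r s, 0 <= r -> 0 <= s -> op (mu_ r) (mu_ s) =P+ mu_ (r + s) &
      weak_cvg (0 : R)^'+ mu_ (delta 0)].

End generalized_convolution.

Section characteristic_function.
Context {R : realType}.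
Variable h : Pplus R -> R.

Definition Omega (t : R) : R := h (delta t).

Definition Phi (mu : Pplus R) (t : R) : R := h (scale t mu).

Definition is_gcf (phi : R -> R) :=
  exists mu : Pplus R, forall t, 0 <= t -> Phi mu t = phi t.

Definition is_characteristic_exponent (kappa : R) :=
  [/\ 0 < kappa,
      is_gcf (fun t => expR (- (t `^ kappa))) &
      forall p, 0 < p -> is_gcf (fun t => expR (- (t `^ p))) -> p <= kappa].

Definition upsilon (x0 x : R) : R := 1 - Omega (Num.min x x0).

(* Exponents are extended-real: the integrals are of nonnegative functions and
   [expeR -oo = 0]. *)
Definition levy_khintchine (kappa x0 : R) (mu : Pplus R) (A : R)
    (m : {finite_measure set R -> \bar R}) :=
  [/\ 0 <= A,
      m `]-oo, 0[%classic = 0%E &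
      forall t, 0 <= t ->
        (Phi mu t)%:E =
        expeR (- (A * t `^ kappa)%:E -
               \int[m]_(x in `]0%R, +oo[)
                 ((1 - Omega (t * x)) / upsilon x0 x)%:E)%E].

Definition class_A (kappa x0 : R) (m : {finite_measure set R -> \bar R})
    (f : R -> R) :=
  [/\ forall x, 0 <= x -> 0 <= f x,
      measurable_fun (`[0, +oo[%classic : set R) f,
      forall a b, 0 <= a -> exists K, forall x, a <= x <= b -> f x <= K,
      forall t, 0 < t ->
        (\int[lebesgue_measure]_(x in `[0%R, t]) (f x `^ kappa)%:E < +oo)%E &
      forall t u, 0 < t -> 0 < u ->
        (\int[m]_(r in `]0%R, +oo[) \int[lebesgue_measure]_(x in `[0%R, t])
           ((1 - Omega (u * f x * r)) / upsilon x0 r)%:E < +oo)%E].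

Definition Psi (kappa x0 A : R) (m : {finite_measure set R -> \bar R})
    (f : R -> R) (s t u : R) : \bar R :=
  expeR (- ((A * u `^ kappa)%:E *
            \int[lebesgue_measure]_(x in `[s, t]) (f x `^ kappa)%:E) -
         \int[m]_(r in `]0%R, +oo[) \int[lebesgue_measure]_(x in `[s, t])
           ((1 - Omega (u * f x * r)) / upsilon x0 r)%:E)%E.

End characteristic_function.

Section processes.
Context {R : realType}.

(* [p s t x] is the law at time [t] of the process that is at [x] at time [s],
   for [0 <= s < t] and [0 <= x]. *)
Record transition_function (p : R -> R -> R -> Pplus R) : Prop := {
  tf_measurable : forall s t (B : set R), 0 <= s -> s < t -> measurable B ->
    measurable_fun (`[0, +oo[%classic : set R) (fun x => p s t x B) ;
  tf_chapman_kolmogorov : forall s t u x (B : set R),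
    0 <= s -> s < t -> t < u -> 0 <= x -> measurable B ->
    p s u x B = (\int[p s t x]_(y in `[0%R, +oo[) p t u y B)%E }.

Section process.
Context {d : measure_display} {T : measurableType d} {P : probability T R}.
(* Only the times [0 <= t] are meaningful. *)
Variable Y : R -> {RV P >-> R}.

Definition past (s : R) : set (set T) :=
  <<s [set E | exists r (B : set R),
         [/\ 0 <= r <= s, measurable B & E = Y r @^-1` B]] >>.

(* The Markov property says that [p s t (Y s) B] is a version of
   [P (Y t \in B | past s)]. *)
Record markov_process (p : R -> R -> R -> Pplus R) : Prop := {
  mp_ge0 : forall t w, 0 <= t -> 0 <= Y t w ;
  mp_transition : transition_function p ;
  mp_markov : forall s t (E : set T) (B : set R),
    0 <= s -> s < t -> past s E -> measurable B ->
    P (E `&` Y t @^-1` B) = (\int[P]_(w in E) p s t (Y s w) B)%E }.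

Definition additive_process_with (op : Pplus R -> Pplus R -> Pplus R)
    (mu : R -> R -> Pplus R) :=
  (forall s t u, 0 <= s -> s < t -> t < u ->
     op (mu s t) (mu t u) =P+ mu s u) /\
  markov_process (fun s t x => op (delta x) (mu s t)).

Definition additive_process (op : Pplus R -> Pplus R -> Pplus R) :=
  exists mu : R -> R -> Pplus R, additive_process_with op mu.

Definition levy_process (op : Pplus R -> Pplus R -> Pplus R) (mu : Pplus R) :=
  exists mu_ : R -> Pplus R,
    power_family op mu mu_ /\
    additive_process_with op (fun s t => mu_ (t - s)).

Definition has_initial_law (nu : Pplus R) :=
  forall B : set R, measurable B -> distribution P (Y 0) B = nu B.

End process.
End processes.

(* Main.v *)
From HB Require Import structures.
Require Import Defs.
From mathcomp Require Import all_boot all_order all_algebra.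
From mathcomp Require Import all_classical all_reals all_analysis.
From mathcomp Require Import measurable_realfun.
From mathcomp Require Import lra ring.

Set Implicit Arguments.
Unset Strict Implicit.
Unset Printing Implicit Defensive.

Import Order.TTheory GRing.Theory Num.Theory.
Import numFieldNormedType.Exports.

Local Open Scope classical_set_scope.
Local Open Scope ring_scope.

(** The proof has an analytic half, which produces the measures whose
    characteristic function is Psi, and a probabilistic half, which turns them
    into a process.

    Analytic half.  Write [e] for the exponent of [lambda], so that
    [Phi h lambda u = exp (- e u)], and let [nu_N] be an [N]-th convolution
    root of [lambda] with nonnegative characteristic function
    ([convolution_roots]).  Pick a time [tau] uniformly in an interval of
    integer length [K] that starts at [s] and contains [t], and independently [Z]
    with law [nu_N]; let [rho_N] be the law of [g tau * Z], where [g] is [f] set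
    to [0] outside the interval from [s] to [t].  Since
    [Phi h nu_N = exp (- e / N)], averaging over [tau] gives
    [N * (1 - Phi h rho_N u) --> (1 / K) * \int_s^t e (u * f x) dx], so the
    characteristic function of the [N K]-fold power of [rho_N] converges to
    [exp (- \int_s^t e (u * f x) dx)] ([gcf_time_integral]), which is Psi by
    Tonelli's theorem ([Psi_levy_exponent]).

    The limit is a characteristic function by a continuity theorem, [gcf_closed],
    and [Phi h mu] determines [mu] ([Phi_inj]).  Both facts rest on the measure
    [sigma] with characteristic function [exp (- t ^ kappa)]: by Fubini's
    theorem, integrating [Phi h mu (u * s)] over [sigma] gives
    [\int exp (- (u * x) ^ kappa) mu (dx)].  Powers of [exp (- x ^ kappa)] are
    rescalings of it, so these transforms give the integrals of all polynomials
    in that exponential.  For [a < b], explicit such polynomials are close to [1] on arguments up to [a] and close to [0] beyond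
    [b] ([separating_polynomial]), so the transforms control distribution
    functions; compactness is Helly's theorem, obtained here by
    taking limits of quantile functions ([helly]).

    Probabilistic half.  An affine weakly continuous functional of a law is the
    integral of its values at point masses ([affine_integral]).  Applied to
    [nu |-> \int g d(op nu mu)], this says that [x |-> op (delta x) mu] is a
    kernel which represents the convolution with [mu] ([conv_integral]), so the
    semigroup property of the measures, itself a consequence of [Phi_inj],
    becomes the Chapman-Kolmogorov equation ([additive_transition_function]).
    A Markov process with a given transition function and initial law exists by
    Kolmogorov's extension argument ([markov_process_exists]): on finitely many
    times it is built from independent uniform variables by quantile
    transforms ([chain_exists]), and the whole process is coded by the events
    [Y t < q] with [q] rational, that is, by a point of the compact space of
    functions from pairs [(t, q)] to [bool], where cylinder sets are open and
    closed, so that finitely additive contents are countably additive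
    ([cylinder_extension]). *)

(** * Integrals of bounded functions *)

Section bounded_integrals.
Context {R : realType} {d : measure_display} {T : measurableType d}.
Variable P : probability T R.
Implicit Types (g : T -> R) (M : R).

Lemma bounded_integrable g M : measurable_fun setT g ->
  (forall x, `|g x| <= M) -> P.-integrable setT (EFin \o g).
Proof.
move=> mg gM; apply: measurable_bounded_integrable => //.
  by rewrite -ge0_fin_numE//; exact: fin_num_measure.
by exists M; split; [rewrite num_real|move=> y My x _ /=; rewrite (le_trans (gM x))// ltW].
Qed.

Lemma bounded_RintegralE g M : measurable_fun setT g ->
  (forall x, `|g x| <= M) ->
  (\int[P]_x g x)%:E = (\int[P]_x (g x)%:E)%E.
Proof.
move=> mg gM; rewrite /Rintegral fineK//.
by apply: integrable_fin_num => //; exact: bounded_integrable gM.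
Qed.

Lemma bounded_cvg_ae (g_ : nat -> T -> R) g M :
  (forall n, measurable_fun setT (g_ n)) -> measurable_fun setT g ->
  (forall n x, `|g_ n x| <= M) -> (forall x, `|g x| <= M) ->
  {ae P, forall x, g_ n x @[n --> \oo] --> g x} ->
  \int[P]_x g_ n x @[n --> \oo] --> \int[P]_x g x.
Proof.
move=> mg_ mg g_M gM g_g; apply: fine_cvg.
have key : (\int[P]_x (g_ n x)%:E)%E @[n --> \oo] --> (\int[P]_x (g x)%:E)%E.
  have [//|||||_ _] := @dominated_convergence _ _ _ P setT measurableT
    (fun n x => (g_ n x)%:E) (fun x => (g x)%:E) (cst M%:E).
  - by move=> n; exact/measurable_EFinP.
  - exact/measurable_EFinP.
  - by apply: filterS g_g => x gx _; by apply: cvg_EFin => //; exact: nearW.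
  - by have := @finite_measure_integrable_cst _ _ _ P setT M measurableT.
  - by apply: aeW => x n _ /=; rewrite lee_fin.
  by [].
by rewrite -/(Rintegral _ _ _) (bounded_RintegralE mg gM).
Qed.
End bounded_integrals.

Lemma Rintegral_norm_le {R : realType} {d} {T : measurableType d}
    (P : probability T R) (g : T -> R) (M : R) :
  measurable_fun setT g -> (forall x, `|g x| <= M) -> `|\int[P]_x g x| <= M.
Proof.
move=> mg gM; have ig := bounded_integrable P mg gM.
apply: (le_trans (le_normr_Rintegral measurableT ig)).
have -> : M = \int[P]_x M.
  by rewrite Rintegral_cst// [X in fine X]probability_setT mulr1.
apply: le_Rintegral => //; last exact: finite_measure_integrable_cst.
apply: (@bounded_integrable _ _ _ _ _ M); first exact: measurableT_comp.
by move=> x; rewrite normr_id.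
Qed.

Section bounded_fubini.
Context {R : realType} {d1 d2 : measure_display}
  {T1 : measurableType d1} {T2 : measurableType d2}.
Variables (P1 : probability T1 R) (P2 : probability T2 R).
Variables (g : T1 * T2 -> R) (M : R).
Hypotheses (mg : measurable_fun setT g) (gM : forall z, `|g z| <= M).

Let mg1 x : measurable_fun setT (fun y => g (x, y)).
Proof. exact: (measurableT_comp mg (pair1_measurable x)). Qed.

Let mg2 y : measurable_fun setT (fun x => g (x, y)).
Proof. exact: (measurableT_comp mg (pair2_measurable y)). Qed.

Let ig : (P1 \x P2)%E.-integrable setT (EFin \o g).
Proof. exact: (bounded_integrable _ mg gM). Qed.

Lemma bounded_fubini_measurable1 : measurable_fun setT (fun x => \int[P2]_y g (x, y)).
Proof. by apply: measurableT_comp => //; exact: (measurable_fubini_F ig). Qed.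

Lemma bounded_fubini_measurable2 : measurable_fun setT (fun y => \int[P1]_x g (x, y)).
Proof. by apply: measurableT_comp => //; exact: (measurable_fubini_G ig). Qed.

Lemma bounded_Rintegral_prod12 :
  \int[(P1 \x P2)%E]_z g z = \int[P1]_x \int[P2]_y g (x, y).
Proof.
apply: EFin_inj; rewrite (@bounded_RintegralE _ _ _ P1 _ M); last 2 first.
- exact: bounded_fubini_measurable1.
- by move=> x; exact: Rintegral_norm_le.
under eq_integral do rewrite (bounded_RintegralE _ (mg1 _) (fun y => gM (_, y))).
rewrite (integral12_prod_meas1 ig); exact: (bounded_RintegralE _ mg gM).
Qed.

Lemma bounded_Rintegral_prod21 :
  \int[(P1 \x P2)%E]_z g z = \int[P2]_y \int[P1]_x g (x, y).
Proof.
apply: EFin_inj; rewrite (@bounded_RintegralE _ _ _ P2 _ M); last 2 first.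
- exact: bounded_fubini_measurable2.
- by move=> x; exact: Rintegral_norm_le.
under eq_integral do rewrite (bounded_RintegralE _ (mg2 _) (fun y => gM (y, _))).
rewrite (integral21_prod_meas1 ig); exact: (bounded_RintegralE _ mg gM).
Qed.

Lemma bounded_Fubini :
  \int[P1]_x \int[P2]_y g (x, y) = \int[P2]_y \int[P1]_x g (x, y).
Proof. by rewrite -bounded_Rintegral_prod12 bounded_Rintegral_prod21. Qed.

End bounded_fubini.

(** * Laws on the half-line *)
Section Pplus_basics.
Context {R : realType}.
Implicit Types mu nu rho : Pplus R.

Lemma eq_Pplus_refl mu : mu =P+ mu. Proof. by []. Qed.

Lemma eq_Pplus_sym mu nu : mu =P+ nu -> nu =P+ mu.
Proof. by move=> h B mB; rewrite h. Qed.

Lemma eq_Pplus_trans mu nu rho : mu =P+ nu -> nu =P+ rho -> mu =P+ rho.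
Proof. by move=> h1 h2 B mB; rewrite h1// h2. Qed.

Lemma eq_Pplus_integral mu nu (D : set R) (g : R -> \bar R) : mu =P+ nu ->
  (\int[mu]_(x in D) g x = \int[nu]_(x in D) g x)%E.
Proof. by move=> h; apply: eq_measure_integral => A mA _; exact: h. Qed.

Lemma eq_Pplus_Rintegral mu nu (g : R -> R) : mu =P+ nu ->
  \int[mu]_x g x = \int[nu]_x g x.
Proof. by move=> h; rewrite /Rintegral (eq_Pplus_integral _ _ h). Qed.

Lemma Pplus_lt0 mu : mu `]-oo, 0[%classic = 0%E.
Proof.
have -> : (`]-oo, 0[%classic : set R) = ~` `[0, +oo[%classic by rewrite setCitvr.
by rewrite probability_setC ?Pplus_carried ?subee.
Qed.

Lemma eq_Pplus_cdf mu nu :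
  (forall a, 0 <= a -> mu `]-oo, a]%classic = nu `]-oo, a]%classic) ->
  mu =P+ nu.
Proof.
move=> h.
have {}h a : mu `]-oo, a]%classic = nu `]-oo, a]%classic.
  have [/h//|a0] := leP 0 a.
  have sub : (`]-oo, a]%classic : set R) `<=` `]-oo, 0[%classic.
    by apply: subset_itvl; rewrite bnd_simp.
  by rewrite (subset_measure0 _ _ sub (Pplus_lt0 mu))//
             (subset_measure0 _ _ sub (Pplus_lt0 nu)).
move=> B mB.
apply: (@measure_unique _ R R [set A | exists a : R, A = `]-oo, a]%classic]
  (fun n : nat => `]-oo, n%:R]%classic)) => //.
- rewrite eqEsubset; split => //; last first.
    apply: smallest_sub; first exact: sigma_algebra_measurable.
    by move=> _ [a ->]; exact: measurable_itv.
  suff : (@RGenOInfty.G R).-sigma.-measurable `<=`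
      <<s [set A | exists a : R, A = `]-oo, a]%classic] >>.
    by rewrite -RGenOInfty.measurableE.
  apply: smallest_sub; first exact: smallest_sigma_algebra.
  move=> _ [a ->]; rewrite -setCitvl -setTD.
  have [_ + _] := @smallest_sigma_algebra R setT
    [set A | exists a : R, A = `]-oo, a]%classic].
  by apply; apply: sub_sigma_algebra; exists a.
- move=> _ _ [a ->] [b ->]; exists (Num.min a b).
  apply/seteqP; split => x /=; rewrite !in_itv/= le_min; first by move=> [-> ->].
  by move=> /andP.
- by move=> n; exists n%:R.
- apply/seteqP; split => // x _; exists (Num.truncn `|x|).+1 => //=.
  by rewrite in_itv/= (le_trans (ler_norm _))// ltW// truncnS_gt.
- by move=> A [a ->]; exact: h.
- move=> n; rewrite -ge0_fin_numE//; exact: fin_num_measure.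
Qed.

(** Normalizing a measure of total mass one packs it as a probability inside a
    proof, where no instance can be declared. *)
Lemma probability_of_measure d (T : measurableType d) (m : {measure set T -> \bar R}) :
  m setT = 1%E -> exists P : probability T R, forall B, P B = m B.
Proof.
move=> m1; pose P : probability T R := mnormalize m (dirac (point : T)).
by exists P => B; rewrite /P/= /mnormalize m1 onee_eq0/= invr1 mule1.
Qed.

Lemma Pplus_of_measure (m : {measure set R -> \bar R}) :
  m setT = 1%E -> m `[0, +oo[%classic = 1%E ->
  exists mu : Pplus R, forall B, mu B = m B.
Proof.
move=> m1 m0; have [P0 PE] := probability_of_measure m1.
have P01 : P0 `[0, +oo[%classic = 1%E by rewrite PE.
by exists (MkPplus P01).
Qed.

Lemma mixture_exists (p : R) mu nu : 0 <= p <= 1 -> exists rho, is_mixture p mu nu rho.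
Proof.
move=> /andP[p0 p1]; have q0 : 0 <= 1 - p by rewrite subr_ge0.
pose m := measure_add (mscale (NngNum p0) mu) (mscale (NngNum q0) nu).
have mE B : m B = (p%:E * mu B + (1 - p)%:E * nu B)%E.
  by rewrite /m /= measure_addE.
have [||rho rhoE] := @Pplus_of_measure m.
- apply: (etrans (mE _)).
  by rewrite !probability_setT !mule1 -EFinD addrC subrK.
- apply: (etrans (mE _)).
  by rewrite !Pplus_carried !mule1 -EFinD addrC subrK.
by exists rho => B mB; rewrite rhoE; exact: mE.
Qed.

Lemma conditional_exists mu (D : set R) : measurable D -> mu D != 0%E ->
  exists nu : Pplus R, forall B, measurable B -> (mu (B `&` D) = mu D * nu B)%E.
Proof.
move=> mD D0.
have Dfin : mu D \is a fin_num by exact: fin_num_measure.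
have c0 : 0 <= (fine (mu D))^-1 by rewrite invr_ge0 fine_ge0.
have cE : ((fine (mu D))^-1%:E * mu D = 1)%E.
  by rewrite -{2}(fineK Dfin) -EFinM mulVf// fine_eq0.
pose m := mscale (NngNum c0) (mrestr mu mD).
have mE B : m B = ((fine (mu D))^-1%:E * mu (B `&` D))%E by [].
have [||nu nuE] := @Pplus_of_measure m.
- by apply: (etrans (mE _)); rewrite setTI.
- apply: (etrans (mE _)); rewrite -cE; congr (_ * _)%E.
  have := @measureDI _ _ _ mu D `[0, +oo[%classic mD (measurable_itv _).
  rewrite (@subset_measure0 _ _ _ mu (D `\` `[0, +oo[%classic) `]-oo, 0[%classic) ?add0e//.
  + by rewrite setIC => <-.
  + exact: measurableD.
  + by move=> x [_] /=; rewrite !in_itv/= andbT => /negP; rewrite -ltNge.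
  + exact: Pplus_lt0.
exists nu => B mB; rewrite nuE [X in (_ = _ * X)%E]mE muleA -{1}(fineK Dfin).
by rewrite -EFinM mulfV ?fine_eq0// mul1e.
Qed.

End Pplus_basics.

(** * Affine functionals of a law *)
Section weak_functionals.
Context {R : realType}.
Implicit Types (mu nu rho : Pplus R) (F : Pplus R -> R).

Definition affine F := forall a mu nu rho, 0 <= a <= 1 ->
  is_mixture a mu nu rho -> F rho = a * F mu + (1 - a) * F nu.

Definition weakly_continuous F := forall (mu_ : nat -> Pplus R) mu,
  weak_cvg \oo mu_ mu -> F (mu_ n) @[n --> \oo] --> F mu.

Lemma weak_cvg_cst mu nu : mu =P+ nu -> weak_cvg \oo (fun=> mu) nu.
Proof.
by move=> munu g _ _; rewrite (eq_Pplus_Rintegral _ munu); exact: cvg_cst.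
Qed.

(** A constant sequence converges weakly to anything equal to it on Borel sets;
    this is how every weakly continuous operation respects that equality. *)
Lemma weakly_continuous_eq F mu nu :
  weakly_continuous F -> mu =P+ nu -> F mu = F nu.
Proof.
move=> Fc /weak_cvg_cst/Fc h.
by apply: (cvg_unique _ _ h) => //; exact: cvg_cst.
Qed.

(** Shifting [g] by [M] reduces the claim to nonnegative functions, for which
    integration is additive in the measure. *)
Lemma mixture_Rintegral (p : R) mu nu rho (g : R -> R) (M : R) : 0 <= p <= 1 ->
  is_mixture p mu nu rho -> measurable_fun setT g -> (forall x, `|g x| <= M) ->
  \int[rho]_x g x = p * \int[mu]_x g x + (1 - p) * \int[nu]_x g x.
Proof.
move=> /andP[p0 p1] mix mg gM; have q0 : 0 <= 1 - p by rewrite subr_ge0.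
pose m := measure_add (mscale (NngNum p0) mu) (mscale (NngNum q0) nu).
have mE B : m B = (p%:E * mu B + (1 - p)%:E * nu B)%E.
  by rewrite /m /= measure_addE.
have M0 : 0 <= M by rewrite (le_trans _ (gM 0)).
pose g' x := g x + M.
have g'0 x : 0 <= g' x by have := gM x; rewrite ler_norml /g'; lra.
have mg' : measurable_fun setT g' by exact: measurable_funD.
have g'M x : `|g' x| <= M + M.
  by rewrite (le_trans (ler_normD _ _))// lerD// ger0_norm.
have key : \int[rho]_x g' x = p * \int[mu]_x g' x + (1 - p) * \int[nu]_x g' x.
  apply: EFin_inj; rewrite EFinD !EFinM !(bounded_RintegralE _ mg' g'M).
  have -> : (\int[rho]_x (g' x)%:E = \int[m]_x (g' x)%:E)%E.
    by apply: eq_measure_integral => A mA _; apply: (etrans (mix _ mA)); exact/esym/mE.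
  have eg' : measurable_fun setT (EFin \o g') by exact/measurable_EFinP.
  rewrite ge0_integral_measure_add//; first last.
    by move=> x _; rewrite lee_fin.
  rewrite (ge0_integral_mscale mu measurableT (NngNum p0))//; first last.
    by move=> x _; rewrite lee_fin.
  rewrite (ge0_integral_mscale nu measurableT (NngNum q0))//.
  by move=> x _; rewrite lee_fin.
have sh (P : Pplus R) : \int[P]_x g' x = \int[P]_x g x + M.
  rewrite /g' RintegralD//.
  - by rewrite Rintegral_cst// [X in fine X](probability_setT P) mulr1.
  - exact: bounded_integrable gM.
  - exact: finite_measure_integrable_cst.
move: key; rewrite !sh; lra.
Qed.

Lemma Rintegral_delta x (g : R -> R) : measurable_fun setT g ->
  \int[delta x]_y g y = g `|x|.
Proof.
move=> mg; rewrite /Rintegral/= integral_dirac//; last exact/measurable_EFinP.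
by rewrite diracT mul1e.
Qed.

Lemma weak_cvg_delta (x_ : nat -> R) x : x_ n @[n --> \oo] --> x ->
  weak_cvg \oo (fun n => delta (x_ n)) (delta x).
Proof.
move=> x_x g cg _; have mg := continuous_measurable_fun cg.
under eq_fun do rewrite Rintegral_delta//.
rewrite Rintegral_delta//.
apply: (cvg_comp _ _ (cvg_norm x_x)); exact: cg.
Qed.

Lemma weakly_continuous_delta F : weakly_continuous F ->
  continuous (fun x => F (delta x)).
Proof.
by move=> Fc x; apply/(@cvg_nbhsP _ R^o) => u ux; apply: Fc; exact: weak_cvg_delta.
Qed.

Lemma cvg_harmonic_le (u : nat -> R) (l K : R) :
  (forall n, `|u n - l| <= K * harmonic n) -> u n @[n --> \oo] --> l.
Proof.
move=> h; have hK : K * harmonic n @[n --> \oo] --> (0 : R).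
  by rewrite -(mulr0 K); apply: cvgMr; exact: cvg_harmonic.
apply/cvgrPdist_le => e e0; near=> n.
rewrite distrC (le_trans (h n))// (le_trans (ler_norm _))//.
rewrite -normrN -[X in `|X|]add0r; near: n.
by move/cvgrPdist_le : hK; exact.
Unshelve. all: by end_near. Qed.

(** If [F] were unbounded, choose [x_ n] with [n ^ 2 < |F (delta (x_ n))|] up to
    an index shift: the mixtures of [delta (x_ n)] and [delta 0] with weights
    [1 / n] and [1 - 1 / n] converge to [delta 0], whatever [x_] is, while the
    values of [F] at them blow up. *)
Lemma affine_delta_bounded F : affine F -> weakly_continuous F ->
  exists M : R, forall x : R, `|F (delta x)| <= M.
Proof.
move=> Fa Fc; apply: contrapT => nb.
have /choice[x_ x_P] : forall n : nat, exists x, n.+1%:R ^+ 2 < `|F (delta x)|.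
  move=> n; apply: contrapT => nx; apply: nb; exists (n.+1%:R ^+ 2) => x.
  by rewrite leNgt; apply/negP => h; apply: nx; exists x.
have h01 n : 0 <= (harmonic n : R) <= 1.
  by rewrite invr_ge0 ler0n/= invf_le1 ?ltr0n// ler1n.
have /choice[rho_ rho_P] : forall n, exists rho,
    is_mixture (harmonic n) (delta (x_ n)) (delta 0) rho.
  by move=> n; exact: mixture_exists.
have cvg_rho : weak_cvg \oo rho_ (delta 0).
  move=> g cg [M gM]; have mg := continuous_measurable_fun cg.
  apply: (@cvg_harmonic_le _ _ (M + M)) => n.
  rewrite (mixture_Rintegral (h01 n) (rho_P n) mg gM) !Rintegral_delta// normr0.
  have -> : harmonic n * g `|x_ n| + (1 - harmonic n) * g 0 - g 0 =
    (g `|x_ n| - g 0) * harmonic n by ring.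
  rewrite normrM (ger0_norm (proj1 (andP (h01 n)))) ler_wpM2r//.
    by case/andP: (h01 n).
  by rewrite (le_trans (ler_normB _ _))// lerD.
have /cvg_seq_bounded[K [_ /(_ (`|K| + 1))]] : cvg (F (rho_ n) @[n --> \oo]).
  by apply/cvg_ex; exists (F (delta 0)); exact: Fc.
rewrite (le_lt_trans (ler_norm _)) ?ltrDl// => /(_ isT) FK.
pose C := `|K| + 1 + `|F (delta 0)|.
pose n := Num.truncn C.
have := FK n I; rewrite /= (Fa _ _ _ _ (h01 n) (rho_P n)).
have hn : 0 < (harmonic n : R) by rewrite invr_gt0 ltr0n.
have Cn : C < n.+1%:R by exact: truncnS_gt.
have xn : n.+1%:R <= `|harmonic n * F (delta (x_ n))|.
  rewrite normrM gtr0_norm// -ler_pdivrMl// invrK -expr2.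
  by rewrite ltW// x_P.
have e1 : `|(1 - harmonic n) * F (delta 0)| <= `|F (delta 0)|.
  rewrite normrM ler_piMl// ler_norml.
  by have := h01 n; lra.
have := ler_normD (harmonic n * F (delta (x_ n)) + (1 - harmonic n) * F (delta 0))
  (- ((1 - harmonic n) * F (delta 0))).
rewrite addrK normrN => e2 e3.
by move: Cn; rewrite /C; lra.
Qed.

Lemma probability_setI1 d (T : measurableType d) (P : probability T R)
    (A B : set T) : measurable A -> measurable B -> P A = 1%E ->
  P (B `&` A) = P B.
Proof.
move=> mA mB PA; rewrite [RHS](measureDI P mB mA).
rewrite [X in _ = (X + _)%E](@subset_measure0 _ _ _ P _ (~` A)) ?add0e//.
- exact: measurableD.
- exact: measurableC.
- by apply: etrans (probability_setC P mA) _; rewrite PA subee.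
Qed.

Lemma measurable_seq (s : seq R) : measurable [set` s].
Proof.
elim: s => [|a s IHs].
  by rewrite (_ : [set` [::]] = set0)//; apply/seteqP; split.
rewrite (_ : [set` a :: s] = [set a] `|` [set` s]); first exact: measurableU.
apply/seteqP; split => x /=; rewrite inE; first by move=> /orP[/eqP|]; [left|right].
by move=> [->|->]; rewrite ?eqxx ?orbT.
Qed.

(** Induction on the support: conditioning on an atom [a] and on its complement
    writes [nu] as a mixture of [delta a] and a law carried by the other
    points. *)
Lemma affine_finite_support F (s : seq R) nu :
  affine F -> weakly_continuous F -> {in s, forall a, 0 <= a} ->
  nu [set` s] = 1%E -> F nu = \int[nu]_x F (delta x).
Proof.
move=> Fa Fc; have [M FM] := affine_delta_bounded Fa Fc.
have mF : measurable_fun setT (fun x => F (delta x)).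
  by apply: continuous_measurable_fun; exact: weakly_continuous_delta.
elim: s nu => [|a s IHs] nu s0.
  rewrite (_ : [set` [::]] = set0) ?measure0; last by apply/seteqP; split.
  by move=> /eqP; rewrite eq_sym onee_eq0.
have a0 : 0 <= a by apply: s0; rewrite mem_head.
move=> nu1; pose p := fine (nu [set a]).
have pE : p%:E = nu [set a] by rewrite /p fineK// fin_num_measure.
have p01 : 0 <= p <= 1.
  by rewrite -!lee_fin pE measure_ge0 probability_le1.
have [p1|pn1] := eqVneq p 1.
  have nuE : nu =P+ delta a.
    move=> B mB; rewrite /= diracE ger0_norm//.
    rewrite -(@probability_setI1 _ _ nu [set a] B)// -?pE ?p1//.
    case: (asboolP (B a)) => Ba.
      rewrite mem_set// (_ : B `&` _ = [set a]) -?pE ?p1//.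
      by apply/seteqP; split => [x []//|x /= ->].
    rewrite memNset// (_ : B `&` _ = set0) ?measure0//.
    by apply/seteqP; split => // x [Bx /= xa]; apply: Ba; rewrite -xa.
  rewrite (weakly_continuous_eq Fc nuE) (eq_Pplus_Rintegral _ nuE).
  by rewrite Rintegral_delta// ger0_norm.
have mC : measurable (~` [set a]) by exact: measurableC.
have nuC : nu (~` [set a]) = (1 - p)%:E.
  by rewrite probability_setC// -pE.
have nuC0 : nu (~` [set a]) != 0%E by rewrite nuC eqe subr_eq0 eq_sym.
have [nu' nu'E] := conditional_exists mC nuC0.
have mix : is_mixture p (delta a) nu' nu.
  move=> B mB; rewrite -nuC -nu'E// pE.
  rewrite [LHS](@measureDI _ _ _ nu B [set a])// addeC; congr (_ + _)%E.
  rewrite /= diracE ger0_norm//; case: (asboolP (B a)) => Ba.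
    rewrite mem_set// mule1; congr (nu _).
    by apply/seteqP; split => [x []//|x /= ->].
  rewrite memNset// mule0 [X in nu X](_ : _ = set0) ?measure0//.
  by apply/seteqP; split => // x [Bx /= xa]; apply: Ba; rewrite -xa.
have nu's : nu' [set` s] = 1%E.
  have : nu ([set` s] `&` ~` [set a]) = nu (~` [set a]).
    rewrite -[RHS](@probability_setI1 _ _ nu [set` a :: s])//; last first.
      exact: measurable_seq.
    congr (nu _); apply/seteqP; split => x /=; rewrite inE.
      by move=> [-> ?]; split => //; rewrite orbT.
    by move=> [xa /orP[/eqP//|->]].
  rewrite nu'E; last exact: measurable_seq.
  rewrite nuC -(fineK (fin_num_measure nu' _ (measurable_seq s))) -EFinM => -[].
  by rewrite -{2}(mulr1 (1 - p)) => /mulfI ->//; rewrite subr_eq0 eq_sym.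
rewrite (Fa _ _ _ _ p01 mix) (IHs nu' _ nu's); last first.
  by move=> x xs; apply: s0; rewrite inE xs orbT.
by rewrite (mixture_Rintegral p01 mix mF FM) Rintegral_delta// ger0_norm.
Qed.

(** [grid n x] is the largest element up to [x] of a finite set, [0] and the
    first [n] rationals of an enumeration, when [0 <= x].  It is a discretization
    of the half-line with finitely many values that increases to the identity. *)
Fixpoint grid n (x : R) : R :=
  if n is n'.+1 then
    let q := ratr (odflt 0 (unpickle n')) in
    if q <= x then Num.max q (grid n' x) else grid n' x
  else 0.

Lemma gridS n x : grid n.+1 x =
  if ratr (odflt 0 (unpickle n)) <= x
  then Num.max (ratr (odflt 0 (unpickle n))) (grid n x) else grid n x.
Proof. by []. Qed.

Lemma grid_ge0 n x : 0 <= grid n x.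
Proof. by elim: n => //= n IHn; case: ifP => // _; rewrite le_max IHn orbT. Qed.

Lemma grid_le n x : 0 <= x -> grid n x <= x.
Proof.
by move=> x0; elim: n => //= n IHn; case: ifP => // qx; rewrite ge_max qx.
Qed.

Lemma grid_nd m n x : (m <= n)%N -> grid m x <= grid n x.
Proof.
move=> /subnKC <-; elim: (n - m)%N => [|k IHk]; rewrite ?addn0// addnS/=.
by case: ifP => // _; rewrite le_max IHk orbT.
Qed.

Lemma measurable_grid n : measurable_fun setT (grid n).
Proof.
elim: n => [|n IHn]/=; first exact: measurable_cst.
apply: measurable_fun_ifT => //; last exact: measurable_maxr.
by apply: measurable_fun_ler.
Qed.

Lemma cvg_grid x : 0 <= x -> grid n x @[n --> \oo] --> x.
Proof.
move=> x0; apply/cvgrPdist_lt => e e0.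
have [->|xn0] := eqVneq x 0.
  near=> n; have := grid_le n (lexx (0 : R)); have := grid_ge0 n 0.
  by move=> h1 h2; rewrite (_ : grid n 0 = 0) ?subr0 ?normr0//; apply/le_anti/andP.
have xgt0 : 0 < x by rewrite lt_neqAle eq_sym xn0.
have [|q] := @rat_in_itvoo R (x - e) x; first by rewrite ltrBlDr ltrDl.
rewrite in_itv/= => /andP[xq qx].
near=> n; have gx := grid_le n x0.
have qg : ratr q <= grid n x.
  apply: (@le_trans _ _ (grid (pickle q).+1 x)); last first.
    by apply: grid_nd; near: n; exact: nbhs_infty_ge.
  rewrite gridS pickleK [odflt _ _]/= (ltW qx).
  by rewrite le_max lexx.
by rewrite ger0_norm ?subr_ge0//; move: xq qg; lra.
Unshelve. all: by end_near. Qed.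

Fixpoint grid_values n : seq R :=
  if n is n'.+1 then
    let q := ratr (odflt 0 (unpickle n')) in
    if 0 <= q then q :: grid_values n' else grid_values n'
  else [:: 0].

Lemma grid_values_ge0 n : {in grid_values n, forall a, 0 <= a}.
Proof.
elim: n => [|n IHn] a /=; first by rewrite inE => /eqP->.
by case: ifP => q0; [rewrite inE => /orP[/eqP->//|/IHn]|exact: IHn].
Qed.

Lemma grid_in_values n x : grid n x \in grid_values n.
Proof.
elim: n => [|n IHn]/=; first by rewrite inE.
set q := ratr _; case: (leP 0 q) => q0; case: ifP => qx.
- by rewrite /Num.max; case: ifP => _; rewrite inE ?eqxx// IHn orbT.
- by rewrite inE IHn orbT.
- by rewrite max_r// (le_trans (ltW q0))// grid_ge0.
- by [].
Qed.

Definition is_law d (T : measurableType d) (P : probability T R) (X : T -> R) mu :=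
  forall B, measurable B -> mu B = P (X @^-1` B).

Lemma law_exists d (T : measurableType d) (P : probability T R) (X : T -> R) :
  measurable_fun setT X -> (forall w, 0 <= X w) -> exists mu, is_law P X mu.
Proof.
move=> mX X0; pose X' : {mfun T >-> R} := mfun_Sub (mem_set mX).
have [| |mu muE] := @Pplus_of_measure _ (distribution P X').
- exact: (probability_setT (distribution P X')).
- have e : X @^-1` `[0, +oo[%classic = setT.
    by apply/seteqP; split => // w _ /=; rewrite in_itv/= X0.
  by rewrite -[RHS](probability_setT P) -e.
by exists mu => B mB; rewrite muE.
Qed.

Lemma law_integral d (T : measurableType d) (P : probability T R) (X : T -> R)
    mu (D : set R) (g : R -> \bar R) : measurable_fun setT X -> is_law P X mu ->
  measurable D -> measurable_fun D g -> (forall x, D x -> 0 <= g x)%E ->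
  (\int[mu]_(x in D) g x = \int[P]_(w in X @^-1` D) g (X w))%E.
Proof.
move=> mX muE mD mg g0; pose X' : {mfun T >-> R} := mfun_Sub (mem_set mX).
transitivity (\int[distribution P X']_(x in D) (g x))%E.
  by apply: eq_measure_integral => A mA _; exact: muE.
by rewrite ge0_integral_pushforward// => y /[!inE]; exact: g0.
Qed.

Lemma law_Rintegral d (T : measurableType d) (P : probability T R) (X : T -> R)
    mu (g : R -> R) (M : R) : measurable_fun setT X -> is_law P X mu ->
  measurable_fun setT g -> (forall x : R, `|g x| <= M) ->
  \int[mu]_x g x = \int[P]_w g (X w).
Proof.
move=> mX muE mg gM; pose X' : {mfun T >-> R} := mfun_Sub (mem_set mX).
rewrite /Rintegral; congr fine.
transitivity (\int[distribution P X']_x (g x)%:E)%E.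
  by apply: eq_measure_integral => A mA _; exact: muE.
rewrite integral_distribution//; first exact/measurable_EFinP.
by apply: (@bounded_integrable _ _ _ _ _ M) => //; exact: measurableT_comp.
Qed.

(** The laws of [grid n] under [mu] have finite support and converge weakly to
    [mu]; for them the formula holds by affinity, and both of its sides pass to
    the limit because [x |-> F (delta x)] is bounded and continuous. *)
Theorem affine_integral F mu : affine F -> weakly_continuous F ->
  F mu = \int[mu]_x F (delta x).
Proof.
move=> Fa Fc; have [M FM] := affine_delta_bounded Fa Fc.
have cF := weakly_continuous_delta Fc.
have mF : measurable_fun setT (fun x => F (delta x)).
  by apply: continuous_measurable_fun; exact: cF.
have /choice[mu_ mu_E] : forall n, exists nu, is_law mu (grid n) nu.
  by move=> n; apply: law_exists; [exact: measurable_grid|exact: grid_ge0].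
have approx (g : R -> R) (K : R) : continuous g -> (forall x : R, `|g x| <= K) ->
    \int[mu_ n]_x g x @[n --> \oo] --> \int[mu]_x g x.
  move=> cg gK; have mg := continuous_measurable_fun cg.
  under eq_fun do rewrite (law_Rintegral (measurable_grid _) (mu_E _) mg gK).
  apply: (@bounded_cvg_ae _ _ _ _ _ _ K) => //.
  - by move=> n; apply: measurableT_comp => //; exact: measurable_grid.
  - exists `]-oo, 0[%classic; split => //; first exact: Pplus_lt0.
    move=> x /= h; rewrite in_itv/= ltNge; apply/negP => x0; apply: h.
    by apply: (cvg_comp _ _ (cvg_grid x0)); exact: cg.
have Fmu_ n : F (mu_ n) = \int[mu_ n]_x F (delta x).
  apply: (@affine_finite_support _ (grid_values n)) => //.
    exact: grid_values_ge0.
  rewrite mu_E; last exact: measurable_seq.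
  rewrite (_ : _ @^-1` _ = setT) ?probability_setT//.
  by apply/seteqP; split => // x _ /=; exact: grid_in_values.
have c1 : F (mu_ n) @[n --> \oo] --> F mu.
  by apply: Fc => g cg [K gK]; exact: approx gK.
have c2 : F (mu_ n) @[n --> \oo] --> \int[mu]_x F (delta x).
  by under eq_fun do rewrite Fmu_; exact: approx FM.
exact: (cvg_unique _ c1 c2).
Qed.

End weak_functionals.

(** * Quantile functions *)

Section quantile.
Context {R : realType}.
Implicit Types mu : Pplus R.

Definition unif01 : probability (measurableTypeR R) R := uniform_prob (@ltr01 R).

Lemma unif01_le (c : R) : 0 <= c <= 1 -> unif01 `]0, c]%classic = c%:E.
Proof.
move=> /andP[c0 c1]; rewrite /unif01/= /uniform_prob integral_uniform_pdf.
rewrite (_ : _ `&` _ = `]0%R, c]%classic); last first.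
  apply/setIidl => x /=; rewrite !in_itv/= => /andP[x0 xc].
  by rewrite ltW//= (le_trans xc).
rewrite (eq_integral (cst 1%E)); last first.
  move=> x; rewrite inE/= in_itv/= => /andP[x0 xc].
  by rewrite /uniform_pdf ltW//= (le_trans xc)// subr0 invr1.
rewrite integral_cst//= mul1e lebesgue_measure_itv/= lte_fin.
case: ltP => [_|c0']; first by rewrite -EFinB subr0.
by congr (_%:E); apply/le_anti/andP.
Qed.

Lemma unif01_in : unif01 `]0, 1[%classic = 1%E.
Proof.
rewrite /unif01/= /uniform_prob integral_uniform_pdf.
rewrite (_ : _ `&` _ = `]0%R, 1%R[%classic); last first.
  apply/setIidl => x /=; rewrite !in_itv/= => /andP[x0 xc].
  by rewrite !ltW.
rewrite (eq_integral (cst 1%E)); last first.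
  move=> x; rewrite inE/= in_itv/= => /andP[x0 xc].
  by rewrite /uniform_pdf !ltW//= subr0 invr1.
by rewrite integral_cst//= mul1e lebesgue_measure_itv/= lte_fin ltr01 -EFinB subr0.
Qed.

Let idR : R -> R := idfun.

#[local] HB.instance Definition _ :=
  @isMeasurableFun.Build _ _ _ _ idR (@measurable_id _ _ setT).

(** The infimum runs over [0 <= x] so that quantiles are nonnegative without
    reference to the carrier of [mu]. *)
Definition quantile mu (u : R) : R :=
  if 0 < u < 1 then inf [set x : R | 0 <= x /\ (u%:E <= mu `]-oo, x]%classic)%E]
  else 0.

Lemma quantile_ge0 mu u : 0 <= quantile mu u.
Proof.
rewrite /quantile; case: ifP => // _; set S := [set _ | _].
have [->|/set0P S0] := eqVneq S set0; first by rewrite inf0.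
by apply: lb_le_inf => // x [].
Qed.

(** The Galois connection between the quantile function and the distribution
    function, from which everything else about quantiles follows. *)
Lemma quantile_le mu u x : 0 < u < 1 -> 0 <= x ->
  (quantile mu u <= x) = (u%:E <= mu `]-oo, x]%classic)%E.
Proof.
move=> u01 x0; rewrite /quantile u01; case/andP: u01 => u0 u1.
set S := [set _ | _].
have S_lb : has_lbound S by exists 0 => y [].
pose X : {RV mu >-> R} := idR.
have S0 : S !=set0.
  apply: contrapT => S0; have : (1%:E <= u%:E)%E; last by rewrite lee_fin leNgt u1.
  apply: (cvge_le _ (cvg_cdfy1 X)); near=> y.
  rewrite leNgt; apply/negP => uy; apply: S0; exists y; split; last exact: ltW.
  by near: y; exact: nbhs_pinfty_ge.
apply/idP/idP => [h|h]; last by apply: ge_inf.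
have Sy y : x < y -> (u%:E <= mu `]-oo, y]%classic)%E.
  move=> xy.
  have [z [z0 Sz] zy] : exists2 z, S z & z < y.
    by apply: inf_lt => //; apply: le_lt_trans xy.
  apply: (le_trans Sz); apply: le_measure; rewrite ?inE//.
  by apply: subset_itvl; rewrite bnd_simp ltW.
have rc : cdf X y @[y --> x^'+] --> cdf X x by exact: cdf_right_continuous.
apply: (cvge_ge _ rc); near=> y; exact: Sy.
Unshelve. all: by end_near. Qed.

Lemma quantile_out mu u : ~~ (0 < u < 1) -> quantile mu u = 0.
Proof. by rewrite /quantile => /negbTE ->. Qed.

Lemma unif01_setI (A : set (measurableTypeR R)) : measurable A ->
  unif01 (A `&` `]0, 1[%classic) = unif01 A.
Proof.
by move=> mA; apply: (@probability_setI1 _ _ _ unif01) => //; exact: unif01_in.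
Qed.

Lemma measurable_fun_le_set d (T : measurableType d) (f : T -> R) :
  (forall a, measurable [set z | f z <= a]) -> measurable_fun setT f.
Proof.
move=> mf; apply: (measurability _ (RGenOInfty.measurableE R)) => //.
move=> _ [_ [a ->] <-]; rewrite setTI.
rewrite (_ : _ @^-1` _ = ~` [set z | f z <= a]); first exact: measurableC.
by apply/seteqP; split => z /=; rewrite in_itv/= andbT ltNge => /negP.
Qed.

(** By the Galois connection a sublevel set of the joint quantile is, away from
    the endpoints, the set where [u] lies below a measurable function of the
    parameter. *)
Lemma measurable_quantile_param d (T : measurableType d) (K : T -> Pplus R) :
  (forall a, 0 <= a -> measurable_fun setT (fun x => K x `]-oo, a]%classic)) ->
  measurable_fun setT
    (fun z : T * measurableTypeR R => quantile (K z.1) z.2 : R).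
Proof.
move=> mK; apply: measurable_fun_le_set => a.
have [a0|a0] := leP 0 a; last first.
  rewrite (_ : [set z | _] = set0)//; apply/seteqP; split => // z /= h.
  by have := le_lt_trans h a0; rewrite ltNge quantile_ge0.
pose I : set (T * measurableTypeR R) := setT `*` `]0, 1[%classic.
have mI : measurable I by apply: measurableX => //; exact: measurable_itv.
have m2 : measurable_fun setT (fun z : T * measurableTypeR R => (z.2 : R)%:E).
  apply/measurable_EFinP; exact: measurable_snd.
have m1 : measurable_fun setT
    (fun z : T * measurableTypeR R => K z.1 `]-oo, a]%classic).
  exact: (measurableT_comp (mK a a0) measurable_fst).
have mle := measurable_lee measurableT m2 m1.
rewrite (_ : [set z | _] = ~` I `|`
  (I `&` (setT `&` [set z | ((z.2 : R)%:E <= K z.1 `]-oo, a]%classic)%E]))); last first.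
  apply/seteqP; split => -[x u] /=; rewrite /I/= !in_itv/=.
    have [u01|u01] := boolP (0 < u < 1); last by left => -[].
    by rewrite quantile_le// => h; right.
  have [u01|u01] := boolP (0 < u < 1); last by rewrite quantile_out.
  by case=> [[]//|[_ [_ h]]]; rewrite quantile_le.
apply: measurableU; first exact: measurableC.
exact: measurableI.
Qed.

Lemma measurable_quantile mu :
  measurable_fun setT (quantile mu : measurableTypeR R -> R).
Proof.
have h := @measurable_quantile_param _ R (fun=> mu) (fun _ _ => measurable_cst _).
exact: (measurableT_comp h (pair1_measurable (0 : R))).
Qed.

Lemma quantile_law mu : is_law unif01 (quantile mu) mu.
Proof.
have [nu nuE] := law_exists unif01 (measurable_quantile mu) (quantile_ge0 mu).
have numu : nu =P+ mu.
  apply: eq_Pplus_cdf => a a0; rewrite nuE//.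
  pose c := fine (mu `]-oo, a]%classic).
  have cE : c%:E = mu `]-oo, a]%classic by rewrite fineK// fin_num_measure.
  have c01 : 0 <= c <= 1 by rewrite -!lee_fin cE measure_ge0 probability_le1.
  rewrite -cE -(unif01_le c01) -unif01_setI; last first.
    by rewrite -[X in measurable X]setTI; exact: measurable_quantile.
  rewrite -[RHS]unif01_setI; last exact: measurable_itv.
  congr (unif01 _); apply/seteqP; split => u /=; rewrite !in_itv/= => -[h u01];
    split => //; move: h.
    by rewrite quantile_le// -cE lee_fin => ->; case/andP: u01 => ->.
  by case/andP => _ h; rewrite quantile_le// -cE lee_fin.
by move=> B mB; rewrite -numu// nuE.
Qed.

End quantile.

Section disintegration.
Context {R : realType}.
Implicit Types (mu nu : Pplus R).

(** Realizing [K x] as the law of [quantile (K x)] under the uniform law turns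
    all integrals against the kernel [K] into integrals over a product space, so
    a family of laws that is measurable, or mixes correctly, on half-lines does
    so on all Borel sets and nonnegative functions, by Tonelli's theorem. *)
Lemma Pplus_mixture (K : R -> Pplus R) (nu rho : Pplus R) :
  (forall a, 0 <= a -> measurable_fun setT (fun x => K x `]-oo, a]%classic)) ->
  (forall a, 0 <= a ->
    rho `]-oo, a]%classic = (\int[nu]_x K x `]-oo, a]%classic)%E) ->
  [/\ forall B, measurable B -> measurable_fun setT (fun x => K x B),
     forall g : R -> \bar R, measurable_fun setT g -> (forall y, 0 <= g y)%E ->
       measurable_fun setT (fun x => \int[K x]_y g y)%E &
     forall g : R -> \bar R, measurable_fun setT g -> (forall y, 0 <= g y)%E ->
       (\int[rho]_y g y = \int[nu]_x \int[K x]_y g y)%E].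
Proof.
move=> mK rhoE; pose q (z : R * measurableTypeR R) : R := quantile (K z.1) z.2.
have mq : measurable_fun setT q := measurable_quantile_param mK.
have KE x B : measurable B -> K x B = unif01 (xsection (q @^-1` B) x).
  move=> mB; rewrite (quantile_law (K x) mB); congr (unif01 _).
  by apply/seteqP; split => u /=; rewrite /xsection/= inE.
have mqB B : measurable B -> measurable (q @^-1` B).
  by move=> mB; rewrite -[X in measurable X]setTI; exact: mq.
have mKB B : measurable B -> measurable_fun setT (fun x => K x B).
  move=> mB; under eq_fun do rewrite KE//.
  exact: (measurable_fun_xsection _ (mqB _ mB)).
have intK x (g : R -> \bar R) : measurable_fun setT g -> (forall y, 0 <= g y)%E ->
    (\int[K x]_y g y = \int[unif01]_u g (q (x, u)))%E.
  move=> mg g0.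
  have mQ := measurable_quantile (K x).
  by rewrite (law_integral mQ (quantile_law (K x)))// preimage_setT.
split => //.
- move=> g mg g0; under eq_fun do rewrite intK//.
  have mgq : measurable_fun setT (fun z => g (q z)) by exact: measurableT_comp.
  have := @measurable_fun_fubini_tonelli_F _ _ _ _ _ unif01 _ mgq.
  by apply => z; exact: g0.
- move=> g mg g0.
  have mgq : measurable_fun setT (fun z => g (q z)) by exact: measurableT_comp.
  under [RHS]eq_integral do rewrite intK//.
  rewrite -(@fubini_tonelli1 _ _ _ _ _ nu unif01 (fun z => g (q z)))//.
  have q_law : is_law (nu \x unif01)%E q rho.
    have [rho' rho'E] := law_exists (nu \x unif01)%E mq (fun z => quantile_ge0 _ _).
    move=> B mB; rewrite -rho'E//.
    apply: (@eq_Pplus_cdf _ rho rho') => // a a0.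
    rewrite rhoE// rho'E//= /product_measure1/=.
    by apply: eq_integral => x _; rewrite KE.
  by rewrite (law_integral mq q_law)// preimage_setT.
Qed.

End disintegration.

(** * The convolution kernel *)

Section ramps.
Context {R : realType}.
Implicit Types (mu nu rho : Pplus R).

(** For [0 < k], a continuous function that is [1] up to [a], vanishes beyond
    [a + 1 / k] and is affine between; as [k] grows it decreases to the
    indicator of the half-line. *)
Definition ramp (a : R) (k : nat) (y : R) : R :=
  Num.max 0 (Num.min 1 (1 - k%:R * (y - a))).

Lemma ramp_continuous a k : continuous (ramp a k).
Proof.
move=> y; apply: (@continuous_max _ R (fun=> 0) _ y); first exact: cvg_cst.
apply: (@continuous_min _ R (fun=> 1) _ y); first exact: cvg_cst.
apply: cvgB; first exact: cvg_cst.
apply: cvgMr; apply: cvgB; [exact: cvg_id|exact: cvg_cst].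
Qed.

Lemma ramp_ge0 a k y : 0 <= ramp a k y.
Proof. by rewrite le_max lexx. Qed.

Lemma ramp_norm_le1 a k y : `|ramp a k y| <= 1.
Proof. by rewrite ger0_norm ?ramp_ge0// ge_max ler01/= ge_min lexx. Qed.

Lemma cvg_ramp a y : ramp a k y @[k --> \oo] --> (\1_(`]-oo, a]) y : R).
Proof.
rewrite indicE; case: (leP y a) => ya.
  rewrite mem_set/= ?in_itv//=.
  under eq_fun => k.
    rewrite /ramp min_l ?max_r ?ler01//; last first.
      by rewrite lerBrDr -lerBrDl subrr mulr_ge0_le0// subr_le0.
    over.
  exact: cvg_cst.
rewrite memNset/= ?in_itv/= => [|h]; last by have := lt_le_trans ya h; rewrite ltxx.
have ya0 : 0 < y - a by rewrite subr_gt0.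
apply/cvgrPdist_le => e e0; near=> k.
suff -> : ramp a k y = 0 by rewrite subr0 normr0 ltW.
rewrite /ramp max_l// ge_min; apply/orP; right.
rewrite subr_le0 -ler_pdivrMr// mul1r.
near: k; exact: nbhs_infty_ger.
Unshelve. all: by end_near. Qed.

Lemma measurable_ramp a k : measurable_fun setT (ramp a k).
Proof. by apply: continuous_measurable_fun; exact: ramp_continuous. Qed.

Lemma cvg_integral_ramp mu a :
  \int[mu]_y ramp a k y @[k --> \oo] --> fine (mu `]-oo, a]%classic).
Proof.
have -> : fine (mu `]-oo, a]%classic) = \int[mu]_y (\1_(`]-oo, a]) y : R).
  by rewrite /Rintegral integral_indic// setIT.
apply: (@bounded_cvg_ae _ _ _ _ _ _ 1).
- by move=> k; exact: measurable_ramp.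
- exact: measurable_indic.
- by move=> k y; exact: ramp_norm_le1.
- by move=> y; rewrite indicE; case: (_ \in _); rewrite ?normr0 ?normr1.
- by apply: aeW => y; exact: cvg_ramp.
Qed.

Lemma eq_Pplus_continuous mu nu :
  (forall g : R -> R, continuous g -> (exists M : R, forall x, `|g x| <= M) ->
    \int[mu]_x g x = \int[nu]_x g x) -> mu =P+ nu.
Proof.
move=> h; apply: eq_Pplus_cdf => a _.
rewrite -[LHS]fineK ?fin_num_measure// -[RHS]fineK ?fin_num_measure//.
congr (_%:E); have h1 := @cvg_integral_ramp (mu) a.
have h2 := @cvg_integral_ramp nu a.
suff h3 : \int[mu]_y ramp a k y @[k --> \oo] --> fine (nu `]-oo, a]%classic).
  exact: (cvg_unique _ h1 h3).
under eq_fun => k.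
  rewrite h; [over|exact: ramp_continuous|exists 1 => x; exact: ramp_norm_le1].
exact: h2.
Qed.

End ramps.

Section convolution_kernel.
Context {R : realType} (op : Pplus R -> Pplus R -> Pplus R).
Hypothesis op_conv : generalized_convolution op.
Implicit Types (mu nu rho : Pplus R).

Lemma op_congr mu mu' nu nu' : mu =P+ mu' -> nu =P+ nu' ->
  op mu nu =P+ op mu' nu'.
Proof.
move=> hmu hnu; apply: eq_Pplus_continuous => g cg gM.
have := gc_continuous op_conv (weak_cvg_cst hmu) (weak_cvg_cst hnu) cg gM.
by move=> hg; apply: (cvg_unique _ _ hg) => //; exact: cvg_cst.
Qed.

Section fixed_kernel.
Variable mu : Pplus R.

(** This lemma and the next one make the functional
    [nu |-> \int g d(op nu mu)] accessible to [affine_integral]. *)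
Lemma conv_affine (g : R -> R) (M : R) : measurable_fun setT g ->
  (forall x, `|g x| <= M) -> affine (fun nu => \int[op nu mu]_y g y).
Proof.
move=> mg gM a nu1 nu2 rho a01 mix.
exact: (mixture_Rintegral a01 (gc_mixture op_conv mu a01 mix) mg gM).
Qed.

Lemma conv_weakly_continuous (g : R -> R) (M : R) : continuous g ->
  (forall x : R, `|g x| <= M) ->
  weakly_continuous (fun nu => \int[op nu mu]_y g y).
Proof.
move=> cg gM nu_ nu nu_nu.
apply: (gc_continuous op_conv nu_nu (weak_cvg_cst (eq_Pplus_refl mu)) cg).
by exists M.
Qed.

(** The distribution function is a limit of integrals of ramps, which are
    continuous in [x]. *)
Lemma conv_cdf_measurable (a : R) :
  measurable_fun setT (fun x => op (delta x) mu `]-oo, a]%classic).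
Proof.
have m1 : measurable_fun setT (fun x => fine (op (delta x) mu `]-oo, a]%classic)).
  apply: (@measurable_fun_cvg _ _ _ setT
    (fun k x => \int[op (delta x) mu]_y ramp a k y)) => [k|x _].
  - apply: continuous_measurable_fun.
    apply: (@weakly_continuous_delta _ (fun nu => \int[op nu mu]_y ramp a k y)).
    exact: (conv_weakly_continuous (@ramp_continuous _ a k) (ramp_norm_le1 a k)).
  - exact: cvg_integral_ramp.
move/measurable_EFinP : m1; apply: eq_measurable_fun => x _ /=.
by rewrite fineK// fin_num_measure.
Qed.

Lemma conv_cdf_integral nu (a : R) : op nu mu `]-oo, a]%classic =
  (\int[nu]_x op (delta x) mu `]-oo, a]%classic)%E.
Proof.
pose F x := fine (op (delta x) mu `]-oo, a]%classic).
have FE x : (F x)%:E = op (delta x) mu `]-oo, a]%classic.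
  by rewrite fineK// fin_num_measure.
have mF : measurable_fun setT F.
  by apply: measurableT_comp => //; exact: conv_cdf_measurable.
have F1 x : `|F x| <= 1.
  by rewrite ger0_norm ?fine_ge0// -lee_fin FE probability_le1.
under eq_integral do rewrite -FE.
rewrite -[LHS]fineK ?fin_num_measure// -(bounded_RintegralE _ mF F1); congr (_%:E).
have h1 := @cvg_integral_ramp _ (op nu mu) a.
pose G k x := \int[op (delta x) mu]_y ramp a k y.
have cG k : continuous (G k).
  apply: (@weakly_continuous_delta _ (fun nu => \int[op nu mu]_y ramp a k y)).
  exact: (conv_weakly_continuous (@ramp_continuous _ a k) (ramp_norm_le1 a k)).
have h2 : \int[op nu mu]_y ramp a k y @[k --> \oo] --> \int[nu]_x F x.
  under eq_fun => k.
    rewrite (@affine_integral _ (fun nu => \int[op nu mu]_y ramp a k y)); first over.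
    - exact: (conv_affine (measurable_ramp a k) (ramp_norm_le1 a k)).
    - exact: (conv_weakly_continuous (@ramp_continuous _ a k) (ramp_norm_le1 a k)).
  apply: (@bounded_cvg_ae _ _ _ _ _ _ 1) => //.
  - by move=> k; apply: continuous_measurable_fun; exact: cG.
  - by move=> k x; exact: (Rintegral_norm_le _ (measurable_ramp a k) (ramp_norm_le1 a k)).
  - by apply: aeW => x; exact: cvg_integral_ramp.
exact: (cvg_unique _ h1 h2).
Qed.

End fixed_kernel.

(** Convolution with [mu] is the mixture of the kernel
    [x |-> op (delta x) mu]. *)
Definition conv_mixture mu nu := @Pplus_mixture R (fun x => op (delta x) mu)
  nu (op nu mu) (fun a _ => @conv_cdf_measurable mu a)
  (fun a _ => @conv_cdf_integral mu nu a).

Lemma conv_measurable mu (B : set R) : measurable B ->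
  measurable_fun setT (fun x => op (delta x) mu B).
Proof. by have [h _ _] := conv_mixture mu mu; exact: h. Qed.

Lemma conv_integral mu nu (g : R -> \bar R) : measurable_fun setT g ->
  (forall y, 0 <= g y)%E ->
  (\int[op nu mu]_y g y = \int[nu]_x \int[op (delta x) mu]_y g y)%E.
Proof. by have [_ _ h] := conv_mixture mu nu; exact: h. Qed.

End convolution_kernel.

Lemma bernoulli {R : realType} (d : R) n : -1 <= d -> 1 + n%:R * d <= (1 + d) ^+ n.
Proof.
move=> d1; elim: n => [|n IHn]; first by rewrite mul0r addr0 expr0.
rewrite exprS; apply: (@le_trans _ _ ((1 + d) * (1 + n%:R * d))).
  have : 0 <= n%:R * (d * d) by rewrite mulr_ge0// -expr2 sqr_ge0.
  by rewrite -natr1; lra.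
by rewrite ler_wpM2l// -lerBlDl sub0r.
Qed.

(** * Generalized characteristic functions *)
Section regular.
Context {R : realType} (op : Pplus R -> Pplus R -> Pplus R) (h : Pplus R -> R).
Hypotheses (op_conv : generalized_convolution op)
  (h_regular : regular_homomorphism op h).
Implicit Types (mu nu rho : Pplus R).

Let h_affine : affine h. Proof. exact: rh_mixture h_regular. Qed.
Let h_continuous : weakly_continuous h. Proof. exact: rh_continuous h_regular. Qed.

Lemma h_eq mu nu : mu =P+ nu -> h mu = h nu.
Proof. exact: weakly_continuous_eq. Qed.

Lemma Omega_continuous : continuous (Omega h).
Proof. exact: weakly_continuous_delta. Qed.

Lemma Omega_measurable : measurable_fun setT (Omega h).
Proof. apply: continuous_measurable_fun; exact: Omega_continuous. Qed.

Lemma h_integral mu : h mu = \int[mu]_x Omega h x.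
Proof. exact: affine_integral. Qed.

(** Since [delta 0] is neutral, [h mu = h mu * h (delta 0)] for every [mu], and
    [h] is nonzero somewhere. *)
Lemma h_delta0 : h (delta 0) = 1.
Proof.
have [mu mu0] := rh_neq0 h_regular.
have := rh_mul h_regular mu (delta 0); rewrite (h_eq (gc_unit op_conv mu)).
by move/eqP; rewrite -subr_eq0 -{1}(mulr1 (h mu)) -mulrBr mulf_eq0 subr_eq0
  => /orP[/eqP//|/eqP <-].
Qed.

Lemma h_gpow mu n : h (gpow op mu n) = h mu ^+ n.
Proof.
elim: n => [|n IHn]; first by rewrite h_delta0.
by rewrite /gpow/= (rh_mul h_regular) -/(gpow op mu n) IHn exprS.
Qed.

(** The values of [h] are bounded and stable under powers. *)
Lemma h_norm_le1 mu : `|h mu| <= 1.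
Proof.
have [M hM] := affine_delta_bounded h_affine h_continuous.
have {}hM nu : `|h nu| <= M.
  by rewrite h_integral; exact: (Rintegral_norm_le _ Omega_measurable).
rewrite leNgt; apply/negP => h1.
have [n Mn] : exists n, M < `|h mu| ^+ n.
  pose d := `|h mu| - 1; have d0 : 0 < d by rewrite subr_gt0.
  have hE : `|h mu| = 1 + d by rewrite /d addrC subrK.
  exists (Num.truncn (`|M| / d)).+1; rewrite hE.
  apply: lt_le_trans (bernoulli _ _); last by rewrite (le_trans _ (ltW d0))// lerN10.
  have : `|M| / d < (Num.truncn (`|M| / d)).+1%:R by exact: truncnS_gt.
  rewrite ltr_pdivrMr// => hM'; rewrite (le_lt_trans (ler_norm M))//.
  by rewrite (lt_trans hM')// ltrDr.
by have := hM (gpow op mu n); rewrite h_gpow normrX leNgt Mn.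
Qed.

Lemma Omega_norm_le1 x : `|Omega h x| <= 1.
Proof. exact: h_norm_le1. Qed.

Lemma Omega_le1 x : Omega h x <= 1.
Proof. exact: le_trans (ler_norm _) (Omega_norm_le1 x). Qed.

Lemma Omega0 : Omega h 0 = 1. Proof. exact: h_delta0. Qed.

Lemma scale_law t mu : is_law mu (scale_fun t) (scale t mu).
Proof. by []. Qed.

Lemma Omega_abs x : Omega h `|x| = Omega h x.
Proof. by apply: h_eq => B mB; rewrite /= normr_id. Qed.

Lemma Omega_mul_measurable (t : R) : measurable_fun setT (fun x : R => Omega h (t * x)).
Proof.
by apply: measurableT_comp; [exact: Omega_measurable|exact: mulrl_measurable].
Qed.

Lemma Phi_integral mu t : Phi h mu t = \int[mu]_x Omega h (t * x).
Proof.
under [RHS]eq_Rintegral do rewrite -Omega_abs normrM -{1}(normr_id t) -normrM Omega_abs.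
rewrite /Phi h_integral (law_Rintegral (measurable_scale_fun t) (scale_law t mu)
  Omega_measurable Omega_norm_le1).
by [].
Qed.

Lemma Phi_abs mu t : Phi h mu `|t| = Phi h mu t.
Proof.
rewrite !Phi_integral; apply: eq_Rintegral => x _.
by rewrite -Omega_abs normrM normr_id -normrM Omega_abs.
Qed.

Lemma Phi_continuous mu : continuous (Phi h mu).
Proof.
move=> t; apply/(@cvg_nbhsP _ R^o) => u ut.
rewrite Phi_integral -[X in X @ _ --> _]/(fun n => Phi h mu (u n)).
under eq_fun do rewrite Phi_integral.
apply: (@bounded_cvg_ae _ _ _ _ _ _ 1) => //.
- by move=> n; exact: Omega_mul_measurable.
- exact: Omega_mul_measurable.
- by move=> n x; exact: Omega_norm_le1.
- by move=> x; exact: Omega_norm_le1.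
- apply: aeW => x; apply: (@cvg_comp _ _ _ (fun n => u n * x) (Omega h) \oo
    (nbhs (t * x))); last exact: Omega_continuous.
  by apply: cvgMl.
Qed.

Lemma Phi_measurable mu : measurable_fun setT (Phi h mu).
Proof. by apply: continuous_measurable_fun; exact: Phi_continuous. Qed.

Lemma Phi_norm_le1 mu t : `|Phi h mu t| <= 1. Proof. exact: h_norm_le1. Qed.

Lemma Phi0 mu : Phi h mu 0 = 1.
Proof.
rewrite Phi_integral; under eq_Rintegral do rewrite mul0r Omega0.
by rewrite Rintegral_cst// [X in fine X]probability_setT mulr1.
Qed.

Lemma scale_eq t mu nu : mu =P+ nu -> scale t mu =P+ scale t nu.
Proof.
move=> e B mB; apply: e; rewrite -[X in measurable X]setTI.
exact: measurable_scale_fun.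
Qed.

Lemma Phi_eq mu nu t : mu =P+ nu -> Phi h mu t = Phi h nu t.
Proof. by move=> e; apply: h_eq; exact: scale_eq. Qed.

Lemma Phi_op mu nu t : 0 <= t -> Phi h (op mu nu) t = Phi h mu t * Phi h nu t.
Proof.
by move=> t0; rewrite /Phi (h_eq (gc_scale op_conv _ _ t0)) (rh_mul h_regular).
Qed.

Lemma Phi_delta0 t : Phi h (delta 0) t = 1.
Proof.
rewrite Phi_integral Rintegral_delta; first by rewrite normr0 mulr0 Omega0.
exact: Omega_mul_measurable.
Qed.

Lemma Phi_gpow mu n t : 0 <= t -> Phi h (gpow op mu n) t = Phi h mu t ^+ n.
Proof.
move=> t0; elim: n => [|n IHn]; first by rewrite Phi_delta0.
by rewrite /gpow/= Phi_op// -/(gpow op mu n) IHn exprS.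
Qed.

End regular.

(** * Separation of distribution functions *)

Section cdf_bounds.
Context {R : realType} (mu : Pplus R) (g : R -> R) (M : R).
Hypotheses (mg : measurable_fun setT g) (gM : forall x, `|g x| <= M).

Let Rintegral_ind (D : set R) : measurable D ->
  \int[mu]_x (\1_D x : R) = fine (mu D).
Proof. by move=> mD; rewrite /Rintegral integral_indic// setIT. Qed.

Let indic_norm_le1 (D : set R) x : `|\1_D x : R| <= 1.
Proof. by rewrite indicE; case: (_ \in _); rewrite ?normr0 ?normr1. Qed.

Lemma cdf_le_Rintegral (a c : R) : (forall x, 0 <= g x) ->
  (forall x, 0 <= x <= a -> c <= g x) ->
  c * fine (mu `]-oo, a]%classic) <= \int[mu]_x g x.
Proof.
move=> g0 gc; have mI : measurable (`]-oo, a]%classic `&` `[0, +oo[%classic : set R).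
  exact: measurableI.
rewrite -(probability_setI1 _ _ (Pplus_carried mu))//.
rewrite -Rintegral_ind// -RintegralZl//; last first.
  by apply: (@bounded_integrable _ _ _ _ _ 1).
apply: le_Rintegral => //.
- apply: (@bounded_integrable _ _ _ _ _ `|c|); first exact: measurable_funM.
  by move=> x; rewrite normrM ler_piMr.
- exact: bounded_integrable gM.
move=> x _; rewrite indicE; case: (asboolP ((`]-oo, a] `&` `[0, +oo[) x)) => h.
  rewrite mem_set// mulr1; apply: gc; case: h => /=.
  by rewrite !in_itv/= andbT => -> ->.
by rewrite memNset// mulr0.
Qed.

Lemma Rintegral_le_cdf (b e : R) : 0 <= e -> (forall x, g x <= 1) ->
  (forall x, b < x -> g x <= e) ->
  \int[mu]_x g x <= fine (mu `]-oo, b]%classic) + e.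
Proof.
move=> e0 g1 ge.
have mI : measurable (`]-oo, b]%classic : set R) by [].
have -> : fine (mu `]-oo, b]%classic) + e =
    \int[mu]_x ((\1_(`]-oo, b]) x : R) + e).
  rewrite RintegralD//; last 2 first.
  - exact: (@bounded_integrable _ _ _ _ _ 1).
  - exact: finite_measure_integrable_cst.
  by rewrite Rintegral_ind// Rintegral_cst// [X in _ * fine X]probability_setT mulr1.
apply: le_Rintegral => //.
- exact: bounded_integrable gM.
- apply: (@bounded_integrable _ _ _ _ _ (1 + e)).
    exact: measurable_funD.
  by move=> x; rewrite (le_trans (ler_normD _ _))// lerD// ger0_norm.
move=> x _; rewrite indicE; case: (leP x b) => xb.
  by rewrite mem_set/= ?in_itv//= (le_trans (g1 x))// lerDl.
rewrite memNset/= ?in_itv/= ?add0r ?ge// => h.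
by have := lt_le_trans xb h; rewrite ltxx.
Qed.

End cdf_bounds.

Section separation.
Context {R : realType}.

(** Choose [k] about [1 / (e * alpha ^ m)]: then [k * alpha ^ m] is large, so
    [(1 - alpha ^ m) ^ k] is small, while [k * beta ^ m] is about
    [(beta / alpha) ^ m / e], small for large [m]. *)
Lemma separating_exponents (alpha beta e : R) : 0 < beta -> beta < alpha ->
  alpha <= 1 -> 0 < e -> exists m k : nat,
    (1 - alpha ^+ m) ^+ k <= e /\ k%:R * beta ^+ m <= e.
Proof.
move=> b0 ba a1 e0; have a0 : 0 < alpha by exact: lt_trans ba.
pose q := beta / alpha.
have q0 : 0 <= q by rewrite divr_ge0// ltW.
have q1 : `|q| < 1 by rewrite ger0_norm// ltr_pdivrMr// mul1r.
have c0 : 0 < e^-1 + 1 by rewrite addr_gt0// invr_gt0.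
have [m qm] : exists m, q ^+ m * (e^-1 + 1) <= e.
  have /cvgrPdist_le/(_ (e / (e^-1 + 1)))[] := cvg_expr q1; first exact: divr_gt0.
  move=> m _ /(_ m (leqnn m))/=; rewrite sub0r normrN ger0_norm ?exprn_ge0//.
  by rewrite ler_pdivlMr// => ?; exists m.
pose y := alpha ^+ m; have y0 : 0 < y by exact: exprn_gt0.
have y1 : y <= 1 by rewrite exprn_ile1// ltW.
exists m, (Num.truncn (e * y)^-1).+1; set k := _.+1.
have ky : (e * y)^-1 < k%:R by exact: truncnS_gt.
have ky' : k%:R <= (e * y)^-1 + 1.
  by rewrite -natr1 lerD2r truncn_le// invr_ge0 mulr_ge0// ltW.
split.
  (* Bernoulli's inequality bounds the second factor by [(1 + y) ^ k]. *)
  have h1 : (1 - y) ^+ k * (1 + k%:R * y) <= 1.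
    apply: (@le_trans _ _ ((1 - y) ^+ k * (1 + y) ^+ k)).
      by rewrite ler_wpM2l ?bernoulli ?exprn_ge0 ?subr_ge0// (le_trans _ (ltW y0))// lerN10.
    rewrite -exprMn exprn_ile1//; first by nra.
    by rewrite mulrDr mulr1 mulrBl mul1r; nra.
  have h2 : e^-1 <= 1 + k%:R * y.
    rewrite (@le_trans _ _ (k%:R * y))//; last by rewrite lerDr.
    by rewrite -ler_pdivrMr// -invfM ltW.
  have h3 : 0 < 1 + k%:R * y by rewrite addr_gt0// mulr_gt0.
  rewrite -(ler_pM2r h3) (le_trans h1)//.
  by rewrite mulrC -ler_pdivrMr// mul1r.
apply: (@le_trans _ _ (((e * y)^-1 + 1) * beta ^+ m)).
  by rewrite ler_wpM2r// exprn_ge0// ltW.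
have bE : beta ^+ m = q ^+ m * y.
  by rewrite /q /y -exprMn divfK// gt_eqF.
rewrite bE (le_trans _ qm)// mulrC -mulrA ler_wpM2l ?exprn_ge0//.
rewrite mulrDr mulr1 invfM mulrCA mulfV ?gt_eqF// mulr1.
by rewrite lerD2l.
Qed.

(** The polynomial [1 - (1 - y ^ m) ^ k] works, with the exponents of the
    previous lemma. *)
Lemma separating_polynomial (alpha beta e : R) : 0 < beta -> beta < alpha ->
  alpha <= 1 -> 0 < e -> exists p : {poly R},
  [/\ forall y, 0 <= y <= 1 -> 0 <= p.[y] <= 1,
      forall y, alpha <= y <= 1 -> 1 - e <= p.[y] &
      forall y, 0 <= y <= beta -> p.[y] <= e].
Proof.
move=> b0 ba a1 e0; have [m [k [h1 h2]]] := separating_exponents b0 ba a1 e0.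
exists (1 - (1 - 'X^m) ^+ k).
have pE y : (1 - (1 - 'X^m) ^+ k : {poly R}).[y] = 1 - (1 - y ^+ m) ^+ k.
  by rewrite !hornerE.
have y01 (y : R) : 0 <= y <= 1 -> 0 <= 1 - y ^+ m <= 1.
  by move=> /andP[y0 y1]; rewrite subr_ge0 exprn_ile1//= lerBlDr lerDl exprn_ge0.
split=> y yP; rewrite pE.
- have /andP[z0 z1] := y01 _ yP.
  by rewrite subr_ge0 exprn_ile1//= lerBlDr lerDl exprn_ge0.
- case/andP: yP => ay y1; have a0 : 0 <= alpha by exact: ltW (lt_trans b0 ba).
  have y0 := le_trans a0 ay.
  rewrite lerD2l lerN2; apply: le_trans h1; apply: lerXn2r; rewrite ?nnegrE.
  + by rewrite subr_ge0 exprn_ile1.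
  + by rewrite subr_ge0 exprn_ile1.
  + by rewrite lerD2l lerN2; apply: lerXn2r; rewrite ?nnegrE.
- case/andP: yP => y0 yb; have y1 : y <= 1 by rewrite (le_trans yb)// (le_trans (ltW ba)).
  have h3 : -1 <= - y ^+ m by rewrite lerN2 exprn_ile1.
  have := bernoulli k h3; rewrite mulrN => {}h3.
  apply: (@le_trans _ _ (k%:R * y ^+ m)); first by move: h3; lra.
  apply: le_trans h2; rewrite ler_wpM2l//; apply: lerXn2r; rewrite ?nnegrE//.
  exact: ltW.
Qed.

Variables (kappa : R).
Hypothesis kappa_gt0 : 0 < kappa.
Implicit Types mu nu : Pplus R.

Definition stretched_exp (x : R) : R := expR (- (`|x| `^ kappa)).
Local Notation E := stretched_exp.

Lemma stretched_exp_gt0 x : 0 < E x. Proof. exact: expR_gt0. Qed.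

Lemma stretched_exp_le1 x : E x <= 1.
Proof. by rewrite -expR0 ler_expR oppr_le0 powR_ge0. Qed.

Lemma stretched_exp_norm_le1 x : `|E x| <= 1.
Proof. by rewrite ger0_norm ?stretched_exp_le1// ltW// stretched_exp_gt0. Qed.

Lemma stretched_exp_anti x y : 0 <= x -> x <= y -> E y <= E x.
Proof.
move=> x0 xy; rewrite ler_expR lerN2 !ger0_norm// ?(le_trans x0)//.
by apply: (ge0_ler_powR (ltW kappa_gt0)); rewrite ?nnegrE// (le_trans x0).
Qed.

Lemma stretched_exp_lt x y : 0 <= x -> x < y -> E y < E x.
Proof.
move=> x0 xy; have y0 := le_lt_trans x0 xy.
rewrite ltr_expR ltrN2 !ger0_norm// ?(ltW y0)//.
by rewrite gt0_ltr_powR ?nnegrE// ltW.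
Qed.

(** Powers of the kernel are rescalings of it, so convergence of the transform
    at all scales gives convergence of integrals of polynomials in the
    kernel. *)
Lemma stretched_exp_expn x m : E x ^+ m = E (m%:R `^ kappa^-1 * x).
Proof.
rewrite /E -expRM_natl mulrN; congr (expR (- _)).
rewrite normrM (ger0_norm (powR_ge0 _ _)) powRM ?powR_ge0//.
by rewrite -powRrM mulVf ?gt_eqF// powRr1.
Qed.

Lemma stretched_exp_small (u e : R) : 0 < u -> 0 < e ->
  exists2 b, 0 <= b & E (u * b) <= e.
Proof.
move=> u0 e0; pose t := Num.max 0 (- ln e).
have t0 : 0 <= t by rewrite le_max lexx.
exists (u^-1 * t `^ kappa^-1); first by rewrite mulr_ge0 ?powR_ge0// invr_ge0 ltW.
rewrite mulrA mulfV ?gt_eqF// mul1r /E ger0_norm ?powR_ge0//.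
rewrite -powRrM mulVf ?gt_eqF// powRr1//.
rewrite -[leRHS](lnK (_ : e \is Num.pos)) ?posrE// ler_expR lerNl.
by rewrite le_max lexx orbT.
Qed.

Lemma stretched_exp_measurable : measurable_fun setT E.
Proof.
apply: measurableT_comp => //; apply: measurableT_comp => //.
by apply: (@measurableT_comp _ _ _ _ _ _ (@powR R ^~ kappa)).
Qed.

Lemma stretched_expM_measurable (u : R) : measurable_fun setT (fun x => E (u * x)).
Proof.
by apply: measurableT_comp; [exact: stretched_exp_measurable|exact: mulrl_measurable].
Qed.

Section cdf_separation.
Variable mu_ : nat -> Pplus R.
Hypothesis mu_cvg : forall u : R, cvgn (fun n => \int[mu_ n]_x E (u * x)).

(** Induction on the polynomial, strengthened by a factor [E x ^ j] that absorbs
    the multiplications by the variable. *)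
Lemma cvg_horner_stretched_exp (p : {poly R}) :
  cvgn (fun n => \int[mu_ n]_x p.[E x]).
Proof.
suff : forall j, cvgn (fun n => \int[mu_ n]_x (p.[E x] * E x ^+ j)).
  by move=> /(_ 0%N); under eq_fun do under eq_Rintegral do rewrite expr0 mulr1.
have bnd (q : {poly R}) : exists M : R, forall x j, `|q.[E x] * E x ^+ j| <= M.
  exists (\sum_(i < size q) `|q`_i|) => x j.
  rewrite normrM; apply: (@le_trans _ _ `|q.[E x]|).
    by rewrite ler_piMr ?normr_ge0// normrX exprn_ile1 ?stretched_exp_norm_le1.
  rewrite horner_coef (le_trans (ler_norm_sum _ _ _))// ler_sum// => i _.
  by rewrite normrM ler_piMr ?normr_ge0// normrX exprn_ile1 ?stretched_exp_norm_le1.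
have meas (q : {poly R}) j : measurable_fun setT (fun x => q.[E x] * E x ^+ j).
  apply: measurable_funM; last by apply: measurable_funX; exact: stretched_exp_measurable.
  apply: (@measurableT_comp _ _ _ _ _ _ (fun y => q.[y])).
    by apply: continuous_measurable_fun; exact: continuous_horner.
  exact: stretched_exp_measurable.
elim/poly_ind: p => [|p c IHp] j.
  under eq_fun do under eq_Rintegral do rewrite horner0 mul0r.
  by under eq_fun do rewrite /Rintegral integral0; exact: is_cvg_cst.
have [M pM] := bnd p; have [M' pM'] := bnd c%:P.
have -> : (fun n => \int[mu_ n]_x ((p * 'X + c%:P).[E x] * E x ^+ j)) =
   (fun n => \int[mu_ n]_x (p.[E x] * E x ^+ j.+1) +
             c * \int[mu_ n]_x E (j%:R `^ kappa^-1 * x)).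
  apply/funext => n; under eq_Rintegral => x _.
    rewrite hornerD hornerMX hornerC mulrDl -mulrA -exprS.
    rewrite -[X in X * E x ^+ j](hornerC c (E x)); over.
  rewrite RintegralD//; last 2 first.
  - exact: (bounded_integrable _ (meas _ _) (fun x => pM x _)).
  - exact: (bounded_integrable _ (meas _ _) (fun x => pM' x _)).
  congr (_ + _); under eq_Rintegral do rewrite hornerC stretched_exp_expn.
  rewrite RintegralZl//; apply: (@bounded_integrable _ _ _ _ _ 1).
    exact: stretched_expM_measurable.
  by move=> x; exact: stretched_exp_norm_le1.
apply: is_cvgD; first exact: IHp.
by apply: is_cvgMr; exact: mu_cvg.
Qed.

(** Convergence of the transforms forbids the distribution functions to
    oscillate across an interval: a separating polynomial has an integral that
    is at least [w' - e] infinitely often and at most [w + e] infinitely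
    often, yet converges. *)
Lemma cdf_separation (a b w w' : R) : 0 <= a -> a < b -> w < w' ->
  (forall N, exists2 n, (N <= n)%N & (w'%:E <= mu_ n `]-oo, a]%classic)%E) ->
  (forall N, exists2 n, (N <= n)%N & (mu_ n `]-oo, b]%classic <= w%:E)%E) ->
  False.
Proof.
move=> a0 ab ww' lo hi.
(* Any error below half of the gap would do. *)
pose e := (w' - w) / 4; have e0 : 0 < e by rewrite divr_gt0// subr_gt0.
have [p [p01 pa pb]] := separating_polynomial
  (stretched_exp_gt0 b) (stretched_exp_lt a0 ab) (stretched_exp_le1 a) e0.
have E01 x : 0 <= E x <= 1.
  by rewrite stretched_exp_le1 andbT; exact/ltW/stretched_exp_gt0.
have p0 x : 0 <= p.[E x] by case/andP: (p01 _ (E01 x)).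
have p1 x : p.[E x] <= 1 by case/andP: (p01 _ (E01 x)).
have pN x : `|p.[E x]| <= 1 by rewrite ger0_norm.
have mp : measurable_fun setT (fun x => p.[E x]).
  apply: (@measurableT_comp _ _ _ _ _ _ (horner p)).
    by apply: continuous_measurable_fun; exact: continuous_horner.
  exact: stretched_exp_measurable.
have {}pa x : 0 <= x <= a -> 1 - e <= p.[E x].
  move=> /andP[x0 xa]; apply: pa.
  by rewrite stretched_exp_anti// stretched_exp_le1.
have {}pb x : b < x -> p.[E x] <= e.
  move=> bx; apply: pb; case/andP: (E01 x) => -> _ /=; apply: stretched_exp_anti.
    exact: le_trans (ltW ab).
  exact: ltW.
have /cvg_ex[c pc] := @cvg_horner_stretched_exp p.
have w'1 : w' <= 1.
  have [n _ h] := lo 0%N; rewrite -lee_fin (le_trans h)//; exact: probability_le1.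
have c_lo : w' - e <= c.
  rewrite leNgt; apply/negP => cw.
  have d0 : 0 < w' - e - c by rewrite subr_gt0.
  have /cvgrPdist_lt/(_ _ d0)[N _ HN] := pc.
  have [n Nn h] := lo N; have := HN n Nn; rewrite /= distrC => /(le_lt_trans (ler_norm _)).
  rewrite ltrBrDr subrK ltNge => /negP; apply.
  apply: le_trans (cdf_le_Rintegral (mu_ n) mp pN p0 pa).
  have : w' <= fine (mu_ n `]-oo, a]%classic) by rewrite -lee_fin fineK// fin_num_measure.
  have : fine (mu_ n `]-oo, a]%classic) <= 1.
    by rewrite -lee_fin fineK ?fin_num_measure// probability_le1.
  by move: e0; nra.
have c_hi : c <= w + e.
  rewrite leNgt; apply/negP => cw.
  have d0 : 0 < c - (w + e) by rewrite subr_gt0.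
  have /cvgrPdist_lt/(_ _ d0)[N _ HN] := pc.
  have [n Nn h] := hi N; have := HN n Nn; rewrite /= => /(le_lt_trans (ler_norm _)).
  rewrite ltrD2l ltrN2 ltNge => /negP; apply.
  apply: (le_trans (Rintegral_le_cdf (mu_ n) mp pN (ltW e0) p1 pb)).
  by rewrite lerD2r -lee_fin fineK// fin_num_measure.
by have := le_trans c_lo c_hi; move: ww'; rewrite /e; lra.
Qed.

End cdf_separation.

End separation.

(** * Compactness by quantile functions *)
Section helly.
Context {R : realType}.
Implicit Types mu nu : Pplus R.
Variable mu_ : nat -> Pplus R.

Hypothesis mu_separated : forall a b w w' : R, 0 <= a -> a < b -> w < w' ->
  (forall N, exists2 n, (N <= n)%N & (w'%:E <= mu_ n `]-oo, a]%classic)%E) ->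
  (forall N, exists2 n, (N <= n)%N & (mu_ n `]-oo, b]%classic <= w%:E)%E) ->
  False.

Hypothesis mu_tight : forall w : R, w < 1 ->
  exists b N, forall n, (N <= n)%N -> (w%:E <= mu_ n `]-oo, b]%classic)%E.

Let Q n (u : measurableTypeR R) : R := quantile (mu_ n) u.

Definition crossing (ab : rat * rat) : set (measurableTypeR R) :=
  [set u | [/\ 0 < (u : R) < 1, 0 <= (ratr ab.1 : R) < ratr ab.2,
    forall N, exists2 n, (N <= n)%N & Q n u <= ratr ab.1 &
    forall N, exists2 n, (N <= n)%N & ratr ab.2 < Q n u]].

(** Two levels [u < v] that both cross would make the distribution functions
    oscillate between [u] and [v] on the same interval, which separation
    forbids; hence at most one level crosses a given interval. *)
Lemma crossing_le u v ab : crossing ab u -> crossing ab v -> (v : R) <= u.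
Proof.
case: ab => a b; move=> [/= u01 /andP[a0 ab] _ hi] [/= v01 _ lo _].
rewrite leNgt; apply/negP => uv.
apply: (mu_separated a0 ab uv) => N.
  by have [n Nn h] := lo N; exists n => //; rewrite -quantile_le.
have [n Nn h] := hi N; exists n => //; rewrite leNgt; apply/negP => /ltW.
by rewrite -quantile_le ?(le_trans a0 (ltW ab))// leNgt h.
Qed.

Lemma crossing_countable ab : countable (crossing ab).
Proof.
have [->|/set0P[u uP]] := eqVneq (crossing ab) set0; first exact: countable0.
apply: (@sub_countable _ _ _ [set u]); last exact: countable1.
apply: subset_card_le => v vP /=.
by apply/le_anti/andP; split; [exact: crossing_le vP|exact: crossing_le uP].
Qed.

Lemma crossing_negligible : unif01.-negligible (\bigcup_ab crossing ab).
Proof.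
have cC : countable (\bigcup_ab crossing ab).
  by apply: bigcup_countable => // ab _; exact: crossing_countable.
have mC : measurable (\bigcup_ab crossing ab) by exact: countable_measurable.
apply/negligibleP => //.
have /null_content_dominatesP dom := @dominates_uniform_prob R 0 1 ltr01.
by apply: dom => //; exact: countable_lebesgue_measure0.
Qed.

(** The limit superior is measurable everywhere, while the limit exists only
    almost everywhere; the absolute value makes it nonnegative at the levels
    without a limit. *)
Definition limit_quantile (u : measurableTypeR R) : R :=
  `|fine (limn_esup (fun n => (Q n u)%:E))|.

Lemma limit_quantile_measurable : measurable_fun setT limit_quantile.
Proof.
apply: measurableT_comp => //; apply: measurableT_comp => //.
apply: measurable_fun_limn_esup => n.
by apply/measurable_EFinP; exact: measurable_quantile.
Qed.

(** At a level without crossings the limit superior of the quantiles is the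
    limit: it is finite by tightness, and otherwise two rationals could be
    inserted between a limit point and it. *)
Lemma cvg_quantile u : ~ (\bigcup_ab crossing ab) u ->
  exists L : R, Q n u @[n --> \oo] --> L.
Proof.
move=> uC; have [u01|u01] := boolP (0 < (u : R) < 1); last first.
  exists 0; rewrite (_ : (fun n => Q n u) = fun=> 0); first exact: cvg_cst.
  by apply/funext => n; rewrite /Q quantile_out.
have /andP[u0 u1] := u01.
have [b [N QN]] := mu_tight u1.
have b0 : 0 <= b.
  rewrite leNgt; apply/negP => b0; have := QN N (leqnn N).
  rewrite (@subset_measure0 _ _ _ (mu_ N) _ `]-oo, 0[%classic)//.
  - by rewrite lee_fin leNgt u0.
  - by apply: subset_itvl; rewrite bnd_simp.
  - exact: Pplus_lt0.
have Qb n : (N <= n)%N -> Q n u <= b by move=> Nn; rewrite /Q quantile_le//; exact: QN.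
pose S := [set x : R | 0 <= x /\ exists M, forall n, (M <= n)%N -> Q n u <= x].
have S0 : S !=set0 by exists b; split => //; exists N.
have S_lb : has_lbound S by exists 0 => x [].
exists (inf S); apply/cvgrPdist_lt => e e0.
have [x [x0 [M1 xM1]] xe] : exists2 x, S x & x < inf S + e.
  by apply: inf_adherent.
have [M2 eM2] : exists M, forall n, (M <= n)%N -> inf S - e < Q n u.
  apply: contrapT => nM.
  have lo K : exists2 n, (K <= n)%N & Q n u <= inf S - e.
    apply: contrapT => nK; apply: nM; exists K => n Kn.
    by rewrite ltNge; apply/negP => h; apply: nK; exists n.
  have d0 : 0 <= inf S - e.
    have [n _ h] := lo 0%N; apply: le_trans h; exact: quantile_ge0.
  have [|a] := @rat_in_itvoo R (inf S - e) (inf S); first by rewrite ltrBlDr ltrDl.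
  rewrite in_itv/= => /andP[ea aS].
  have [c] := @rat_in_itvoo R (ratr a) (inf S) aS.
  rewrite in_itv/= => /andP[ac cS].
  have a0 : 0 <= (ratr a : R) by rewrite (le_trans d0)// ltW.
  apply: uC; exists (a, c) => //; split => //=; first by rewrite a0.
    by move=> K; have [n Kn h] := lo K; exists n; rewrite // (le_trans h)// ltW.
  move=> K; apply: contrapT => nK.
  have : S (ratr c).
    split; first by rewrite (le_trans a0)// ltW.
    exists K => n Kn; rewrite leNgt; apply/negP => h; apply: nK; by exists n.
  by move/(ge_inf S_lb); rewrite leNgt cS.
exists (maxn M1 M2) => // n /=; rewrite geq_max => /andP[/xM1 h1 /eM2 h2].
by rewrite ltr_norml; lra.
Qed.

Lemma cvg_limit_quantile u : ~ (\bigcup_ab crossing ab) u ->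
  Q n u @[n --> \oo] --> limit_quantile u.
Proof.
move=> /cvg_quantile[L QL]; rewrite /limit_quantile.
have QLE : (Q n u)%:E @[n --> \oo] --> L%:E by apply: cvg_EFin => //; exact: nearW.
have L0 : 0 <= L.
  by apply: (cvgr_to_ge QL); apply: nearW => n; exact: quantile_ge0.
rewrite (is_cvg_limn_esupE (cvgP _ QLE)) (cvg_lim _ QLE)//=.
by rewrite ger0_norm.
Qed.

Lemma helly : exists mu, weak_cvg \oo mu_ mu.
Proof.
have l0 u : 0 <= limit_quantile u by rewrite /limit_quantile.
have [mu muE] := law_exists unif01 limit_quantile_measurable l0.
exists mu => g cg [M gM]; have mg := continuous_measurable_fun cg.
rewrite (law_Rintegral limit_quantile_measurable muE mg gM).
under eq_fun do rewrite (law_Rintegral (measurable_quantile _) (quantile_law _) mg gM).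
apply: (@bounded_cvg_ae _ _ _ _ _ _ M) => //.
- by move=> n; apply: measurableT_comp => //; exact: measurable_quantile.
- by apply: measurableT_comp => //; exact: limit_quantile_measurable.
apply: negligibleS crossing_negligible => u /= h; apply: contrapT => uC; apply: h.
by apply: (cvg_comp _ _ (cvg_limit_quantile uC)); exact: cg.
Qed.

End helly.

(** * The continuity theorem *)
Section continuity_theorem.
Context {R : realType} (op : Pplus R -> Pplus R -> Pplus R) (h : Pplus R -> R).
Hypotheses (op_conv : generalized_convolution op)
  (h_regular : regular_homomorphism op h).
Variable kappa : R.
Hypothesis kappa_exponent : is_characteristic_exponent h kappa.
Implicit Types mu nu : Pplus R.

Let kappa_gt0 : 0 < kappa. Proof. by case: kappa_exponent. Qed.

Local Notation E := (stretched_exp kappa).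

Let O1 := Omega_norm_le1 op_conv h_regular.

(** Take [sigma] with characteristic function [exp (- t ^ kappa)]: both sides
    are the integral of [Omega (u * s * x)] over the product of [sigma] and
    [mu]. *)
Lemma Rintegral_stretched_exp : exists sigma : Pplus R, forall mu u,
  \int[mu]_x E (u * x) = \int[sigma]_s Phi h mu (u * s).
Proof.
have [_ [sigma sigmaE] _] := kappa_exponent; exists sigma => mu u.
have EE x : E x = Phi h sigma x.
  by rewrite -(Phi_abs op_conv h_regular) sigmaE// /stretched_exp.
under eq_Rintegral do rewrite EE (Phi_integral op_conv h_regular).
under [RHS]eq_Rintegral do rewrite (Phi_integral op_conv h_regular).
under [RHS]eq_Rintegral do under eq_Rintegral do rewrite mulrAC.
have mO : measurable_fun setT (fun z : R * R => Omega h (u * z.1 * z.2)).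
  apply: measurableT_comp; first exact: Omega_measurable h_regular.
  apply: measurable_funM; last exact: measurable_snd.
  by apply: measurable_funM => //; exact: measurable_fst.
exact: (bounded_Fubini mu sigma mO (fun z => O1 _)).
Qed.

(** If the distribution functions of two laws with the same transform differed at
    [a], they would still differ slightly to the right of [a], and the sequence
    that alternates between the two laws would contradict [cdf_separation]. *)
Theorem Phi_inj mu nu : (forall u, 0 <= u -> Phi h mu u = Phi h nu u) -> mu =P+ nu.
Proof.
move=> PE; have {}PE u : Phi h mu u = Phi h nu u.
  by rewrite -(Phi_abs op_conv h_regular) PE// (Phi_abs op_conv h_regular).
have [sigma sE] := Rintegral_stretched_exp.
have EE u : \int[mu]_x E (u * x) = \int[nu]_x E (u * x).
  by rewrite !sE; under eq_Rintegral do rewrite PE.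
suff key (mu1 mu2 : Pplus R) : (forall u, \int[mu1]_x E (u * x) = \int[mu2]_x E (u * x)) ->
    forall a, 0 <= a -> (mu1 `]-oo, a]%classic <= mu2 `]-oo, a]%classic)%E.
  apply: eq_Pplus_cdf => a a0; apply/le_anti/andP.
  by split; apply: key.
move=> {}EE a a0; rewrite leNgt; apply/negP => lt21.
have finE (rho : Pplus R) : (fine (rho `]-oo, a]%classic))%:E = rho `]-oo, a]%classic.
  by rewrite fineK// fin_num_measure.
set w1 := fine (mu1 `]-oo, a]%classic); set w2 := fine (mu2 `]-oo, a]%classic).
have w21 : w2 < w1 by rewrite -lte_fin !finE.
have w11 : w1 <= 1 by rewrite -lee_fin finE probability_le1.
have w20 : 0 <= w2 by rewrite -lee_fin finE measure_ge0.
pose w := (w1 + w2) / 2.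
have ww1 : w < w1 by rewrite /w; lra.
have w2w : w2 < w by rewrite /w; lra.
have w01 : 0 < w < 1 by apply/andP; split; lra.
have aQ : a < quantile mu2 w by rewrite ltNge quantile_le// -finE lee_fin -ltNge.
(* By the choice of [w], the distribution function of [mu2] stays below [w] up
   to [b], while that of [mu1] is [w1] at [a]. *)
pose b := (a + quantile mu2 w) / 2.
have ab : a < b by rewrite /b; lra.
have bQ : b < quantile mu2 w by rewrite /b; lra.
have b0 : 0 <= b by apply: le_trans (ltW ab).
have mu2b : (mu2 `]-oo, b]%classic <= w%:E)%E.
  by rewrite leNgt; apply/negP => /ltW; rewrite -quantile_le// leNgt bQ.
pose nu_ n := if odd n then mu2 else mu1.
apply: (@cdf_separation _ _ kappa_gt0 nu_ _ a b w w1 a0 ab ww1).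
- move=> u; rewrite (_ : (fun n => _) = fun=> \int[mu1]_x E (u * x)).
    exact: is_cvg_cst.
  by apply/funext => n; rewrite /nu_; case: (odd n).
- by move=> N; exists N.*2; rewrite ?/nu_ ?odd_double ?finE// -addnn leq_addr.
- move=> N; exists N.*2.+1; first by rewrite (leq_trans _ (leqnSn _))// -addnn leq_addr.
  by rewrite /nu_ oddS odd_double.
Qed.

(** Pointwise convergence of the characteristic functions implies convergence of
    the transforms, hence the separation property; continuity of the limit at
    [0] gives tightness, because [exp (- (u * x) ^ kappa)] is small far out while
    its integral is close to [1] for small [u].  The weak limit provided by
    [helly] has the limit as characteristic function. *)
Theorem gcf_closed (mu_ : nat -> Pplus R) (phi : R -> R) :
  (forall u, 0 <= u -> Phi h (mu_ n) u @[n --> \oo] --> phi u) ->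
  (forall e, 0 < e -> exists2 d, 0 < d & forall u, 0 <= u < d -> 1 - e <= phi u) ->
  is_gcf h phi.
Proof.
move=> Pphi phi1.
have {}Pphi u : Phi h (mu_ n) u @[n --> \oo] --> phi `|u|.
  by under eq_fun do rewrite -(Phi_abs op_conv h_regular); exact: Pphi.
have [sigma sE] := Rintegral_stretched_exp.
have mphi : measurable_fun setT (fun u : R => phi `|u|).
  apply: (@measurable_fun_cvg _ _ _ setT (fun n u => Phi h (mu_ n) u)) => //.
  by move=> n; exact: (Phi_measurable op_conv h_regular).
have phiN (u : R) : `|phi `|u| | <= 1.
  apply: (cvgr_to_le (cvg_norm (Pphi u))).
  by apply: nearW => n; exact: (Phi_norm_le1 op_conv h_regular).
have mphiu (u : R) : measurable_fun setT (fun s : R => phi `|u * s|).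
  by apply: (@measurableT_comp _ _ _ _ _ _ (fun v : R => phi `|v|)).
have cvgE u : \int[mu_ n]_x E (u * x) @[n --> \oo] --> \int[sigma]_s phi `|u * s|.
  under eq_fun do rewrite sE.
  apply: (@bounded_cvg_ae _ _ _ _ _ _ 1) => //.
  - move=> n; apply: measurableT_comp => //.
    exact: (Phi_measurable op_conv h_regular).
  - by move=> n s; exact: (Phi_norm_le1 op_conv h_regular).
  - by apply: aeW => s.
have sep a b w w' := @cdf_separation _ _ kappa_gt0 mu_
  (fun u => cvgP _ (cvgE u)) a b w w'.
have tight (w : R) : w < 1 ->
    exists b N, forall n, (N <= n)%N -> (w%:E <= mu_ n `]-oo, b]%classic)%E.
  move=> w1; pose e := (1 - w) / 4; have e0 : 0 < e by rewrite divr_gt0// subr_gt0.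
  have L1 : \int[sigma]_s phi `|harmonic k * s| @[k --> \oo] --> (1 : R).
    have -> : 1 = \int[sigma]_s (1 : R).
      by rewrite Rintegral_cst// [X in _ * fine X]probability_setT mulr1.
    apply: (@bounded_cvg_ae _ _ _ _ _ _ 1) => //.
    + by move=> x; rewrite normr1.
    apply: aeW => s; apply/cvgrPdist_le => d d0.
    have [c c0 cP] := phi1 d d0.
    have hs : harmonic k * s @[k --> \oo] --> (0 : R).
      by rewrite -[X in _ --> X](mul0r s); apply: cvgMl; exact: cvg_harmonic.
    near=> k.
    have h1 : 1 - d <= phi `|harmonic k * s|.
      apply: cP; rewrite normr_ge0/=; near: k.
      by have /cvgrPdist_lt/(_ _ c0) := hs; apply: filterS => k; rewrite sub0r normrN.
    have h2 := le_trans (ler_norm _) (phiN (harmonic k * s)).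
    by rewrite ger0_norm ?subr_ge0//; lra.
  (* A small scale at which the limiting transform is nearly [1]. *)
  have [u u0 uP] : exists2 u : R, 0 < u & 1 - e <= \int[sigma]_s phi `|u * s|.
    have /cvgrPdist_le/(_ _ e0)[k _ /(_ k (leqnn k)) kP] := L1.
    exists (harmonic k); first by rewrite invr_gt0 ltr0n.
    by have := le_trans (ler_norm _) kP; rewrite lerBlDr -lerBlDl.
  have [b b0 bP] := stretched_exp_small kappa_gt0 u0 e0.
  have /cvgrPdist_le/(_ _ e0)[N _ NP] := cvgE u.
  exists b, N => n Nn; have nP := le_trans (ler_norm _) (NP n Nn).
  have tail x : b < x -> E (u * x) <= e.
    move=> bx; apply: le_trans bP; apply: (stretched_exp_anti kappa_gt0).
      by rewrite mulr_ge0// ltW.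
    by rewrite ler_wpM2l// ltW.
  have hb := Rintegral_le_cdf (mu_ n) (stretched_expM_measurable kappa u)
    (fun x => stretched_exp_norm_le1 kappa (u * x)) (ltW e0)
    (fun x => stretched_exp_le1 kappa (u * x)) tail.
  rewrite -[leRHS]fineK ?fin_num_measure// lee_fin.
  by move: uP nP hb; rewrite /e; lra.
have [mu mu_mu] := helly sep tight.
exists mu => u u0.
have c1 : Phi h (mu_ n) u @[n --> \oo] --> Phi h mu u.
  rewrite (Phi_integral op_conv h_regular).
  under eq_fun do rewrite (Phi_integral op_conv h_regular).
  apply: mu_mu; last by exists 1 => x; exact: O1.
  move=> x; apply: (@cvg_comp _ _ _ (fun y => u * y) (Omega h) (nbhs x)
    (nbhs (u * x))); last exact: Omega_continuous h_regular _.
  by apply: cvgMr; exact: cvg_id.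
have := Pphi u; rewrite ger0_norm// => c2.
exact: (cvg_unique _ c1 c2).
Unshelve. all: by end_near. Qed.

End continuity_theorem.

(** * The exponent of an infinitely decomposable law *)

Section exponential_limits.
Context {R : realType}.

(** If [y] is the [n]-th root of [exp (- r)], then [n * (1 - y)] approximates [r]
    from below, with an explicit error. *)
Lemma expR_rate_le (y r : R) n : 0 <= y -> y ^+ n.+1 = expR (- r) ->
  n.+1%:R * (1 - y) <= r /\ (0 <= r -> r - n.+1%:R * (1 - y) <= r ^+ 2 * harmonic n).
Proof.
move=> y0 yE; have n0 : 0 < n.+1%:R :> R by rewrite ltr0n.
have {}yE : y = expR (- (r / n.+1%:R)).
  apply/eqP; rewrite -(@eqrXn2 _ n.+1)// ?expR_ge0//.
  by rewrite yE -expRM_natl mulrN (mulrC _ (r / _)) divfK// gt_eqF.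
pose z := r / n.+1%:R; have rE : r = n.+1%:R * z by rewrite /z mulrCA mulfV ?gt_eqF// mulr1.
split.
  rewrite rE ler_wpM2l ?(ltW n0)// lerBlDr -lerBlDl yE -/z.
  by rewrite (le_trans _ (expR_ge1Dx _)).
move=> r0; have z0 : 0 <= z by rewrite divr_ge0// ltW.
have z1 : 0 < 1 + z by rewrite ltr_pwDl.
have yz : y <= (1 + z)^-1.
  rewrite yE -/z expRN lef_pV2 ?posrE ?expR_gt0//; exact: expR_ge1Dx.
have yz' : y * (1 + z) <= 1 by rewrite -ler_pdivlMr// mul1r.
have -> : r ^+ 2 * harmonic n = n.+1%:R * (z * z).
  rewrite /harmonic/= {1}rE expr2; field; rewrite ?gt_eqF//.
rewrite {1}rE -mulrBr ler_wpM2l ?(ltW n0)//.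
by have := mulr_ge0 z0 z0; nra.
Qed.

Lemma one_sub_scaled (p : R) n : p = 1 - (n.+1%:R * (1 - p)) / n.+1%:R.
Proof. by rewrite mulrC mulKf ?pnatr_eq0// subKr. Qed.

(** Squeeze [(1 - x) ^ n] between [exp (- n x / (1 - x))] and [exp (- n x)]. *)
Lemma cvg_expR_pow (b_ : nat -> R) (b : R) :
  b_ n @[n --> \oo] --> b ->
  (1 - b_ n / n.+1%:R) ^+ n.+1 @[n --> \oo] --> expR (- b).
Proof.
move=> bb.
have hb : b_ n / n.+1%:R @[n --> \oo] --> (0 : R).
  by rewrite -[X in _ --> X](mulr0 b); apply: cvgM => //; exact: cvg_harmonic.
apply: (@squeeze_cvgr _ _ _ _ (fun n => expR (- (b_ n / (1 - b_ n / n.+1%:R))))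
   (fun n => expR (- b_ n))).
- near=> n.
  have : `|0 - b_ n / n.+1%:R| < 1 by near: n; move/cvgrPdist_lt : hb; exact.
  rewrite sub0r normrN => /(le_lt_trans (ler_norm _)); set x := b_ n / n.+1%:R => x1.
  have n0 : 0 < n.+1%:R :> R by rewrite ltr0n.
  have bE : b_ n = n.+1%:R * x by rewrite /x mulrCA mulfV ?gt_eqF// mulr1.
  have x1' : 0 < 1 - x by rewrite subr_gt0.
  apply/andP; split.
    rewrite [in leLHS]bE -mulrA -mulrN expRM_natl lerXn2r ?nnegrE ?expR_ge0//.
      exact: ltW.
    rewrite expRN -[leRHS]invrK lef_pV2 ?posrE ?expR_gt0 ?invr_gt0//.
    apply: le_trans (expR_ge1Dx _).
    suff -> : 1 + x / (1 - x) = (1 - x)^-1 by [].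
    by field; rewrite gt_eqF.
  have -> : - b_ n = n.+1%:R * - x by rewrite bE mulrN.
  rewrite expRM_natl lerXn2r ?nnegrE ?expR_ge0//.
    exact: ltW.
  exact: expR_ge1Dx.
- apply: (@cvg_comp _ _ _ _ (@expR R) _ (nbhs (- b))); last exact: continuous_expR.
  apply: cvgN; rewrite -[X in _ --> X]divr1; apply: cvgM => //.
  apply: cvgV; first exact: oner_neq0.
  by rewrite -[X in _ --> X]subr0; apply: cvgB => //; exact: cvg_cst.
- apply: (@cvg_comp _ _ _ _ (@expR R) _ (nbhs (- b))); last exact: continuous_expR.
  exact: cvgN.
Unshelve. all: by end_near. Qed.

End exponential_limits.

Section levy_exponent.
Context {R : realType} (op : Pplus R -> Pplus R -> Pplus R) (h : Pplus R -> R).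
Hypotheses (op_conv : generalized_convolution op)
  (h_regular : regular_homomorphism op h).
Variables (kappa x0 A : R) (m : {finite_measure set R -> \bar R}).
Hypotheses (kappa_exponent : is_characteristic_exponent h kappa)
  (x0_gt0 : 0 < x0) (Omega_lt1 : forall x, 0 < x <= x0 -> Omega h x < 1).

Let kappa_gt0 : 0 < kappa. Proof. by case: kappa_exponent. Qed.

Lemma upsilon_gt0 r : 0 < r -> 0 < upsilon h x0 r.
Proof.
move=> r0; rewrite /upsilon subr_gt0; apply: Omega_lt1.
by rewrite lt_min r0 x0_gt0 ge_min lexx orbT.
Qed.

(** Zero for [r <= 0], so that integrals over the open half-line become
    integrals over the line. *)
Definition levy_density (v r : R) : R :=
  if 0 < r then (1 - Omega h (v * r)) / upsilon h x0 r else 0.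

Lemma levy_density_ge0 v r : 0 <= levy_density v r.
Proof.
rewrite /levy_density; case: ifPn => // r0; rewrite divr_ge0//.
  by rewrite subr_ge0; exact: (Omega_le1 op_conv h_regular).
exact/ltW/upsilon_gt0.
Qed.

Lemma levy_density0 r : levy_density 0 r = 0.
Proof.
by rewrite /levy_density mul0r (Omega0 op_conv h_regular) subrr mul0r if_same.
Qed.

Lemma levy_density_measurable :
  measurable_fun setT (fun z : R * R => levy_density z.1 z.2).
Proof.
have mO := Omega_measurable h_regular.
apply: measurable_fun_if => //.
- by apply: measurable_fun_ltr => //; exact: measurable_snd.
- apply: measurable_funTS.
  (* The inverse is rewritten as a power, a measurable function. *)
  have -> : (fun z : R * R => (1 - Omega h (z.1 * z.2)) / upsilon h x0 z.2) =
      (fun z : R * R => (1 - Omega h (z.1 * z.2)) * upsilon h x0 z.2 `^ (-1)).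
    apply/funext => z; rewrite powR_inv1// subr_ge0.
    exact: (Omega_le1 op_conv h_regular).
  apply: measurable_funM.
    apply: measurable_funB => //; apply: measurableT_comp => //.
    by apply: measurable_funM; [exact: measurable_fst|exact: measurable_snd].
  apply: (@measurableT_comp _ _ _ _ _ _ (@powR R ^~ (-1))) => //.
  apply: measurable_funB => //; apply: measurableT_comp => //.
  by apply: measurable_minr => //; exact: measurable_snd.
Qed.

Definition levy_exponent (v : R) : \bar R :=
  ((A * v `^ kappa)%:E + \int[m]_r (levy_density v r)%:E)%E.

Hypothesis A_ge0 : 0 <= A.

Lemma levy_exponent_ge0 v : (0 <= levy_exponent v)%E.
Proof.
apply: adde_ge0; first by rewrite lee_fin mulr_ge0// powR_ge0.
by apply: integral_ge0 => r _; rewrite lee_fin levy_density_ge0.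
Qed.

Lemma levy_exponent0 : levy_exponent 0 = 0%E.
Proof.
rewrite /levy_exponent powR0 ?gt_eqF// mulr0 add0e.
by under eq_integral do rewrite levy_density0; rewrite integral0.
Qed.

Lemma levy_integral_measurable :
  measurable_fun setT (fun v => \int[m]_r (levy_density v r)%:E)%E.
Proof.
apply: (@measurable_fun_fubini_tonelli_F _ _ _ _ _ m
  (fun z : R * R => (levy_density z.1 z.2)%:E)).
  by apply/measurable_EFinP; exact: levy_density_measurable.
by move=> z; rewrite lee_fin levy_density_ge0.
Qed.

Lemma levy_exponent_measurable : measurable_fun setT levy_exponent.
Proof.
apply: emeasurable_funD; last exact: levy_integral_measurable.
by apply/measurable_EFinP; apply: measurable_funM.
Qed.

Lemma levy_exponentE v : ((A * v `^ kappa)%:E +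
    \int[m]_(r in `]0%R, +oo[) ((1 - Omega h (v * r)) / upsilon h x0 r)%:E
  = levy_exponent v)%E.
Proof.
rewrite /levy_exponent; congr (_ + _)%E.
rewrite integral_mkcond; apply: eq_integral => r _.
rewrite patchE /levy_density; case: ifPn.
  by rewrite inE/= in_itv/= andbT => ->.
by rewrite notin_setE/= in_itv/= andbT => /negP/negbTE ->.
Qed.

Variable lambda : Pplus R.
Hypotheses (lambda_id : infinitely_decomposable op lambda)
  (lambda_repr : forall t, 0 <= t ->
        (Phi h lambda t)%:E =
        expeR (- (A * t `^ kappa)%:E -
               \int[m]_(x in `]0%R, +oo[)
                 ((1 - Omega h (t * x)) / upsilon h x0 x)%:E)%E).

Lemma Phi_levy_exponent v : 0 <= v -> (Phi h lambda v)%:E = expeR (- levy_exponent v).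
Proof.
have negD (a : R) (b : \bar R) : (- a%:E - b = - (a%:E + b))%E.
  by rewrite oppeD// fin_num_adde_defr.
move=> v0; rewrite -levy_exponentE; apply: etrans (lambda_repr v0) _.
by apply: (congr1 (@expeR R)); exact: negD.
Qed.

(** Continuity of the characteristic function at [0]; the exponent may be
    infinite elsewhere. *)
Lemma levy_exponent_small (e : R) : 0 < e ->
  exists2 d, 0 < d & forall v, 0 <= v < d -> (levy_exponent v <= e%:E)%E.
Proof.
move=> e0; have Pc := @Phi_continuous _ _ _ op_conv h_regular lambda (0 : R).
have : expR (- e) < Phi h lambda 0.
  by rewrite (Phi0 op_conv h_regular) expR_lt1 oppr_lt0.
move=> /(cvgr_gt _ Pc)/nbhs_ballP[d /= d0 dP].
exists d => // v /andP[v0 vd].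
have : expR (- e) < Phi h lambda v.
  by apply: dP; rewrite /ball/= sub0r normrN ger0_norm.
rewrite -lte_fin Phi_levy_exponent// -[X in (X < _)%E]/(expeR (- e%:E)) ltr_expeR.
by rewrite lteN2 => /ltW.
Qed.

(** Squaring a root of order [2 * n] gives a root of order [n] whose
    characteristic function is nonnegative, hence is the genuine [n]-th root of
    that of [lambda]. *)
Lemma convolution_roots : exists nu_ : nat -> Pplus R, forall n v, 0 <= v ->
  0 <= Phi h (nu_ n) v /\ (Phi h (nu_ n) v ^+ n.+1)%:E = expeR (- levy_exponent v).
Proof.
suff /choice : forall n, exists nu, forall v, 0 <= v ->
   0 <= Phi h nu v /\ (Phi h nu v ^+ n.+1)%:E = expeR (- levy_exponent v).
  by move=> [nu_ nuP]; exists nu_.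
move=> n; have [//|nu nuE] := @lambda_id (n.+1).*2.
exists (op nu nu) => v v0; rewrite (Phi_op op_conv h_regular)//; split.
  by rewrite -expr2 sqr_ge0.
rewrite -expr2 -exprM mul2n -(Phi_gpow op_conv h_regular)// -Phi_levy_exponent//.
by rewrite -(Phi_eq h_regular _ nuE).
Qed.

Lemma cvg_root_exponent (nu_ : nat -> Pplus R) v : 0 <= v ->
  (forall n, 0 <= Phi h (nu_ n) v /\
    (Phi h (nu_ n) v ^+ n.+1)%:E = expeR (- levy_exponent v)) ->
  (forall n, (n.+1%:R * (1 - Phi h (nu_ n) v))%:E <= levy_exponent v)%E /\
  (n.+1%:R * (1 - Phi h (nu_ n) v))%:E @[n --> \oo] --> levy_exponent v.
Proof.
move=> v0; have := levy_exponent_ge0 v.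
case: (levy_exponent v) => [r| |]//.
- rewrite lee_fin => r0 nuP.
  have nuP' n := expR_rate_le (proj1 (nuP n)) (EFin_inj (proj2 (nuP n))).
  split=> [n|]; first by rewrite lee_fin; exact: (nuP' n).1.
  apply: cvg_EFin; first exact: nearW.
  apply: (@cvg_harmonic_le _ _ _ (r ^+ 2)) => n /=.
  rewrite distrC ger0_norm; first exact: (nuP' n).2.
  by rewrite subr_ge0; exact: (nuP' n).1.
- move=> _ nuP; split=> [n|]; first exact: leey.
  have nu0 n : Phi h (nu_ n) v = 0.
    have [_ /= [] /eqP] := nuP n.
    by rewrite expf_eq0/= => /eqP.
  under eq_fun do rewrite nu0 subr0 mulr1.
  apply/cvgeryP.
  rewrite (_ : (fun n => _) = (fun n => (n.+1)%:R : R))//.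
  by rewrite (@cvg_shiftS _ (fun n => n%:R : R)); exact: cvgr_idn.
Qed.

(** * Integrating the exponent in time *)
Section time_integral.
Variables (s t C : R) (g : R -> R).
Hypotheses (st : s < t) (mg : measurable_fun setT g)
  (gC : forall x, 0 <= g x <= C) (g_out : forall x, ~~ (s <= x <= t) -> g x = 0)
  (g_fin : forall u, 0 <= u ->
    (\int[lebesgue_measure]_(x in `[s, t]) levy_exponent (u * g x) < +oo)%E).

Let g0 x : 0 <= g x. Proof. by case/andP: (gC x). Qed.

(** An integer length, so that the convolution powers below have integer order. *)
Let K : nat := (Num.truncn (t - s)).+1.
Let K0 : 0 < K%:R :> R. Proof. by rewrite ltr0n. Qed.
Let sK : s < s + K%:R. Proof. by rewrite ltrDl. Qed.
Let U : probability (measurableTypeR R) R := uniform_prob sK.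

Let me (u : R) : measurable_fun setT (fun x : measurableTypeR R => levy_exponent (u * g x)).
Proof.
apply: (measurableT_comp levy_exponent_measurable).
by apply: measurable_funM => //; exact: mg.
Qed.

Lemma integral_levy_exponent_unif u :
  (K%:R%:E * \int[U]_x levy_exponent (u * g x) =
   \int[lebesgue_measure]_(x in `[s, t]) levy_exponent (u * g x))%E.
Proof.
rewrite /U integral_uniform//; last by move=> x; exact: levy_exponent_ge0.
rewrite addrAC subrr add0r muleA -EFinM mulfV ?gt_eqF// mul1e.
rewrite [LHS]integral_mkcond [RHS]integral_mkcond; apply: eq_integral => x _.
rewrite !patchE; have [xst|xst] := boolP (s <= x <= t).
  have tK : t <= s + K%:R by rewrite -lerBlDl ltW// truncnS_gt.
  rewrite !mem_set//= in_itv//=; case/andP: xst => -> xt /=.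
  exact: le_trans xt tK.
rewrite g_out// mulr0 levy_exponent0.
by case: ifP => _; case: ifP.
Qed.

Let I_fin u : 0 <= u -> (\int[U]_x levy_exponent (u * g x))%E \is a fin_num.
Proof.
move=> u0; rewrite ge0_fin_numE; last first.
  by apply: integral_ge0 => x _; exact: levy_exponent_ge0.
have := g_fin u0; rewrite -integral_levy_exponent_unif.
case: (\int[U]_x _)%E => [r| |]//; rewrite ?ltry//.
by rewrite gt0_muley// lte_fin.
Qed.

Let b u : R := fine (\int[U]_x levy_exponent (u * g x))%E.

(** Randomizing the time produces the average of the roots over time, and
    convolution powers turn the average into a time integral of exponents. *)
Lemma gcf_time_integral : exists mu : Pplus R, forall u, 0 <= u ->
  (Phi h mu u)%:E = expeR (- \int[lebesgue_measure]_(x in `[s, t]) levy_exponent (u * g x)).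
Proof.
have [nu_ nuP] := convolution_roots.
pose X (z : measurableTypeR R * R) : R := g z.1 * `|z.2|.
have mX : measurable_fun setT X.
  apply: measurable_funM; first exact: (measurableT_comp mg measurable_fst).
  by apply: measurableT_comp => //; exact: measurable_snd.
have X0 z : 0 <= X z by rewrite mulr_ge0.
have /choice[rho_ rhoE] : forall n, exists rho, is_law (U \x nu_ n)%E X rho.
  by move=> n; exact: law_exists.
have O1 := Omega_norm_le1 op_conv h_regular.
have mO := Omega_measurable h_regular.
have mP n u : measurable_fun setT (fun x : measurableTypeR R => Phi h (nu_ n) (u * g x)).
  apply: (measurableT_comp (Phi_measurable op_conv h_regular _)).
  by apply: measurable_funM => //; exact: mg.
have P1 := Phi_norm_le1 op_conv h_regular.
have Phi_rho n u : Phi h (rho_ n) u = \int[U]_x Phi h (nu_ n) (u * g x).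
  rewrite (Phi_integral op_conv h_regular).
  have mOu : measurable_fun setT (fun y => Omega h (u * y)).
    exact: (Omega_mul_measurable h_regular).
  rewrite (law_Rintegral mX (rhoE n) mOu (fun y => O1 _)).
  have mOX : measurable_fun setT (fun z => Omega h (u * X z)) := measurableT_comp mOu mX.
  rewrite (bounded_Rintegral_prod12 U (nu_ n) mOX (fun z => O1 _)).
  apply: eq_Rintegral => x _; rewrite (Phi_integral op_conv h_regular).
  apply: eq_Rintegral => y _; rewrite /X/= mulrA -(Omega_abs h_regular) normrM normr_id.
  by rewrite -normrM (Omega_abs h_regular).
(* These rates converge to [b u], the average exponent over the times. *)
pose b_ u n := n.+1%:R * (1 - Phi h (rho_ n) u).
have b_E u n : (b_ u n)%:E = (\int[U]_x (n.+1%:R * (1 - Phi h (nu_ n) (u * g x)))%:E)%E.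
  have mq : measurable_fun setT (fun x : measurableTypeR R =>
      n.+1%:R * (1 - Phi h (nu_ n) (u * g x))).
    by apply: measurable_funM => //; exact: measurable_funB.
  rewrite -(@bounded_RintegralE _ _ _ _ _ (n.+1%:R * (1 + 1))) //; last first.
    move=> x; rewrite normrM normr_nat ler_wpM2l// (le_trans (ler_normB _ _))//.
    by rewrite normr1 lerD.
  congr (_%:E); rewrite /b_ Phi_rho RintegralZl//; last first.
    apply: (@bounded_integrable _ _ _ _ _ (1 + 1)); first exact: measurable_funB.
    by move=> x; rewrite (le_trans (ler_normB _ _))// normr1 lerD.
  rewrite RintegralB//; last 2 first.
  - exact: finite_measure_integrable_cst.
  - exact: (bounded_integrable _ (mP n u) (fun x => P1 _ _)).
  by rewrite Rintegral_cst// [X in _ * fine X]probability_setT mulr1.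
(* Dominated convergence, by the limit itself: see [cvg_root_exponent]. *)
have b_cvg u : 0 <= u -> b_ u n @[n --> \oo] --> b u.
  move=> u0; suff : (b_ u n)%:E @[n --> \oo] --> (b u)%:E by move/fine_cvg.
  rewrite fineK ?I_fin//.
  rewrite (_ : (fun n => _) = (fun n =>
    \int[U]_x (n.+1%:R * (1 - Phi h (nu_ n) (u * g x)))%:E)%E); last first.
    by apply/funext => n; rewrite b_E.
  have rP x := cvg_root_exponent (mulr_ge0 u0 (g0 x)) (fun n => nuP n _ (mulr_ge0 u0 (g0 x))).
  have [//|||||_ _] := @dominated_convergence _ _ _ U setT measurableT
    (fun n x => (n.+1%:R * (1 - Phi h (nu_ n) (u * g x)))%:E)
    (fun x => levy_exponent (u * g x)) (fun x => levy_exponent (u * g x)).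
  - move=> n; apply/measurable_EFinP.
    by apply: measurable_funM => //; exact: measurable_funB.
  - exact: me.
  - by apply: aeW => x _; exact: (rP x).2.
  - apply/integrableP; split; first exact: me.
    under eq_integral do rewrite gee0_abs ?levy_exponent_ge0//.
    by rewrite ltey_eq I_fin.
  - apply: aeW => x n _; rewrite gee0_abs; first exact: (rP x).1.
    rewrite lee_fin mulr_ge0// subr_ge0; apply: le_trans (P1 (nu_ n) (u * g x)).
    exact: ler_norm.
  by [].
(* Order [n * K]: the average over [K] units of time is turned into an integral. *)
have [||mu muE] := @gcf_closed _ op h op_conv h_regular kappa kappa_exponent
  (fun n => gpow op (rho_ n) (n.+1 * K)) (fun u => expR (- (K%:R * b u))).
- move=> u u0; rewrite (_ : (fun n => _) =
      (fun n => ((1 - b_ u n / n.+1%:R) ^+ n.+1) ^+ K)); last first.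
    apply/funext => n; rewrite (Phi_gpow op_conv h_regular)// exprM; congr (_ ^+ _ ^+ _).
    exact: one_sub_scaled.
  rewrite -mulrN expRM_natl.
  apply: (@cvg_comp _ _ _ _ (fun y : R => y ^+ K) _ (nbhs (expR (- b u)))).
    exact: cvg_expR_pow (b_cvg u u0).
  exact: exprn_continuous.
- move=> e e0; have [d d0 dP] := levy_exponent_small (divr_gt0 e0 K0).
  have C0 : 0 < C + 1.
    by rewrite ltr_pwDr//; case/andP: (gC 0) => h1 h2; exact: le_trans h1 h2.
  exists (d / (C + 1)); first exact: divr_gt0.
  move=> u /andP[u0 ud]; have buK : b u <= e / K%:R.
    rewrite -lee_fin fineK ?I_fin//.
    apply: (@le_trans _ _ (\int[U]_x (e / K%:R)%:E)%E).
      apply: ge0_le_integral => //.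
      + by move=> x _; exact: levy_exponent_ge0.
      + move=> x _; apply: dP; rewrite mulr_ge0//=.
        rewrite ltr_pdivlMr// in ud; apply: le_lt_trans ud.
        rewrite ler_wpM2l//; case/andP: (gC x) => _ /le_trans; apply.
        by rewrite lerDl.
    by rewrite integral_cst// [X in (_ * X)%E]probability_setT mule1.
  apply: le_trans (expR_ge1Dx _); rewrite lerD2l lerN2.
  by rewrite -ler_pdivlMl// mulrC.
exists mu => u u0; rewrite muE// -integral_levy_exponent_unif.
by rewrite -(fineK (I_fin u0)) -EFinM.
Qed.

End time_integral.


(** [f] is only known to be measurable on the half-line; cutting it off gives a
    function that is bounded and measurable on the whole line. *)
Definition cutoff (f : R -> R) (s t x : R) : R := if s <= x <= t then f x else 0.

Section exponent_of_integral.
Variables (f : R -> R) (s t : R).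
Hypotheses (f_class : class_A h kappa x0 m f) (s0 : 0 <= s) (st : s < t).

Let st_sub : `[s, t]%classic `<=` `[0%R, +oo[%classic.
Proof. by move=> x/=; rewrite !in_itv/= andbT => /andP[/(le_trans s0)]. Qed.


Local Notation cut := (cutoff f s t).

Lemma measurable_cut : measurable_fun setT cut.
Proof.
case: f_class => _ mf _ _ _.
have mst : measurable (`[s, t]%classic : set R) := measurable_itv `[s, t].
have m0 : measurable (`[0, +oo[%classic : set R) := measurable_itv `[0, +oo[.
have mfst : measurable_fun (`[s, t]%classic : set R) f by exact: measurable_funS mf.
have -> : cut = (f : R -> R) \_ (`[s, t]%classic : set R).
  apply/funext => x; rewrite patchE /cutoff; case: ifP => [xst|xst].
    by rewrite mem_set//= in_itv.
  by rewrite memNset//= in_itv/= xst.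
by apply/(measurable_restrictT f mst).
Qed.

Lemma cut_ge0 x : 0 <= cut x.
Proof.
case: f_class => f0 _ _ _ _; rewrite /cutoff; case: ifP => // /andP[sx _].
by apply: f0; exact: le_trans sx.
Qed.

Lemma integral_cut (F : R -> \bar R) : F 0 = 0%E ->
  (\int[lebesgue_measure]_(x in `[s, t]) F (f x) =
   \int[lebesgue_measure]_x F (cut x))%E.
Proof.
move=> F0; rewrite integral_mkcond; apply: eq_integral => x _.
rewrite patchE /cutoff; case: ifPn; first by rewrite inE/= in_itv/= => ->.
by rewrite notin_setE/= in_itv/= => /negP/negbTE ->.
Qed.

(** Tonelli's theorem, after extending all integrals to the whole line: the
    density of the exponent vanishes where the cut-off function does. *)
Lemma levy_exponent_integral u : 0 <= u ->
  (\int[lebesgue_measure]_(x in `[s, t]) levy_exponent (u * f x) =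
   (A * u `^ kappa)%:E * \int[lebesgue_measure]_(x in `[s, t]) (f x `^ kappa)%:E +
   \int[m]_(r in `]0%R, +oo[) \int[lebesgue_measure]_(x in `[s, t])
     ((1 - Omega h (u * f x * r)) / upsilon h x0 r)%:E)%E.
Proof.
move=> u0.
rewrite (@integral_cut (fun y => levy_exponent (u * y))) ?mulr0 ?levy_exponent0//.
rewrite (@integral_cut (fun y => (y `^ kappa)%:E)) ?powR0 ?gt_eqF//.
have mu_cut : measurable_fun setT (fun x : measurableTypeR R => u * cut x).
  by apply: measurable_funM => //; exact: measurable_cut.
have mcutk : measurable_fun setT (fun x : measurableTypeR R => cut x `^ kappa).
  exact: (measurableT_comp (measurable_powR kappa) measurable_cut).
have mden : measurable_fun setT (fun z : measurableTypeR R * R =>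
    (levy_density (u * cut z.1) z.2)%:E).
  apply/measurable_EFinP.
  pose k (z : measurableTypeR R * R) : R * R := (u * cut z.1, z.2).
  apply: (@measurableT_comp _ _ _ _ _ _ _ _ k levy_density_measurable).
  apply/measurable_fun_pairP; split; last exact: measurable_snd.
  exact: (measurableT_comp mu_cut measurable_fst).
have den0 z : (0 <= (levy_density (u * cut z.1) z.2)%:E)%E.
  by rewrite lee_fin levy_density_ge0.
have -> : (\int[lebesgue_measure]_x levy_exponent (u * cut x) =
   \int[lebesgue_measure]_x ((A * u `^ kappa)%:E * (cut x `^ kappa)%:E) +
   \int[lebesgue_measure]_x \int[m]_r (levy_density (u * cut x) r)%:E)%E.
  apply: (@etrans _ _ (\int[lebesgue_measure]_x ((A * u `^ kappa)%:E * (cut x `^ kappa)%:E +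
      \int[m]_r (levy_density (u * cut x) r)%:E)))%E.
    apply: eq_integral => x _; rewrite /levy_exponent; congr (_ + _)%E.
    by rewrite -EFinM powRM ?(cut_ge0 x)// mulrA.
  apply: ge0_integralD => //.
  - by move=> x _; rewrite -EFinM lee_fin !mulr_ge0// powR_ge0.
  - by apply: measurable_funeM; exact/measurable_EFinP.
  - by move=> x _; apply: integral_ge0 => r _; rewrite lee_fin levy_density_ge0.
  - exact: (measurableT_comp levy_integral_measurable mu_cut).
congr (_ + _)%E.
  rewrite ge0_integralZl//.
  - exact/measurable_EFinP.
  - by move=> x _; rewrite lee_fin powR_ge0.
  - by rewrite lee_fin mulr_ge0// powR_ge0.
rewrite (fubini_tonelli (m2 := m) _ mden den0).
rewrite [RHS]integral_mkcond; apply: eq_integral => r _.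
rewrite patchE /=; case: ifPn.
  rewrite inE/= in_itv/= andbT => r0; rewrite (@integral_cut (fun y => ((1 - Omega h (u * y * r)) / upsilon h x0 r)%:E)).
    by apply: eq_integral => x _; rewrite /levy_density r0.
  by rewrite mulr0 mul0r (Omega0 op_conv h_regular) subrr mul0r.
rewrite notin_setE/= in_itv/= andbT => /negP/negbTE r0.
by under eq_integral do rewrite /levy_density r0; rewrite integral0.
Qed.

End exponent_of_integral.

Lemma levy_exponent_integral_lty (f : R -> R) (s t u : R) :
  class_A h kappa x0 m f -> 0 <= s -> s < t -> 0 <= u ->
  (\int[lebesgue_measure]_(x in `[s, t]) levy_exponent (u * f x) < +oo)%E.
Proof.
move=> f_class s0 st; rewrite le_eqVlt => /predU1P[<-|u0].
  by under eq_integral do rewrite mul0r levy_exponent0; rewrite integral0 ltry.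
have t0 : 0 < t by exact: le_lt_trans st.
have [_ mf _ fk_fin fm_fin] := f_class.
have mf0 : measurable_fun (`[0, t]%classic : set R) f.
  apply: measurable_funS mf; first exact: measurable_itv.
  by move=> x/=; rewrite !in_itv/= andbT => /andP[].
apply: (@le_lt_trans _ _ (\int[lebesgue_measure]_(x in `[0%R, t]) levy_exponent (u * f x)))%E.
  apply: ge0_subset_integral => //.
  - apply: (measurableT_comp levy_exponent_measurable).
    by apply: measurable_funM => //; exact: mf0.
  - by move=> x _; exact: levy_exponent_ge0.
  - by move=> x/=; rewrite !in_itv/= => /andP[/(le_trans s0) -> ->].
rewrite (@levy_exponent_integral f 0 t f_class (lexx _))//; last exact: ltW.
apply: lte_add_pinfty; last exact: fm_fin.
by apply: lte_mul_pinfty => //; [rewrite lee_fin mulr_ge0// powR_ge0|exact: fk_fin].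
Qed.

Lemma gcf_Psi (f : R -> R) (s t : R) : class_A h kappa x0 m f -> 0 <= s -> s < t ->
  exists mu : Pplus R, forall u, 0 <= u ->
  (Phi h mu u)%:E = expeR (- \int[lebesgue_measure]_(x in `[s, t]) levy_exponent (u * f x)).
Proof.
move=> f_class s0 st; have [_ _ f_bd _ _] := f_class.
have [C fC] := f_bd s t s0.
have cutP (u : R) : (\int[lebesgue_measure]_(x in `[s, t]) levy_exponent (u * cutoff f s t x) =
    \int[lebesgue_measure]_(x in `[s, t]) levy_exponent (u * f x))%E.
  by apply: eq_integral => x; rewrite inE/= in_itv/= /cutoff => ->.
have [||||mu muE] := @gcf_time_integral s t (Num.max C 0) (cutoff f s t).
- exact: (@measurable_cut f s t f_class s0).
- move=> x; rewrite (@cut_ge0 f s t f_class s0)//= /cutoff; case: ifP => [/fC fxC|_].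
    by rewrite le_max fxC.
  by rewrite le_max lexx orbT.
- by move=> x /negbTE; rewrite /cutoff => ->.
- by move=> u u0; rewrite cutP; exact: levy_exponent_integral_lty.
by exists mu => u u0; apply: (etrans (muE u u0)); rewrite cutP.
Qed.

Lemma Psi_levy_exponent (f : R -> R) (s t u : R) :
  class_A h kappa x0 m f -> 0 <= s -> s < t -> 0 <= u ->
  Psi h kappa x0 A m f s t u =
  expeR (- \int[lebesgue_measure]_(x in `[s, t]) levy_exponent (u * f x)).
Proof.
move=> f_class s0 st u0.
have negD (a b : \bar R) : (a +? b)%E -> (- a - b = - (a + b))%E by move=> ab; rewrite oppeD.
rewrite (@levy_exponent_integral f s t f_class s0)// /Psi.
apply: (congr1 (@expeR R)); apply: negD; apply: ge0_adde_def; rewrite inE.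
  rewrite mule_ge0// ?lee_fin ?mulr_ge0 ?powR_ge0//.
  by apply: integral_ge0 => x _; rewrite lee_fin powR_ge0.
apply: integral_ge0 => r; rewrite /= in_itv/= andbT => r0.
apply: integral_ge0 => x _; rewrite lee_fin divr_ge0//.
  by rewrite subr_ge0; exact: (Omega_le1 op_conv h_regular).
exact/ltW/upsilon_gt0.
Qed.

End levy_exponent.

(** * The semigroup and its transition function *)

Section additive_kernels.
Context {R : realType} (op : Pplus R -> Pplus R -> Pplus R).
Hypothesis op_conv : generalized_convolution op.

Lemma integral_carried (mu : Pplus R) (g : R -> \bar R) :
  measurable_fun setT g -> (forall x : R, 0 <= g x)%E ->
  (\int[mu]_(x in `[0%R, +oo[) g x = \int[mu]_x g x)%E.
Proof.
move=> mg g0.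
have m0 : measurable (`[0%R, +oo[%classic : set R) := measurable_itv `[0, +oo[.
have m1 : measurable (`]-oo, 0%R[%classic : set R) := measurable_itv `]-oo, 0[.
have -> : [set: R] = `]-oo, 0%R[%classic `|` `[0%R, +oo[%classic.
  by apply/seteqP; split=> // x _ /=; rewrite !in_itv/= andbT; case: ltP; [left|right].
rewrite ge0_integral_setU//.
- rewrite [X in (X + _)%E](_ : _ = 0%E) ?add0e//.
  by apply: null_set_integral => //; [exact: measurable_funTS|exact: Pplus_lt0].
- exact: measurable_funTS.
- rewrite disj_set2E; apply/eqP/seteqP; split => // x [] /=.
  by rewrite !in_itv/= andbT => /lt_geF ->.
Qed.

(** By associativity [op (delta x) (mu s u)] is the convolution of
    [op (delta x) (mu s t)] with [mu t u], which [conv_integral] expresses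
    through the kernel. *)
Lemma additive_transition_function (mu : R -> R -> Pplus R) :
  (forall s t u, 0 <= s -> s < t -> t < u -> op (mu s t) (mu t u) =P+ mu s u) ->
  transition_function (fun s t x => op (delta x) (mu s t)).
Proof.
move=> mu_op; split.
  by move=> s t B s0 st mB; apply: measurable_funTS; exact: conv_measurable.
move=> s t u x B s0 st tu _ mB.
have eqs : op (delta x) (mu s u) =P+ op (op (delta x) (mu s t)) (mu t u).
  apply: eq_Pplus_trans (gc_assoc op_conv _ _ _).
  apply: op_congr => //; apply: eq_Pplus_sym; exact: mu_op.
rewrite eqs// integral_carried//; last exact: conv_measurable.
have mI : measurable_fun setT (fun y : R => (\1_B y)%:E : \bar R).
  by apply/measurable_EFinP; exact: measurable_indic.
have indicE (nu : Pplus R) : nu B = (\int[nu]_y (\1_B y)%:E)%E.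
  by rewrite integral_indic// setIT.
rewrite indicE (conv_integral op_conv _ _ mI)//.
by apply: eq_integral => y _; rewrite -indicE.
Qed.

End additive_kernels.

Section semigroup.
Context {R : realType} (op : Pplus R -> Pplus R -> Pplus R) (h : Pplus R -> R).
Hypotheses (op_conv : generalized_convolution op)
  (h_regular : regular_homomorphism op h).
Variables (kappa x0 A : R) (m : {finite_measure set R -> \bar R}).
Hypotheses (kappa_exponent : is_characteristic_exponent h kappa)
  (x0_gt0 : 0 < x0) (Omega_lt1 : forall x, 0 < x <= x0 -> Omega h x < 1)
  (A_ge0 : 0 <= A).

Lemma levy_exponent_integral_cat (f : R -> R) (s t u v : R) :
  class_A h kappa x0 m f -> 0 <= s -> s < t -> t < u ->
  (\int[lebesgue_measure]_(x in `[s, u]) levy_exponent h kappa x0 A m (v * f x) =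
   \int[lebesgue_measure]_(x in `[s, t]) levy_exponent h kappa x0 A m (v * f x) +
   \int[lebesgue_measure]_(x in `[t, u]) levy_exponent h kappa x0 A m (v * f x))%E.
Proof.
move=> f_class s0 st tu; have [_ mf _ _ _] := f_class.
have mst : measurable (`[s, t]%classic : set (measurableTypeR R)) := measurable_itv _.
have mtu : measurable (`]t, u]%classic : set (measurableTypeR R)) := measurable_itv _.
have suE : `[s, u]%classic = `[s, t]%classic `|` `]t, u]%classic :> set R.
  by apply: itv_bndbnd_setU; rewrite bnd_simp ltW.
have mE : measurable_fun (`[s, u]%classic : set (measurableTypeR R))
    (fun x => levy_exponent h kappa x0 A m (v * f x)).
  apply: (@measurableT_comp _ _ _ _ _ _ (levy_exponent h kappa x0 A m)).
    exact: (levy_exponent_measurable op_conv h_regular).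
  apply: measurable_funM => //; apply: measurable_funS mf; first exact: measurable_itv.
  by move=> x/=; rewrite !in_itv/= andbT => /andP[/(le_trans s0)].
rewrite -[X in (_ + X)%E]integral_itv_obnd_cbnd; last first.
  apply: measurable_funS mE; first exact: measurable_itv.
  by rewrite suE; exact: subsetUr.
rewrite suE ge0_integral_setU//.
- by rewrite -suE.
- by move=> x _; exact: (levy_exponent_ge0 op_conv h_regular).
- rewrite disj_set2E; apply/eqP/seteqP; split => // x [] /=.
  by rewrite !in_itv/= => /andP[_ xt] /andP[] /lt_geF; rewrite xt.
Qed.

(** Both sides have the same characteristic function, because exponents are
    additive over adjacent time intervals. *)
Lemma time_integral_semigroup (f : R -> R) (Pf : R -> R -> Pplus R) :
  class_A h kappa x0 m f ->
  (forall s t u, 0 <= s -> s < t -> 0 <= u ->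
       (Phi h (Pf s t) u)%:E =
   expeR (- \int[lebesgue_measure]_(x in `[s, t]) levy_exponent h kappa x0 A m (u * f x))) ->
  forall s t u, 0 <= s -> s < t -> t < u -> op (Pf s t) (Pf t u) =P+ Pf s u.
Proof.
move=> f_class PfE s t u s0 st tu.
apply: (Phi_inj op_conv h_regular kappa_exponent) => v v0.
have t0 : 0 <= t by rewrite ltW// (le_lt_trans s0).
apply: EFin_inj; rewrite (Phi_op op_conv h_regular)// EFinM.
have e1 := PfE s t v s0 st v0; have e2 := PfE t u v t0 tu v0.
have e3 := PfE s u v s0 (lt_trans st tu) v0.
apply: (etrans (congr2 _ e1 e2)); apply: (etrans _ (esym e3)).
rewrite -expeRD; apply: (congr1 (@expeR R)).
have negD (a b : \bar R) : (a +? b)%E -> (- a - b = - (a + b))%E by move=> ab; rewrite oppeD.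
rewrite (@levy_exponent_integral_cat f s t u)//; apply: negD; apply: ge0_adde_def; rewrite inE.
  by apply: integral_ge0 => x _; exact: (levy_exponent_ge0 op_conv h_regular).
by apply: integral_ge0 => x _; exact: (levy_exponent_ge0 op_conv h_regular).
Qed.

End semigroup.

(** * Contents on cylinder sets *)

Section cylinders.
Context {I : choiceType}.

Definition depends_on (L : seq I) (C : set (I -> bool)) :=
  forall w w', {in L, w =1 w'} -> C w -> C w'.

Definition cylinder : set (set (I -> bool)) := [set C | exists L, depends_on L C].

Lemma depends_on_sub (L L' : seq I) C :
  {subset L <= L'} -> depends_on L C -> depends_on L' C.
Proof. by move=> LL' dC w w' ww'; apply: dC => i /LL'; exact: ww'. Qed.

Lemma depends_onC L C : depends_on L C -> depends_on L (~` C).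
Proof. by move=> dC w w' ww' Cw /(dC w' w) Cw'; apply/Cw/Cw' => i /ww'. Qed.

Lemma depends_onU L C D : depends_on L C -> depends_on L D -> depends_on L (C `|` D).
Proof. by move=> dC dD w w' ww' [/(dC _ _ ww')|/(dD _ _ ww')]; [left|right]. Qed.

Lemma depends_onI L C D : depends_on L C -> depends_on L D -> depends_on L (C `&` D).
Proof. by move=> dC dD w w' ww' [/(dC _ _ ww') ? /(dD _ _ ww')]. Qed.

Lemma cylinder0 : cylinder set0. Proof. by exists [::]. Qed.

Lemma cylinderC : setC_closed cylinder.
Proof. by move=> C [L dC]; exists L; exact: depends_onC. Qed.

Lemma cylinderU : setU_closed cylinder.
Proof.
move=> C D [L dC] [L' dD]; exists (L ++ L'); apply: depends_onU.
  by apply: depends_on_sub dC => i; rewrite mem_cat => ->.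
by apply: depends_on_sub dD => i; rewrite mem_cat => ->; rewrite orbT.
Qed.

(** Induction on the coordinates, splitting on the value of the first one. *)
Lemma depends_on_preimage d (T : measurableType d) (e : T -> I -> bool) L C :
  (forall i, i \in L -> measurable [set x | e x i]) -> depends_on L C ->
  measurable (e @^-1` C).
Proof.
elim: L C => [|i L IHL] C me dC.
  have [[w Cw]|C0] := pselect (C !=set0).
    by rewrite (_ : _ @^-1` _ = setT)//; apply/seteqP; split => // x _; exact: dC Cw.
  by rewrite (_ : _ @^-1` _ = set0)//; apply/seteqP; split => // x /= Cx; case: C0; exists (e x).
pose upd b (w : I -> bool) j := if j == i then b else w j.
have mC b : measurable (e @^-1` [set w | C (upd b w)]).
  apply: IHL; first by move=> j jL; apply: me; rewrite in_cons jL orbT.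
  move=> w w' ww'; apply: dC => j; rewrite in_cons /upd.
  by case: eqP => //= _; exact: ww'.
have mi : measurable [set x | e x i] by apply: me; rewrite mem_head.
rewrite (_ : _ @^-1` _ = ([set x | e x i] `&` (e @^-1` [set w | C (upd true w)])) `|`
   (~` [set x | e x i] `&` (e @^-1` [set w | C (upd false w)]))); last first.
  have updE x : C (e x) = C (upd (e x i) (e x)).
    by congr C; apply/funext => j; rewrite /upd; case: eqP => [->|].
  apply/seteqP; split=> x /=; rewrite updE.
    by case: (e x i); [left|right].
  by case: (e x i) => [[[]//|[]//]|[[]//|[]//]].
by apply: measurableU; apply: measurableI => //; exact: measurableC.
Qed.

(** Compactness of the space of functions to [bool]: an ultrafilter that contains
    all [F n] decides the value of each coordinate, and the point with these
    values lies in every cylinder of the ultrafilter. *)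
Lemma cylinder_compact (F : nat -> set (I -> bool)) : (forall n, cylinder (F n)) ->
  (forall n, F n.+1 `<=` F n) -> (forall n, F n !=set0) -> (\bigcap_n F n) !=set0.
Proof.
move=> cF dF F0.
have Fle n m : (n <= m)%N -> F m `<=` F n.
  elim: m => [|m IHm]; first by rewrite leqn0 => /eqP ->.
  rewrite leq_eqVlt => /predU1P[->//|]; rewrite ltnS => /IHm; exact: subset_trans.
have FF : ProperFilter (filter_from [set: nat] F).
  apply: filter_from_proper; last by move=> n _; exact: F0.
  apply: filter_from_filter; first by exists 0%N.
  move=> n m _ _; exists (maxn n m) => // w Fw.
  by split; apply: Fle Fw; rewrite ?leq_maxl ?leq_maxr.
have [G [GU FG]] := ultraFilterLemma FF.
pose w i : bool := `[< G [set w' : I -> bool | w' i] >].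
have Gw i : G [set w' : I -> bool | w' i = w i].
  have [Gi|Gi] := in_ultra_setVsetC [set w' : I -> bool | w' i] GU.
    have wi : w i = true by exact: asboolT.
    by apply: filterS Gi => w' /= ->.
  have wi : w i = false.
    by apply: asboolF => Gi'; have [w'' []] := filter_ex (filterI Gi Gi').
  by apply: filterS (Gi) => w' /= /negP/negbTE ->.
have GL (L : seq I) : G [set w' : I -> bool | {in L, w' =1 w}].
  elim: L => [|i L IHL]; first by apply: filterS filterT => w' _ j.
  apply: filterS (filterI (Gw i) IHL) => w' [/= w'i w'L] j.
  by rewrite in_cons => /predU1P[->//|/w'L].
exists w => n _; have [L dF'] := cF n.
have GFn : G (F n) by apply: FG; exists n.
by have [w' [Fw' /= w'w]] := filter_ex (filterI GFn (GL L)); exact: dF' Fw'.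
Qed.

End cylinders.

(** An alias, to carry the algebra of cylinder sets. *)
Definition bits (I : choiceType) : Type := I -> bool.

HB.instance Definition _ (I : choiceType) := Pointed.copy (bits I) (I -> bool).

Fact cylinder_display : measure_display. Proof. by []. Qed.

HB.instance Definition _ (I : choiceType) := @isAlgebraOfSets.Build cylinder_display
  (bits I) (@cylinder I) (@cylinder0 I) (@cylinderU I) (@cylinderC I).

Section cylinder_extension.
Context {R : realType} {I : choiceType}.
Variable Q0 : set (bits I) -> \bar R.
Hypotheses (Q0_ge0 : forall C, (0 <= Q0 C)%E) (Q00 : Q0 set0 = 0%E)
  (Q0T : Q0 setT = 1%E)
  (Q0U : forall C D, cylinder C -> cylinder D -> C `&` D = set0 ->
    Q0 (C `|` D) = (Q0 C + Q0 D)%E).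

Let content := Q0.

(** By compactness, if a disjoint union of cylinders is a cylinder, finitely many
   of them already cover it. *)
Let content_sigma_additive : semi_sigma_additive (content : set (bits I) -> \bar R).
Proof.
move=> F cF tF cUF.
have content_additive : measure_function.semi_additive (content : set (bits I) -> \bar R).
  by apply/additive2P => // C D cC cD CD; exact: Q0U.
have cFn n : cylinder (\big[setU/set0]_(i < n) F i).
  by apply: (@bigsetU_measurable _ (bits I)) => i _; exact: cF.
have [N FN] : exists N, \bigcup_n F n `<=` \big[setU/set0]_(i < N) F i.
  apply: contrapT => noN.
  pose D n := \bigcup_n F n `\` \big[setU/set0]_(i < n) F i.
  have cD n : cylinder (D n) by apply: (@measurableD _ (bits I)); [exact: cUF|exact: cFn].
  have [|n|w Dw] := @cylinder_compact I D cD.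
  - move=> n w [Uw Fw]; split=> // Fw'; apply: Fw.
    by rewrite big_ord_recr; left.
  - apply: contrapT => Dn; apply: noN; exists n => w Uw.
    by apply: contrapT => Fw; apply: Dn; exists w.
  have [[n _ Fn] _] := Dw 0%N Logic.I.
  have [_] := Dw n.+1 Logic.I; apply.
  by rewrite big_ord_recr; right.
apply: cvg_near_cst; exists N => // n /= Nn.
have FnE : content (\big[setU/set0]_(i < n) F i) = (\sum_(i < n) content (F i))%E.
  by apply: content_additive => //; exact: cFn.
rewrite big_mkord -FnE; congr content; apply/seteqP; split.
  by rewrite -bigcup_mkord => w [i /= _ Fi]; exists i.
apply: subset_trans FN _; rewrite -!bigcup_mkord => w [i /= iN Fi].
by exists i => //=; exact: leq_trans Nn.
Qed.

HB.instance Definition _ := isMeasure.Build cylinder_display (bits I) R content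
  Q00 Q0_ge0 content_sigma_additive.

Lemma cylinder_extension :
  exists Q : probability (g_sigma_algebraType (measurable : set (set (bits I)))) R,
    forall C, cylinder C -> Q C = Q0 C.
Proof.
pose m : {measure set (g_sigma_algebraType (measurable : set (set (bits I)))) -> \bar R} :=
  measure_extension content.
have mE C : cylinder C -> m C = Q0 C by exact: (@measurable_mu_extE _ _ (bits I)).
have [|P PE] := @probability_of_measure R _ _ m.
  by rewrite mE//; exact: (@measurableT _ (bits I)).
by exists P => C cC; rewrite PE mE.
Qed.

End cylinder_extension.

(** * Markov chains on finitely many times *)

Section transition_kernels.
Context {R : realType} (p : R -> R -> R -> Pplus R).
Hypothesis p_transition : transition_function p.

(** The absolute value extends the transition function, meaningful on the
    half-line only, to a kernel on the line. *)
Definition kern (s t x : R) : Pplus R := p s t `|x|.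

Let kern_set s t B : 0 <= s -> s < t -> measurable B ->
  measurable_fun setT (fun x : R => kern s t x B).
Proof.
move=> s0 st mB; pose a (x : R) : R := `|x|.
have m0 : measurable (`[0, +oo[%classic : set R) := measurable_itv `[0, +oo[.
have aP : range a `<=` `[0, +oo[%classic.
  by move=> _ [x _ <-]; rewrite /= in_itv/= andbT normr_ge0.
exact: (measurable_comp m0 aP (tf_measurable p_transition s0 st mB) (@normr_measurable _ setT)).
Qed.

Lemma kern_measurable s t (g : R -> \bar R) : 0 <= s -> s < t ->
  measurable_fun setT g -> (forall y : R, 0 <= g y)%E ->
  measurable_fun setT (fun x => \int[kern s t x]_y g y)%E.
Proof.
move=> s0 st mg g0.
(* Only the measurability part of [Pplus_mixture] is wanted: a mixture over a
   point mass meets its hypothesis. *)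
pose rho0 : Pplus R := kern s t 0.
have [r rE] : exists r : Pplus R, forall a, 0 <= a ->
    r `]-oo, a]%classic = (\int[delta 0]_x kern s t x `]-oo, a]%classic)%E.
  exists rho0 => a a0; rewrite integral_dirac//; last by apply: kern_set.
  by rewrite diracT mul1e normr0.
have [_ h _] := Pplus_mixture (K := kern s t)
  (fun a _ => kern_set s0 st (measurable_itv `]-oo, a])) rE.
exact: h.
Qed.

Lemma kern_chapman s t u x (g : R -> \bar R) : 0 <= s -> s < t -> t < u ->
  measurable_fun setT g -> (forall y : R, 0 <= g y)%E ->
  (\int[kern s u x]_y g y = \int[kern s t x]_y \int[kern t u y]_z g z)%E.
Proof.
move=> s0 st tu mg g0; have t0 : 0 <= t by rewrite ltW// (le_lt_trans s0).
have [||_ _ h] := @Pplus_mixture _ (kern t u) (kern s t x) (kern s u x).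
- by move=> a _; apply: kern_set => //; exact: measurable_itv.
- move=> a _; have ma : measurable (`]-oo, a]%classic : set R) := measurable_itv _.
  rewrite -integral_carried//; last exact: kern_set.
  rewrite /kern (tf_chapman_kolmogorov p_transition s0 st tu)//.
  by apply: eq_integral => y; rewrite inE/= in_itv/= andbT => y0; rewrite ger0_norm.
exact: h.
Qed.

Definition rect {T : Type} (Z : R -> T -> R) (J : seq R) (B : R -> set R) : set T :=
  [set w | forall r, r \in J -> B r (Z r w)].

Lemma rect_cons T (Z : R -> T -> R) t J B :
  rect Z (t :: J) B = rect Z J B `&` Z t @^-1` B t.
Proof.
apply/seteqP; split=> [w BZ|w [BZ Bt] r].
  by split=> [r rJ|]; apply: BZ; rewrite ?mem_head// in_cons rJ orbT.
by rewrite in_cons => /predU1P[->|/BZ].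
Qed.

Lemma rect_nil T (Z : R -> T -> R) B : rect Z [::] B = setT.
Proof. exact/seteqP. Qed.

Lemma rect_measurable d (T : measurableType d) (Z : R -> T -> R) J B :
  (forall t, t \in J -> measurable_fun setT (Z t)) -> (forall t, measurable (B t)) ->
  measurable (rect Z J B).
Proof.
move=> mZ mB; elim: J mZ => [|t J IHJ] mZ; first by rewrite rect_nil.
rewrite rect_cons; apply: measurableI.
  by apply: IHJ => r rJ; apply: mZ; rewrite in_cons rJ orbT.
by rewrite -[X in measurable X]setTI; apply: mZ => //; rewrite mem_head.
Qed.

(** The Markov property is stated against rectangles in the past and for
    functions of a later state, the form in which one more time can be added. *)
Record chain (nu : Pplus R) (J : seq R) d (T : measurableType d)
    (P : probability T R) (Z : R -> T -> R) : Prop := {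
  chain_measurable : forall t, measurable_fun setT (Z t) ;
  chain_ge0 : forall t w, 0 <= Z t w ;
  chain_initial : is_law P (Z 0) nu ;
  chain_markov : forall L B s t (g : R -> \bar R), {subset L <= J} ->
    (forall r, r \in L -> r <= s) -> s \in J -> t \in J -> s < t ->
    (forall r, measurable (B r)) -> measurable_fun setT g -> (forall y : R, 0 <= g y)%E ->
    (\int[P]_(w in rect Z L B) g (Z t w) =
     \int[P]_(w in rect Z L B) \int[kern s t (Z s w)]_y g y)%E }.

Lemma chain_sub nu J J' d (T : measurableType d) (P : probability T R) Z :
  {subset J' <= J} -> chain nu J P Z -> chain nu J' P Z.
Proof.
move=> J'J [mZ Z0 Zi Zm]; split=> // L B s t g LJ Ls sJ tJ.
by apply: Zm => //; [move=> r /LJ/J'J|exact: J'J|exact: J'J].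
Qed.

(** Strictly decreasing lists of times that end with [0]; the most recent time
    comes first, so that induction adds a time in the future. *)
Definition times (J : seq R) := sorted >%R J && (last 1 J == 0).

Lemma times_ind (Q : seq R -> Prop) : Q [:: 0] ->
  (forall u t J, t < u -> times (t :: J) -> Q (t :: J) -> Q (u :: t :: J)) ->
  forall J, times J -> Q J.
Proof.
move=> Q0 QS; elim=> [|u [|t J] IHJ]; rewrite /times/=; first by rewrite oner_eq0.
  by move=> /eqP ->.
move=> /andP[/andP[tu tJ] J0]; have tt : times (t :: J) by rewrite /times/= tJ.
by apply: QS => //; exact: IHJ.
Qed.

Lemma times_bound J : times J -> forall r, r \in J -> 0 <= r <= head 0 J.
Proof.
move: J; apply: times_ind => [r|u t J tu _ IHJ r]; first by rewrite inE => /eqP ->/=; rewrite lexx.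
rewrite in_cons => /predU1P[->|/IHJ /andP[-> rt]]/=.
  by rewrite lexx andbT; have /andP[/le_trans + _] := IHJ t (mem_head _ _); apply; exact: ltW.
by rewrite (le_trans rt)// ltW.
Qed.

Lemma times_zero J : times J -> 0 \in J.
Proof.
by move: J; apply: times_ind => [|u t J _ _ J0]; rewrite ?mem_head// in_cons J0 orbT.
Qed.

Lemma times_exist (S : seq R) : (forall r, r \in S -> 0 <= r) ->
  exists2 J, times J & {subset S <= J}.
Proof.
move=> S0; pose J := rev (0 :: sort <=%R (undup [seq r <- S | 0 < r])).
exists J; last first.
  move=> r rS; rewrite mem_rev in_cons mem_sort mem_undup mem_filter rS andbT.
  by rewrite eq_sym -le_eqVlt S0.
rewrite /times /J rev_sorted; apply/andP; split; last by rewrite rev_cons last_rcons.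
rewrite /= (path_sortedE lt_trans) sort_lt_sorted undup_uniq andbT.
by apply/allP => r; rewrite mem_sort mem_undup mem_filter => /andP[].
Qed.

(** The Markov property at the most recent time expresses the law of the chain
    on [u :: t :: J] by its law on [t :: J]. *)
Lemma chain_unique nu d (T : measurableType d) (P : probability T R) Z
    d' (T' : measurableType d') (P' : probability T' R) Z' J : times J ->
  chain nu J P Z -> chain nu J P' Z' ->
  forall B (g : R -> \bar R), (forall r, measurable (B r)) ->
  measurable_fun setT g -> (forall y : R, 0 <= g y)%E ->
  (\int[P]_(w in rect Z J B) g (Z (head 0%R J) w) =
   \int[P']_(w in rect Z' J B) g (Z' (head 0%R J) w))%E.
Proof.
move: J; apply: times_ind => [|u t J tu tJ IHJ] cP cP' B g mB mg g0.
  rewrite !rect_cons !rect_nil !setTI /=.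
  have mgB : measurable_fun (B 0) g by exact: measurable_funTS.
  rewrite -(law_integral (chain_measurable cP 0) (chain_initial cP) (mB 0) mgB)//.
  by rewrite -(law_integral (chain_measurable cP' 0) (chain_initial cP') (mB 0) mgB).
have sub : {subset t :: J <= u :: t :: J} by move=> r rJ; rewrite in_cons rJ orbT.
pose gB : R -> \bar R := g \_ (B u).
have mgB : measurable_fun setT gB.
  by apply/(measurable_restrictT g (mB u)); exact: measurable_funTS.
have gB0 y : (0 <= gB y)%E by rewrite /gB patchE; case: ifP.
have t0 : 0 <= t by case/andP: (times_bound tJ (mem_head _ _)).
have mk := kern_measurable t0 tu mgB gB0.
have k0 y : (0 <= \int[kern t u y]_z gB z)%E by exact: integral_ge0.
have step d0 (T0 : measurableType d0) (P0 : probability T0 R) Z0 :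
    chain nu (u :: t :: J) P0 Z0 ->
    (\int[P0]_(w in rect Z0 (u :: t :: J) B) g (Z0 u w) =
     \int[P0]_(w in rect Z0 (t :: J) B) \int[kern t u (Z0 t w)]_y gB y)%E.
  move=> c0; rewrite rect_cons integral_mkcondr -(chain_markov c0)//.
  - by move=> r /(times_bound tJ)/andP[].
  - by apply: sub; rewrite mem_head.
  - by rewrite mem_head.
rewrite /= !step//.
exact: (IHJ (chain_sub sub cP) (chain_sub sub cP') _ _ mB mk k0).
Qed.

Lemma integral_prod_setX d (T : measurableType d) (P : probability T R)
    d' (T' : measurableType d') (P' : probability T' R) (E : set T) (F : T * T' -> \bar R) :
  measurable E -> measurable_fun setT F -> (forall z, 0 <= F z)%E ->
  (\int[(P \x P')%E]_(z in E `*` setT) F z = \int[P]_(w in E) \int[P']_v F (w, v))%E.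
Proof.
move=> mE mF F0; rewrite integral_mkcond fubini_tonelli1.
- rewrite [RHS]integral_mkcond; apply: eq_integral => w _.
  rewrite /fubini_F patchE; case: ifPn => [wE|wE].
    apply: eq_integral => v _; rewrite patchE mem_set//=; split => //; exact: set_mem.
  rewrite integral0_eq// => v _; rewrite patchE memNset//= => -[wE' _].
  by move/negP: wE; apply; exact: mem_set.
- apply/(measurable_restrictT F (measurableX mE measurableT)).
  exact: measurable_funTS.
- by move=> z; rewrite patchE; case: ifP.
Qed.

(** A new time [u] after [t] is reached by an independent uniform variable,
    through the quantile function of the transition law from the state at time
    [t].  For [s < t] the Markov property between [s] and [u] combines the one
    between [s] and [t] with the Chapman-Kolmogorov equation. *)
Lemma chain_exists nu J : times J ->
  exists d (T : measurableType d) (P : probability T R) Z, chain nu J P Z.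
Proof.
move: J; apply: times_ind => [|u t J tu tJ [d [T [P [Z [mZ Z0 Zi Zm]]]]]].
  exists _, (measurableTypeR R), unif01, (fun=> quantile nu); split.
  - by move=> _; exact: measurable_quantile.
  - by move=> _ w; exact: quantile_ge0.
  - exact: quantile_law.
  - by move=> L B s t g _ _; rewrite !inE => /eqP -> /eqP ->; rewrite ltxx.
have t0 : 0 <= t by case/andP: (times_bound tJ (mem_head _ _)).
have u0 : 0 < u by exact: le_lt_trans tu.
have tJle r : r \in t :: J -> r <= t by move=> /(times_bound tJ)/andP[].
pose new (z : T * measurableTypeR R) : R := quantile (kern t u (Z t z.1)) z.2.
pose Z' (r : R) (z : T * measurableTypeR R) : R := if r == u then new z else Z r z.1.
pose P' : probability _ R := (P \x unif01)%E.
have mnew : measurable_fun setT new.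
  apply: (measurable_quantile_param (K := fun w => kern t u (Z t w))) => a _.
  exact: (measurableT_comp (kern_set t0 tu (measurable_itv `]-oo, a])) (mZ t)).
have Z'E r z : r \in t :: J -> Z' r z = Z r z.1.
  by move=> /tJle rt; rewrite /Z' lt_eqF// (le_lt_trans rt).
exists _, _, P', Z'; split.
- move=> r; rewrite /Z'; case: eqP => [_|_]; first exact: mnew.
  exact: (measurableT_comp (mZ r) measurable_fst).
- by move=> r z; rewrite /Z'; case: eqP => _ //; exact: quantile_ge0.
- move=> B mB; rewrite Zi//.
  rewrite (_ : _ @^-1` _ = (Z 0 @^-1` B) `*` setT); last first.
    apply/seteqP; split=> z /=; rewrite Z'E ?times_zero//; last by case.
  have mZB : measurable (Z 0 @^-1` B) by rewrite -[X in measurable X]setTI; exact: mZ.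
  have := product_measure1E P unif01 mZB measurableT.
  by rewrite [X in (_ * X)%E]probability_setT mule1 => <-.
move=> L B s r g LJ Ls sJ rJ sr mB mg g0.
have su : s < u.
  move: rJ; rewrite in_cons => /predU1P[<-//|/tJle rt].
  by rewrite (lt_le_trans sr)// (le_trans rt)// ltW.
have {}sJ : s \in t :: J by move: sJ; rewrite in_cons => /predU1P[su'|//]; rewrite su' ltxx in su.
have s0 : 0 <= s by case/andP: (times_bound tJ sJ).
have {}LJ : {subset L <= t :: J}.
  move=> q qL; have := LJ q qL; rewrite in_cons => /predU1P[qu|//].
  by have := le_lt_trans (Ls q qL) su; rewrite qu ltxx.
have mE : measurable (rect Z L B) by apply: rect_measurable.
have -> : rect Z' L B = rect Z L B `*` setT.
  apply/seteqP; split=> z /=.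
    by move=> BZ; split=> // q qL; rewrite -Z'E ?LJ//; exact: BZ.
  by move=> [BZ _] q qL; rewrite Z'E ?LJ//; exact: BZ.
have mZ' q : measurable_fun setT (Z' q).
  rewrite /Z'; case: eqP => [_|_]; first exact: mnew.
  exact: (measurableT_comp (mZ q) measurable_fst).
have mkk : measurable_fun setT (fun y => \int[kern s r y]_z g z)%E by exact: kern_measurable.
have cstI (c : \bar R) : (\int[unif01]_v c = c)%E.
  by rewrite integral_cst// [X in (_ * X)%E]probability_setT mule1.
have mgZ : measurable_fun setT (fun z => g (Z' r z)) := measurableT_comp mg (mZ' r).
have mkZ : measurable_fun setT (fun z => \int[kern s r (Z' s z)]_y g y)%E :=
  measurableT_comp mkk (mZ' s).
apply: (etrans (integral_prod_setX P unif01 mE mgZ (fun z => g0 _))).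
have kZ0 z : (0 <= \int[kern s r (Z' s z)]_y g y)%E by exact: integral_ge0.
apply: (etrans _ (esym (integral_prod_setX P unif01 mE mkZ kZ0))).
transitivity (\int[P]_(w in rect Z L B) \int[kern s r (Z s w)]_y g y)%E; last first.
  apply: eq_integral => w _.
  by under [RHS]eq_integral do rewrite (Z'E s)//=; rewrite cstI.
move: rJ; rewrite in_cons => /predU1P[ru|rJ]; last first.
  rewrite -Zm//; apply: eq_integral => w _.
  by under eq_integral do rewrite (Z'E r)//=; rewrite cstI.
rewrite ru.
have newE w : (\int[unif01]_v g (Z' u (w, v)) = \int[kern t u (Z t w)]_y g y)%E.
  rewrite (law_integral (measurable_quantile _) (quantile_law _) measurableT)//.
  by rewrite preimage_setT; apply: eq_integral => v _; rewrite /Z' eqxx.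
under eq_integral do rewrite newE.
(* Only the step from [t] to [u] uses the new variable; earlier states are
   reached through [t]. *)
have := tJle s sJ; rewrite le_eqVlt => /predU1P[->//|st].
have mku := kern_measurable t0 tu mg g0.
have ku0 y : (0 <= \int[kern t u y]_z g z)%E by exact: integral_ge0.
apply: (etrans (Zm L B s t _ LJ Ls sJ (mem_head _ _) st mB mku ku0)).
by apply: eq_integral => w _; rewrite -kern_chapman.
Qed.

End transition_kernels.

(** * Identities of measures and integrals on generating classes *)

(** Agreement on [G] extends to the sigma-algebra generated by [G] and to the
    functions that are measurable for it, even when the two probabilities live
    on spaces with larger sigma-algebras, because [phi] and [phi'] push both
    of them forward to that sigma-algebra. *)
Section transfer.
Context {R : realType} {X : pointedType} (G : set (set X)).
Hypotheses (GT : G setT) (GI : setI_closed G).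
Context d (T : measurableType d) (P : probability T R) (phi : T -> X).
Context d' (T' : measurableType d') (P' : probability T' R) (phi' : T' -> X).
Hypotheses (mphi : forall E, G E -> measurable (phi @^-1` E))
  (mphi' : forall E, G E -> measurable (phi' @^-1` E))
  (PG : forall E, G E -> P (phi @^-1` E) = P' (phi' @^-1` E)).

Let X' := g_sigma_algebraType G.

Let measurable_to d0 (T0 : measurableType d0) (f : T0 -> X) :
  (forall E, G E -> measurable (f @^-1` E)) -> measurable_fun setT (f : T0 -> X').
Proof.
move=> mf; apply: (@measurability _ _ _ X' _ _ G erefl) => _ [E GE <-].
by rewrite setTI; exact: mf.
Qed.

Let Phi1 : {mfun T >-> X'} := mfun_Sub (mem_set (measurable_to mphi)).
Let Phi2 : {mfun T' >-> X'} := mfun_Sub (mem_set (measurable_to mphi')).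

Lemma transfer_probability E : <<s G >> E -> P (phi @^-1` E) = P' (phi' @^-1` E).
Proof.
apply: (@g_sigma_algebra_measure_unique _ R X' G _ (fun=> setT) _ _
  (distribution P Phi1) (distribution P' Phi2)) => //.
- exact: sub_sigma_algebra.
- by apply/seteqP; split => // x _; exists 0%N.
- by move=> _; rewrite [ltLHS]probability_setT ltry.
Qed.

Lemma transfer_integral D (g : X' -> \bar R) : <<s G >> D ->
  measurable_fun setT g -> (forall x, 0 <= g x)%E ->
  (\int[P]_(w in phi @^-1` D) g (phi w) = \int[P']_(w in phi' @^-1` D) g (phi' w))%E.
Proof.
move=> mD mg g0.
have mgD : measurable_fun (D : set X') g by exact: measurable_funTS.
transitivity (\int[distribution P Phi1]_(x in D) g x)%E.
  by rewrite ge0_integral_pushforward//; exact: measurable_to.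
transitivity (\int[distribution P' Phi2]_(x in D) g x)%E.
  by apply: eq_measure_integral => E mE _; exact: transfer_probability.
by rewrite ge0_integral_pushforward//; exact: measurable_to.
Qed.

End transfer.

Section pi_system_integral.
Context {R : realType} d (T : measurableType d) (P : probability T R).
Variables (G : set (set T)) (f g : T -> \bar R).
Hypotheses (GT : G setT) (GI : setI_closed G) (mG : forall E, G E -> measurable E)
  (mf : measurable_fun setT f) (mg : measurable_fun setT g)
  (f0 : forall w, (0 <= f w)%E) (g0 : forall w, (0 <= g w)%E)
  (f1 : (\int[P]_w f w < +oo)%E)
  (fg : forall E, G E -> (\int[P]_(w in E) f w = \int[P]_(w in E) g w)%E).

Let nu (k : T -> \bar R) (E : set T) := (\int[P]_(w in E) k w)%E.

Lemma pi_system_integral E : <<s G >> E ->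
  (\int[P]_(w in E) f w = \int[P]_(w in E) g w)%E.
Proof.
have nu0 k : nu k set0 = 0%E by exact: integral_set0.
have nuge0 k : (forall w, (0 <= k w)%E) -> forall E, (0 <= nu k E)%E.
  by move=> k0 F; exact: integral_ge0.
have nus k : measurable_fun setT k -> (forall w, (0 <= k w)%E) -> semi_sigma_additive (nu k).
  by move=> mk k0; exact: semi_sigma_additive_nng_induced.
pose nuf : {measure set T -> \bar R} := HB.pack (nu f)
  (isMeasure.Build _ _ _ (nu f) (nu0 f) (nuge0 f f0) (nus f mf f0)).
pose nug : {measure set T -> \bar R} := HB.pack (nu g)
  (isMeasure.Build _ _ _ (nu g) (nu0 g) (nuge0 g g0) (nus g mg g0)).
apply: (@g_sigma_algebra_measure_unique _ R T G _ (fun=> setT) _ _ nuf nug) => //.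
- by apply/seteqP; split => // x _; exists 0%N.
Qed.

End pi_system_integral.

(** * The extension to all times *)

Section rational_cuts.
Context {R : realType}.

(** The nonnegative real number coded by the upper set [b] of rationals; any [b]
    is allowed, and the value is then still nonnegative and measurable. *)
Definition cut_value (b : rat -> bool) : R :=
  inf [set x : R | exists q : rat, [/\ 0 <= ratr q :> R, b q & x = ratr q]].

Lemma cut_value_ge0 b : 0 <= cut_value b.
Proof.
rewrite /cut_value; set S := [set _ | _].
have [->|/set0P S0] := eqVneq S set0; first by rewrite inf0.
by apply: lb_le_inf => // _ [q [q0 _ ->]].
Qed.

Lemma cut_value_lt b a :
  (cut_value b < a) <->
  (0 < a /\ ((forall q : rat, 0 <= ratr q :> R -> ~~ b q) \/
             exists q : rat, [/\ 0 <= ratr q :> R, b q & ratr q < a])).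
Proof.
rewrite /cut_value; set S := [set _ | _].
have lbS : has_lbound S by exists 0 => _ [q [q0 _ ->]].
split.
  move=> ba; split; first exact: le_lt_trans (cut_value_ge0 b) ba.
  have [S0|/set0P S0] := eqVneq S set0.
    left=> q q0; apply/negP => bq.
    have : S (ratr q) by exists q.
    by rewrite S0.
  have [_ [q [q0 bq ->]] qa] := inf_lt S0 ba.
  by right; exists q.
move=> [a0 [bF|[q [q0 bq qa]]]].
  rewrite (_ : S = set0) ?inf0//; apply/seteqP; split => // x [q [q0 bq xq]].
  by have := bF q q0; rewrite bq.
by apply: le_lt_trans qa; apply: ge_inf => //; exists q.
Qed.

Lemma cut_valueK (y : R) : 0 <= y -> cut_value (fun q => y < ratr q) = y.
Proof.
move=> y0; apply/eqP; rewrite eq_le; apply/andP; split.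
  rewrite leNgt; apply/negP => /rat_in_itvoo[q]; rewrite in_itv/= => /andP[yq].
  apply/negP; rewrite -leNgt; apply: ge_inf; first by exists 0 => _ [r [r0 _ ->]].
  by exists q; split => //; rewrite ltW// (le_lt_trans y0).
rewrite leNgt; apply/negP => /cut_value_lt[_ [/(_ _ _)/negP yF|[q [_ yq]]]]; last first.
  by rewrite ltNge (ltW yq).
have y1 : y < y + 1 by rewrite ltrDl.
have [q] := rat_in_itvoo y1; rewrite in_itv/= => /andP[yq _].
by apply: (yF q) => //; rewrite ltW// (le_lt_trans y0).
Qed.

Lemma measurable_cut_value d (T : measurableType d) (b : T -> rat -> bool) :
  (forall q, measurable [set x | b x q]) -> measurable_fun setT (fun x => cut_value (b x)).
Proof.
move=> mb; apply: (measurability _ (RGenInftyO.measurableE R)) => //.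
move=> _ [_ [a ->] <-]; rewrite setTI.
have mpos (q : rat) : measurable [set x | (0 <= ratr q :> R) && b x q].
  case: (0 <= ratr q) => //=; rewrite (_ : [set x | _] = set0)//.
  by apply/seteqP; split=> x.
have mlt (q : rat) : measurable [set x | [&& 0 <= ratr q :> R, b x q & ratr q < a]].
  case: (ratr q < a) => /=; last first.
    rewrite (_ : [set x | _] = set0)//; apply/seteqP; split => // x /=.
    by rewrite andbF andbF.
  by under eq_set do rewrite andbT; exact: mpos.
have [a0|a0] := leP a 0.
  rewrite (_ : _ @^-1` _ = set0)//; apply/seteqP; split => // x /=.
  by rewrite in_itv/= => /cut_value_lt[] /lt_geF; rewrite a0.
rewrite (_ : _ @^-1` _ = ~` (\bigcup_q [set x | (0 <= ratr q :> R) && b x q]) `|`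
   \bigcup_q [set x | [&& 0 <= ratr q :> R, b x q & ratr q < a]]).
  apply: measurableU; last exact: bigcupT_measurable_rat.
  by apply: measurableC; exact: bigcupT_measurable_rat.
apply/seteqP; split => x /=; rewrite in_itv/=.
  move=> /cut_value_lt[_ [bF|[q [q0 bq qa]]]].
    by left=> -[q _ /= /andP[q0]]; apply/negP; exact: bF.
  by right; exists q => //=; rewrite q0 bq.
move=> bP; apply/cut_value_lt; split => //; case: bP => [bF|[q _ /= /and3P[q0 bq qa]]].
  by left=> q q0; apply/negP => bq; apply: bF; exists q => //=; rewrite q0.
by right; exists q.
Qed.

End rational_cuts.

Section process_extension.
Context {R : realType} (p : R -> R -> R -> Pplus R) (nu : Pplus R).
Hypothesis p_transition : transition_function p.

Let idx : choiceType := (R * rat)%type.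

(** Coordinates are read at the absolute value of their time, so that the points
   of the coding space with negative times need no separate treatment. *)
Let encode (z : R -> R) : bits idx := fun i => z `|i.1| < ratr i.2.

Let coord (t : R) (w : bits idx) : R := cut_value (fun q => w (t, q)).

Let coord_encode z t : (forall r, 0 <= z r) -> coord t (encode z) = z `|t|.
Proof. by move=> z0; rewrite /coord /encode/= cut_valueK. Qed.

Let supported (J : seq R) : set (set (bits idx)) :=
  [set C | exists L : seq idx, (forall i, i \in L -> `|i.1| \in J) /\ depends_on L C].

Let supportedI J : setI_closed (supported J).
Proof.
move=> C D [L [LJ dC]] [L' [L'J dD]]; exists (L ++ L'); split.
  by move=> i; rewrite mem_cat => /orP[/LJ|/L'J].
apply: depends_onI.
  by apply: depends_on_sub dC => i; rewrite mem_cat => ->.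
by apply: depends_on_sub dD => i; rewrite mem_cat => ->; rewrite orbT.
Qed.

Let supported_cylinder J C : supported J C -> cylinder C.
Proof. by move=> [L [_ dC]]; exists L. Qed.

Let supported_sub J J' C : {subset J <= J'} -> supported J C -> supported J' C.
Proof. by move=> JJ' [L [LJ dC]]; exists L; split=> // i /LJ/JJ'. Qed.

Let cylinder_supported C : cylinder C -> exists2 J, times J & supported J C.
Proof.
move=> [L dC]; have [|J tJ LJ] := @times_exist R [seq `|i.1| | i <- L].
  by move=> _ /mapP[i _ ->].
by exists J => //; exists L; split=> // i iL; apply: LJ; apply/mapP; exists i.
Qed.

Let paths (J : seq R) : set (set (R -> R)) :=
  [set E | exists B : R -> set R, (forall r, measurable (B r)) /\ E = rect (fun t z => z t) J B].

Let pathsT J : paths J setT.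
Proof. by exists (fun=> setT); split => //; apply/seteqP; split. Qed.

Let pathsI J : setI_closed (paths J).
Proof.
move=> _ _ [B [mB ->]] [B' [mB' ->]]; exists (fun r => B r `&` B' r).
split=> [r|]; first exact: measurableI.
apply/seteqP; split=> [z [zB zB'] r rJ|z zBB']; first by split; [exact: zB|exact: zB'].
by split=> r rJ; have [] := zBB' r rJ.
Qed.

Let path_event J t (B : set R) : t \in J -> measurable B ->
  <<s paths J >> [set z | B (z t)].
Proof.
move=> tJ mB; apply: sub_sigma_algebra; exists (fun r => if r == t then B else setT).
split; first by move=> r; case: ifP.
apply/seteqP; split=> [z zB r rJ|z zB] /=; first by case: eqP => [->|].
by have := zB t tJ; rewrite eqxx.
Qed.

Let encode_supported J C : supported J C -> <<s paths J >> (encode @^-1` C).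
Proof.
move=> [L [LJ dC]].
apply: (@depends_on_preimage _ _ (g_sigma_algebraType (paths J)) _ L) => // i iL.
have := path_event (LJ i iL) (measurable_itv `]-oo, (ratr i.2 : R)[).
congr (<<s _ >> _); apply/seteqP; split=> z /=; by rewrite in_itv.
Qed.

Let chain_path_event J d (T : measurableType d) (P : probability T R) Z E :
  chain p nu J P Z -> paths J E -> measurable ([set w | E (Z ^~ w)]).
Proof.
move=> c [B [mB ->]]; apply: (@rect_measurable _ _ _ Z J B) => // t _.
exact: (chain_measurable c).
Qed.

Let chain_encode d (T : measurableType d) (P : probability T R) Z J C :
  chain p nu J P Z -> cylinder C -> measurable [set w | C (encode (Z ^~ w))].
Proof.
move=> c [L dC]; apply: (@depends_on_preimage _ _ _ (fun w => encode (Z ^~ w)) L) => // i iL.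
rewrite -[X in measurable X]setTI (_ : [set w | _] = Z `|i.1| @^-1` `]-oo, ratr i.2[).
  by apply: (chain_measurable c) => //; exact: measurable_itv.
by apply/seteqP; split=> w /=; rewrite in_itv.
Qed.

(** Chains on the same times have the same law on rectangles, hence on the
   sigma-algebra they generate, which contains the codes of cylinders. *)
Let chain_agree J d (T : measurableType d) (P : probability T R) Z
    d' (T' : measurableType d') (P' : probability T' R) Z' C : times J ->
  chain p nu J P Z -> chain p nu J P' Z' -> supported J C ->
  P [set w | C (encode (Z ^~ w))] = P' [set w | C (encode (Z' ^~ w))].
Proof.
move=> tJ c c' /encode_supported.
apply: (transfer_probability (pathsT J) (@pathsI J)).
- by move=> E pE; exact: (chain_path_event c pE).
- by move=> E pE; exact: (chain_path_event c' pE).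
move=> _ [B [mB ->]].
have := chain_unique p_transition tJ c c' mB (@measurable_cst _ _ _ _ setT (1%E : \bar R)) (fun _ : R => lee01).
have m1 : measurable (rect Z J B).
  by apply: rect_measurable => // t _; exact: (chain_measurable c).
have m2 : measurable (rect Z' J B).
  by apply: rect_measurable => // t _; exact: (chain_measurable c').
by rewrite !integral_cst// !mul1e.
Qed.

(** A cylinder may be supported by several lists of times; a chain on a list that
   contains two of them shows that the two probabilities agree. *)
Let content_exists : exists Q0 : set (bits idx) -> \bar R,
  (forall C, (0 <= Q0 C)%E) /\
  forall C J d (T : measurableType d) (P : probability T R) Z, times J ->
    supported J C -> chain p nu J P Z -> Q0 C = P [set w | C (encode (Z ^~ w))].
Proof.
suff /choice[Q0 Q0P] : forall C, exists r : \bar R, (0 <= r)%E /\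
    forall J d (T : measurableType d) (P : probability T R) Z, times J ->
    supported J C -> chain p nu J P Z -> r = P [set w | C (encode (Z ^~ w))].
  by exists Q0; split=> [C|C]; have [] := Q0P C.
move=> C; have [/cylinder_supported[J0 t0 JC]|nC] := pselect (cylinder C); last first.
  by exists 0%E; split => // J d T P Z tJ /supported_cylinder.
have [d0 [T0 [P0 [Z0 c0]]]] := chain_exists p_transition nu t0.
exists (P0 [set w | C (encode (Z0 ^~ w))]); split => // J d T P Z tJ sJ c.
(* A chain on a common refinement of the two lists. *)
have [|J1 t1 J1P] := @times_exist R (J0 ++ J).
  move=> r; rewrite mem_cat.
  by case/orP => [/(times_bound t0)/andP[]|/(times_bound tJ)/andP[]].
have [d1 [T1 [P1 [Z1 c1]]]] := chain_exists p_transition nu t1.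
transitivity (P1 [set w | C (encode (Z1 ^~ w))]).
  apply: (chain_agree t0) => //; apply: chain_sub c1 => r rJ.
  by apply: J1P; rewrite mem_cat rJ.
apply: (chain_agree tJ) => //; apply: chain_sub c1 => r rJ.
by apply: J1P; rewrite mem_cat rJ orbT.
Qed.

Let bitsM := g_sigma_algebraType (measurable : set (set (bits idx))).

Let measurable_coord t : measurable_fun setT (coord t : bitsM -> R).
Proof.
apply: (@measurable_cut_value R _ bitsM (fun w q => w (t, q))) => q.
apply: sub_sigma_algebra; exists [:: (t, q)] => w w' ww' /=.
by rewrite ww'// mem_head.
Qed.

Let extension_exists : exists Q : probability bitsM R,
  forall C J d (T : measurableType d) (P : probability T R) Z, times J ->
    supported J C -> chain p nu J P Z -> Q C = P [set w | C (encode (Z ^~ w))].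
Proof.
have [Q0 [Q0_ge0 Q0E]] := content_exists.
have sub0 C : cylinder C -> exists2 J, times J & supported J C by exact: cylinder_supported.
have [||||Q QE] := @cylinder_extension R idx Q0.
- exact: Q0_ge0.
- have [J tJ sJ] := sub0 _ cylinder0; have [d [T [P [Z c]]]] := chain_exists p_transition nu tJ.
  by rewrite (Q0E _ _ _ _ _ _ tJ sJ c) (_ : [set w | _] = set0)//.
- have [J tJ sJ] := sub0 _ (@measurableT _ (bits idx)).
  have [d [T [P [Z c]]]] := chain_exists p_transition nu tJ.
  by rewrite (Q0E _ _ _ _ _ _ tJ sJ c); exact: probability_setT.
- move=> C D cC cD CD; have [J tJ sC] := sub0 _ cC; have [J' tJ' sD] := sub0 _ cD.
  have [|J1 t1 J1P] := @times_exist R (J ++ J').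
    move=> r; rewrite mem_cat.
    by case/orP => [/(times_bound tJ)/andP[]|/(times_bound tJ')/andP[]].
  have [d [T [P [Z c]]]] := chain_exists p_transition nu t1.
  have sC1 : supported J1 C.
    by apply: supported_sub sC => r rJ; apply: J1P; rewrite mem_cat rJ.
  have sD1 : supported J1 D.
    by apply: supported_sub sD => r rJ; apply: J1P; rewrite mem_cat rJ orbT.
  have sU : supported J1 (C `|` D).
    have [L [LJ dC]] := sC1; have [L' [LJ' dD]] := sD1; exists (L ++ L'); split.
      by move=> i; rewrite mem_cat => /orP[/LJ|/LJ'].
    apply: depends_onU.
      by apply: depends_on_sub dC => i; rewrite mem_cat => ->.
    by apply: depends_on_sub dD => i; rewrite mem_cat => ->; rewrite orbT.
  rewrite (Q0E _ _ _ _ _ _ t1 sC1 c) (Q0E _ _ _ _ _ _ t1 sD1 c) (Q0E _ _ _ _ _ _ t1 sU c).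
  rewrite -measureU//.
  + exact: (chain_encode c).
  + exact: (chain_encode c).
  + apply/seteqP; split => // w [/= Cw Dw].
    by have : (C `&` D) (encode (Z ^~ w)) by []; rewrite CD.
exists Q => C J d T P Z tJ sJ c; rewrite QE; first exact: (Q0E _ _ _ _ _ _ tJ sJ c).
exact: supported_cylinder sJ.
Qed.

Let coord_supported J t : times J -> t \in J ->
  measurable_fun setT (coord t : g_sigma_algebraType (supported J) -> R).
Proof.
move=> tJ tin; have /andP[t0 _] := times_bound tJ tin.
apply: (@measurable_cut_value R _ (g_sigma_algebraType (supported J))
  (fun w q => w (t, q))) => q.
apply: sub_sigma_algebra; exists [:: (t, q)]; split.
  by move=> i; rewrite inE => /eqP ->/=; rewrite ger0_norm.
by move=> w w' ww' /=; rewrite ww'// mem_head.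
Qed.

(** The extension has the law of the chains on every finite list of times.  Since
   the decoded process is defined on cylinders, this is transferred through the
   sigma-algebra of the cylinders supported by [J]. *)
Let extension_integral (Q : probability bitsM R) :
  (forall C J d (T : measurableType d) (P : probability T R) Z, times J ->
    supported J C -> chain p nu J P Z -> Q C = P [set w | C (encode (Z ^~ w))]) ->
  forall J d (T : measurableType d) (P : probability T R) Z, times J -> chain p nu J P Z ->
  forall L B t (g : R -> \bar R), {subset L <= J} -> t \in J ->
    (forall r, measurable (B r)) -> measurable_fun setT g -> (forall y : R, 0 <= g y)%E ->
    (\int[Q]_(w in rect coord L B) g (coord t w) =
     \int[P]_(w in rect Z L B) g (Z t w))%E.
Proof.
move=> QE J d T P Z tJ c L B t g LJ tin mB mg g0.
have Z0 w r : 0 <= Z r w by exact: (chain_ge0 c).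
have J0 r : r \in J -> 0 <= r by move=> /(times_bound tJ)/andP[].
have mD : <<s supported J >> (rect coord L B).
  apply: (@rect_measurable _ _ (g_sigma_algebraType (supported J)) coord) => // r rL.
  by apply: coord_supported => //; exact: LJ.
have mgt : measurable_fun setT (fun w : g_sigma_algebraType (supported J) => g (coord t w)).
  exact: (measurableT_comp mg (coord_supported tJ tin)).
have sT : supported J setT by exists [::].
have := @transfer_integral R (bits idx) (supported J) sT (@supportedI J)
  _ bitsM Q id _ T P (fun w => encode (Z ^~ w)) _ _ _ (rect coord L B) _ mD mgt.
move=> -> //.
- rewrite (_ : _ @^-1` _ = rect Z L B); last first.
    by apply/seteqP; split=> w wB r rL; have := wB r rL;
      rewrite coord_encode// ger0_norm// J0// LJ.
  by apply: eq_integral => w _; rewrite coord_encode// ger0_norm// J0.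
- by move=> E /supported_cylinder cE; apply: sub_sigma_algebra.
- by move=> E /supported_cylinder cE; exact: (chain_encode c).
- by move=> E sE; rewrite preimage_id (QE _ _ _ _ _ _ tJ sE c).
Qed.

(** Two measures that agree on rectangles agree on the past, so the Markov
    property follows from that of the chains. *)
Theorem markov_process_exists :
  exists (d : measure_display) (T : measurableType d) (Q : probability T R)
    (Y : R -> {RV Q >-> R}), has_initial_law Y nu /\ markov_process Y p.
Proof.
have [Q QE] := extension_exists.
have QI := extension_integral QE.
pose Y t : {RV Q >-> R} := mfun_Sub (mem_set (measurable_coord t)).
exists _, bitsM, Q, Y; split.
  move=> B mB.
  have t0 : times [:: 0 : R] by rewrite /times/= ?eqxx.
  have [d [T [P [Z c]]]] := chain_exists p_transition nu t0.
  have := QI _ _ _ _ _ t0 c [:: 0] (fun=> B) 0 (cst 1%E) _ _ _ _ _.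
  rewrite !rect_cons !rect_nil !setTI => QIB.
  rewrite (chain_initial c)//.
  have mYB : measurable (Y 0 @^-1` B) by rewrite -[X in measurable X]setTI; exact: measurable_funP.
  have mZB : measurable (Z 0 @^-1` B).
    by rewrite -[X in measurable X]setTI; exact: (chain_measurable c).
  move: QIB; rewrite !integral_cst// !mul1e; apply => //.
  by rewrite mem_head.
split => //.
- by move=> t w _; exact: cut_value_ge0.
move=> s t E B s0 st pE mB.
pose G : set (set bitsM) := [set E | exists L B, [/\ forall r, r \in L -> 0 <= r <= s,
  forall r, measurable (B r : set R) & E = rect coord L B]].
have gB0 (y : R) : (0 <= (\1_B y)%:E :> \bar R)%E by [].
have mgB : measurable_fun setT (fun y : R => (\1_B y)%:E : \bar R).
  by apply/measurable_EFinP; exact: measurable_indic.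
have kB (y : R) : (\int[kern p s t y]_z (\1_B z)%:E = kern p s t y B)%E.
  by rewrite integral_indic// setIT.
have mk := kern_measurable p_transition s0 st mgB gB0.
have GT : G setT by exists [::], (fun=> setT); split => //; rewrite rect_nil.
have GI : setI_closed G.
  move=> _ _ [L [C [Ls mC ->]]] [L' [C' [L's mC' ->]]].
  exists (L ++ L'), (fun r => (if r \in L then C r else setT) `&`
    (if r \in L' then C' r else setT)); split.
  - by move=> r; rewrite mem_cat => /orP[/Ls|/L's].
  - by move=> r; apply: measurableI; case: ifP.
  - apply/seteqP; split=> w.
      move=> [wC wC'] r _; split; case: ifPn => // rL; [exact: wC|exact: wC'].
    by move=> wCC'; split=> r rL; have := wCC' r; rewrite mem_cat rL ?orbT => /(_ isT)[].
have mG D : G D -> measurable D.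
  move=> [L [C [_ mC ->]]]; apply: rect_measurable => // r _; exact: measurable_coord.
have {pE}GE : <<s G >> E.
  move: pE; apply: sub_sigma_algebra2 => _ [r [C [rs mC ->]]].
  exists [:: r], (fun=> C); split => //; first by move=> q; rewrite inE => /eqP ->.
  by rewrite rect_cons rect_nil setTI.
have mE : measurable E := smallest_sub (@sigma_algebra_measurable _ bitsM) mG GE.
have mYtB : measurable (Y t @^-1` B) by rewrite -[X in measurable X]setTI; exact: measurable_funP.
have indicE D : measurable D -> (\int[Q]_(w in D) (\1_B (coord t w))%:E = Q (D `&` Y t @^-1` B))%E.
  by move=> mD; rewrite setIC -(@integral_indic _ _ _ Q D mD (Y t @^-1` B)).
rewrite -indicE//.
transitivity (\int[Q]_(w in E) \int[kern p s t (coord s w)]_z (\1_B z)%:E)%E; last first.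
  by apply: eq_integral => w _; rewrite kB /kern ger0_norm// cut_value_ge0.
apply: (@pi_system_integral R _ _ Q G) => //.
- exact: (measurableT_comp mgB (measurable_coord t)).
- exact: (measurableT_comp mk (measurable_coord s)).
- by move=> w; exact: integral_ge0.
- by rewrite indicE// (le_lt_trans (probability_le1 _ _)) ?ltry//; exact: measurableI.
move=> _ [L [C [Ls mC ->]]].
have [|J tJ JP] := @times_exist R (s :: t :: L).
  move=> r; rewrite !in_cons => /predU1P[->//|/predU1P[->|/Ls/andP[]//]].
  by rewrite ltW// (le_lt_trans s0).
have [d [T [P [Z c]]]] := chain_exists p_transition nu tJ.
have sJ : s \in J by apply: JP; rewrite mem_head.
have tJ' : t \in J by apply: JP; rewrite !in_cons eqxx orbT.
have LJ : {subset L <= J} by move=> r rL; apply: JP; rewrite !in_cons rL !orbT.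
rewrite (QI _ _ _ _ _ tJ c L C t _ LJ tJ' mC mgB gB0).
rewrite (chain_markov c LJ _ sJ tJ' st mC mgB gB0)//; last by move=> r /Ls/andP[].
by rewrite -(QI _ _ _ _ _ tJ c L C s _ LJ sJ mC mk)// => y; exact: integral_ge0.
Qed.

End process_extension.

Theorem theorem5p2 (R : realType) (op : Pplus R -> Pplus R -> Pplus R)
    (h : Pplus R -> R) (kappa x0 : R) (lambda : Pplus R) (A : R)
    (m : {finite_measure set R -> \bar R})
    (d : measure_display) (T : measurableType d) (P : probability T R)
    (X : R -> {RV P >-> R})
    (op_conv : generalized_convolution op)
    (h_regular : regular_homomorphism op h)
    (kappa_exponent : is_characteristic_exponent h kappa)
    (x0_gt0 : 0 < x0)
    (Omega_lt1 : forall x, 0 < x <= x0 -> Omega h x < 1)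
    (lambda_id : infinitely_decomposable op lambda)
    (lambda_repr : levy_khintchine h kappa x0 lambda A m)
    (X_levy : levy_process X op lambda)
    (f : R -> R) (f_class : class_A h kappa x0 m f) :
  exists Pf : R -> R -> Pplus R,
    (forall s t u, 0 <= s -> s < t -> 0 <= u ->
       (Phi h (Pf s t) u)%:E = Psi h kappa x0 A m f s t u) /\
    (forall nu : Pplus R,
       exists (d' : measure_display) (T' : measurableType d')
              (Q : probability T' R) (Y : R -> {RV Q >-> R}),
         [/\ has_initial_law Y nu,
             markov_process Y (fun s t x => op (delta x) (Pf s t)) &
             additive_process Y op]).
Proof.
have [A_ge0 _ Phi_lambda] := lambda_repr.
have [Pf PfE] : exists Pf : R -> R -> Pplus R, forall s t, 0 <= s -> s < t ->
    forall u, 0 <= u -> (Phi h (Pf s t) u)%:E =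
    expeR (- \int[lebesgue_measure]_(x in `[s, t]) levy_exponent h kappa x0 A m (u * f x)).
  have /choice[Pf PfE] : forall st : R * R, exists mu : Pplus R,
      0 <= st.1 -> st.1 < st.2 -> forall u, 0 <= u -> (Phi h mu u)%:E =
      expeR (- \int[lebesgue_measure]_(x in `[st.1, st.2])
        levy_exponent h kappa x0 A m (u * f x)).
    move=> [s t] /=; have [/andP[s0 st]|nst] := boolP ((0 <= s) && (s < t)).
      have [mu muE] := gcf_Psi op_conv h_regular kappa_exponent x0_gt0 Omega_lt1 A_ge0
        lambda_id Phi_lambda f_class s0 st.
      by exists mu.
    by exists lambda => s0 st; move: nst; rewrite s0 st.
  by exists (fun s t => Pf (s, t)) => s t; exact: (PfE (s, t)).
have Pf_op := time_integral_semigroup op_conv h_regular kappa_exponent x0_gt0 Omega_lt1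
  A_ge0 f_class (fun s t u s0 st => PfE s t s0 st u).
exists Pf; split.
  move=> s t u s0 st u0.
  rewrite (Psi_levy_exponent op_conv h_regular kappa_exponent x0_gt0 Omega_lt1 A_ge0)//.
  exact: PfE.
move=> nu; have p_transition := additive_transition_function op_conv Pf_op.
have [d' [T' [Q [Y [Y_initial Y_markov]]]]] := markov_process_exists nu p_transition.
by exists d', T', Q, Y; split => //; exists Pf.
Qed.
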